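(* Let $H$ be a real separable Hilbert space, $T>0$, and $\phi=\phi_1+\phi_2:H\to(-\infty,\infty]$ with $\phi_1$ proper, convex, lower semicontinuous and $\partial\phi_1$ single-valued (where nonempty), $\phi_2\in C^{1,1}(H)$, such that $\phi$ has compact sublevel sets and satisfies the chain rule stated in the context. Let $y_0\in D(\phi)$, $U\ne\emptyset$ compact in $L^2(0,T;H)$, $X:=L^2(0,T;H)\times H^1(0,T;H)$ with $\tau$ = strong $\times$ weak topology, $F:X\to[0,\infty]$ $\tau$-lower semicontinuous with $F(u,y)<\infty$ only if $u\in U$, and $E_\varepsilon:=F+\varepsilon^{-1}G_{\rm DG}$. Then $\min E_\varepsilon$ admits a solution for all $\varepsilon>0$; $E_\varepsilon$ $\Gamma$-converges w.r.t. $\tau$ to $E_0$, with $E_0=F$ on $\{G_{\rm DG}=0\}$ and $E_0=\infty$ otherwise; every sequence of quasiminimizers has a subsequence $\tau$-converging to a minimizer of $E_0$; and if $E_0$ has a unique minimizer, every sequence of quasiminimizers $\tau$-converges to it.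
   Context: $\partial\phi$ is the Fréchet subdifferential: $\xi\in\partial\phi(y)$ iff $y\in D(\phi)$ and $\liminf_{w\to y}\frac{\phi(w)-\phi(y)-(\xi,w-y)}{\|w-y\|}\ge0$; here $\partial\phi=\partial\phi_1+D\phi_2$ is single-valued on $D(\partial\phi)=\{y:\partial\phi(y)\ne\emptyset\}$. Chain rule: if $y\in H^1(0,T;H)$, $\xi\in L^2(0,T;H)$ and $\xi(t)\in\partial\phi(y(t))$ for a.e. $t$, then $\phi\circ y$ is absolutely continuous on $[0,T]$ and $(\phi\circ y)'=(\xi,y')$ a.e. De Giorgi functional: for $(u,y)\in X$, $G_{\rm DG}(u,y)=\int_0^T\big(\frac12\|y'\|^2+\frac12\|\partial\phi(y)-u\|^2-(u,y')\big)\,dt+\phi(y(T))-\phi(y_0)$ if $y(t)\in D(\partial\phi)$ for a.e. $t$ and $y(0)=y_0$, and $G_{\rm DG}(u,y)=\infty$ otherwise. For each $u\in L^2(0,T;H)$, $G_{\rm DG}(u,y)=0$ iff $y\in H^1(0,T;H)$ solves $y'+\partial\phi(y)\ni u$ a.e., $y(0)=y_0$. Quasiminimizers: $\lim(E_\varepsilon(x_\varepsilon)-\inf E_\varepsilon)=0$; $\Gamma$-convergence is sequential. *)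

(* Defs.v *)
From HB Require Import structures.
From Stdlib Require ClassicalEpsilon.
From mathcomp Require Import all_boot all_order all_algebra.
From mathcomp Require Import all_classical all_reals all_analysis.
Set Implicit Arguments. Unset Strict Implicit. Unset Printing Implicit Defensive.
Import Order.TTheory GRing.Theory Num.Theory numFieldNormedType.Exports.
Local Open Scope classical_set_scope.
Local Open Scope ring_scope.

Section GradientFlowDefs.
Context {R : realType} {H : normedModType R}.
Variable ip : H -> H -> R.

Notation mu := (@lebesgue_measure R).

Definition is_inner_product :=
  [/\ forall x y, ip x y = ip y x,
      forall (a : R) x y z, ip (a *: x + y) z = a * ip x z + ip y z &
      forall x, ip x x = `|x| ^+ 2].

Definition separable_space := exists D : set H, countable D /\ dense D.

Definition strongly_measurable (T : R) (u : R -> H) :=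
  exists s : nat -> R -> H,
    (forall n, finite_set (range (s n))) /\
    (forall n v, measurable (`[0%R, T]%classic `&` (s n @^-1` [set v]))) /\
    {ae mu, forall t, `[0%R, T]%classic t -> (fun n => s n t) @ \oo --> u t}.

Definition L2 (T : R) (u : R -> H) :=
  strongly_measurable T u /\
  (\int[mu]_(t in `[0%R, T]%classic) (`|u t| ^+ 2)%:E < +oo)%E.

(* g is the (weak) derivative of y in L^2(0,T;H), y being the continuous
   representative: y(t) = y(0) + \int_0^t g  (tested against every h). *)
Definition is_deriv (T : R) (y g : R -> H) :=
  L2 T g /\ forall t, `[0%R, T]%classic t -> forall h,
    (ip (y t) h)%:E = ((ip (y 0) h)%:E + \int[mu]_(s in `[0%R, t]%classic) (ip (g s) h)%:E)%E.

Definition H1 (T : R) (y : R -> H) := L2 T y /\ exists g, is_deriv T y g.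

(* the derivative y' of y (determined a.e.) *)
Definition dH1 (T : R) (y : R -> H) : R -> H :=
  ClassicalEpsilon.epsilon (inhabits (fun _ : R => (0 : H))) (is_deriv T y).

Definition InX (T : R) (u y : R -> H) := L2 T u /\ H1 T y.
Definition Xset (T : R) : set ((R -> H) * (R -> H)) := [set x | InX T x.1 x.2].

(* equality in X (u up to a.e. equality, y its continuous representative) *)
Definition Xeq (T : R) (x x' : (R -> H) * (R -> H)) :=
  {ae mu, forall t, `[0%R, T]%classic t -> x.1 t = x'.1 t} /\
  forall t, `[0%R, T]%classic t -> x.2 t = x'.2 t.

Definition L2_cvg (T : R) (un : nat -> R -> H) (u : R -> H) :=
  (fun n => (\int[mu]_(t in `[0%R, T]%classic) (`|un n t - u t| ^+ 2)%:E)%E) @ \oo --> 0%E.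

Definition H1_ip (T : R) (y z : R -> H) : \bar R :=
  (\int[mu]_(t in `[0%R, T]%classic) (ip (y t) (z t))%:E +
   \int[mu]_(t in `[0%R, T]%classic) (ip (dH1 T y t) (dH1 T z t))%:E)%E.

Definition H1_weak_cvg (T : R) (yn : nat -> R -> H) (y : R -> H) :=
  forall z, H1 T z -> (fun n => H1_ip T (yn n) z) @ \oo --> H1_ip T y z.

Definition tau_cvg (T : R) (xn : nat -> (R -> H) * (R -> H))
    (x : (R -> H) * (R -> H)) :=
  L2_cvg T (fun n => (xn n).1) x.1 /\ H1_weak_cvg T (fun n => (xn n).2) x.2.

Definition frechet_subdiff (phi : H -> \bar R) (y xi : H) :=
  phi y \is a fin_num /\
  (0 <= limf_einf
          (fun w => ((phi w - phi y - (ip xi (w - y))%:E) * (`|w - y|^-1)%:E)%E)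
          (y^'))%E.

Definition proper_fun (f : H -> \bar R) :=
  (exists x, (f x < +oo)%E) /\ forall x, (-oo < f x)%E.

Definition convex_fun (f : H -> \bar R) :=
  forall x y (l : R), 0 <= l <= 1 ->
    (f (l *: x + (1 - l) *: y)%R <= l%:E * f x + (1 - l)%:E * f y)%E.

Definition C11 (f : H -> R) :=
  exists Df : H -> H,
    (exists L : R, forall x y, `|Df x - Df y| <= L * `|x - y|) /\
    forall y e, 0 < e -> \forall w \near y,
      `|f w - f y - ip (Df y) (w - y)| <= e * `|w - y|.

Definition compact_sublevels (f : H -> \bar R) :=
  forall c : R, compact [set x | (f x <= c%:E)%E].

Definition abs_continuous_on (a b : R) (f : R -> R) :=
  forall e, 0 < e -> exists2 d, 0 < d &
    forall n (l r : 'I_n -> R),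
      (forall i, a <= l i /\ l i <= r i /\ r i <= b) ->
      (forall i j, i != j -> r i <= l j \/ r j <= l i) ->
      \sum_(i < n) (r i - l i) < d ->
      \sum_(i < n) `|f (r i) - f (l i)| < e.

Definition chain_rule (T : R) (phi : H -> \bar R) :=
  forall y g xi, H1 T y -> is_deriv T y g -> L2 T xi ->
    {ae mu, forall t, `[0%R, T]%classic t -> frechet_subdiff phi (y t) (xi t)} ->
    [/\ forall t, `[0%R, T]%classic t -> phi (y t) \is a fin_num,
        abs_continuous_on 0 T (fun t => fine (phi (y t))) &
        {ae mu, forall t, `]0%R, T[%classic t ->
           derivable (fun s => fine (phi (y s))) t 1 /\
           derive1 (fun s => fine (phi (y s))) t = ip (xi t) (g t)}].

(* the (single-valued) subdifferential: the selected element of \partial phi(y) *)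
Definition subdiff_sel (phi : H -> \bar R) (y : H) : H :=
  xget 0 [set xi | frechet_subdiff phi y xi].

Definition G_DG (T : R) (phi : H -> \bar R) (y0 : H) (u y : R -> H) : \bar R :=
  if pselect (InX T u y /\
       {ae mu, forall t, `[0%R, T]%classic t -> exists xi, frechet_subdiff phi (y t) xi} /\
       y 0 = y0)
  then (\int[mu]_(t in `[0%R, T]%classic)
          (`|dH1 T y t| ^+ 2 / 2 + `|subdiff_sel phi (y t) - u t| ^+ 2 / 2
           - ip (u t) (dH1 T y t))%:E
        + phi (y T) - phi y0)%E
  else +oo%E.

Definition E_eps (F : (R -> H) -> (R -> H) -> \bar R) (G : (R -> H) -> (R -> H) -> \bar R)
    (eps : R) (u y : R -> H) : \bar R :=
  (F u y + (eps^-1)%:E * G u y)%E.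

Definition E_0 (F G : (R -> H) -> (R -> H) -> \bar R) (u y : R -> H) : \bar R :=
  if G u y == 0%E then F u y else +oo%E.

Definition infX (T : R) (E : (R -> H) -> (R -> H) -> \bar R) : \bar R :=
  ereal_inf [set E x.1 x.2 | x in Xset T].

Definition is_minimizer (T : R) (E : (R -> H) -> (R -> H) -> \bar R) x :=
  Xset T x /\ forall x', Xset T x' -> (E x.1 x.2 <= E x'.1 x'.2)%E.

Definition tau_lsc (T : R) (E : (R -> H) -> (R -> H) -> \bar R) :=
  forall xn x, (forall n, Xset T (xn n)) -> Xset T x -> tau_cvg T xn x ->
    (E x.1 x.2 <= limn_einf (fun n => E (xn n).1 (xn n).2))%E.

Definition gamma_cvg (T : R) (E : R -> (R -> H) -> (R -> H) -> \bar R)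
    (E0 : (R -> H) -> (R -> H) -> \bar R) :=
  forall eps : nat -> R, (forall n, 0 < eps n) -> eps @ \oo --> (0 : R) ->
  (forall xn x, (forall n, Xset T (xn n)) -> Xset T x -> tau_cvg T xn x ->
     (E0 x.1 x.2 <= limn_einf (fun n => E (eps n) (xn n).1 (xn n).2))%E) /\
  (forall x, Xset T x -> exists xn, (forall n, Xset T (xn n)) /\ tau_cvg T xn x /\
     (limn_esup (fun n => E (eps n) (xn n).1 (xn n).2) <= E0 x.1 x.2)%E).

Definition quasiminimizers (T : R) (E : R -> (R -> H) -> (R -> H) -> \bar R)
    (eps : nat -> R) (xn : nat -> (R -> H) * (R -> H)) :=
  (forall n, Xset T (xn n)) /\
  (fun n => (E (eps n) (xn n).1 (xn n).2 - infX T (E (eps n)))%E) @ \oo --> 0%E.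

End GradientFlowDefs.

(* Main.v *)
(* By the chain rule [G_DG(u, y)] is the integral of [|y' + xi - u|^2 / 2], where
   [xi] is the subgradient of [phi] along [y]; in particular it is nonnegative.
   A bound on [G_DG(u_n, y_n)] with [u_n -> u] bounds [y_n'] and [xi_n] in [L^2]
   and [phi(y_n)] uniformly in time. The sublevels of [phi] being compact, Ascoli's
   theorem gives a uniformly convergent subsequence, and the derivatives converge
   weakly. The set of points having a subgradient in a given ball is closed, so
   [|xi(t) - u(t)|^2] is bounded for a.e. [t] by the lower limit of the
   [|xi_n(t) - u(t)|^2], and Fatou's lemma yields the lower semicontinuity of
   [G_DG]. The assertions on [E_eps = F + eps^-1 G_DG] then follow by the direct
   method. A finite [E_eps(x)] forces [u] into the compact set [U]; it bounds
   [G_DG], hence [y]. No solution of the gradient flow is constructed: if [E_0] is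
   identically infinite, every point of [X] minimizes it. *)
Require Import Defs.
From HB Require Import structures.
From mathcomp Require Import all_boot all_order all_algebra.
From mathcomp Require Import all_classical all_reals all_analysis.
From mathcomp Require Import measurable_realfun ring lra.
Import Order.TTheory GRing.Theory Num.Theory numFieldNormedType.Exports.
Set Implicit Arguments. Unset Strict Implicit. Unset Printing Implicit Defensive.
Local Open Scope classical_set_scope.
Local Open Scope ring_scope.

(** Elements of $X$ are functions here, not classes, and [dH1] and [subdiff_sel] are choices. Their
    integrands agree with measurable functions only almost everywhere, so integrals are handled up
    to null sets, and the subgradient along a curve must be proved measurable before [G_DG] can be
    split into terms. Weak compactness is replaced by one device: in a decreasing sequence of convex
    sets, each with a point in a fixed ball, points of almost minimal norm converge strongly. In $H$
    it produces the limit subgradient behind the closedness claim, in $L^2(0,T;H)$ the derivative of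
    the limit curve. The chain rule only gives $(\phi\circ y)'$ almost everywhere and absolute
    continuity, whereas bounds on $\phi(y_n(t))$ at every $t$ require the integral identity on
    $[0,t]$; hence the fundamental theorem of calculus for absolutely continuous functions. *)

Lemma choice2 (A B : Type) (P Q : A -> B -> Prop) :
  (forall x, exists2 y, P x y & Q x y) ->
  exists f, (forall x, P x (f x)) /\ (forall x, Q x (f x)).
Proof.
move=> PQ.
have /choice[f fP] : forall x, exists y, P x y /\ Q x y.
  by move=> x; have [y] := PQ x; exists y.
by exists f; split => x; have [] := fP x.
Qed.

(** * Lower limits of extended real sequences *)

Section einf_filters.
Variables (T : choiceType) (X : filteredType T) (R : realType).
Implicit Types (f : X -> \bar R) (F : set_system X).

Lemma lt_limf_einf f F (a : \bar R) : Filter F ->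
  (a < limf_einf f F)%E -> \forall x \near F, (a < f x)%E.
Proof.
move=> FF; rewrite limf_einfE => /ereal_sup_gt[_ [V FV <-]] aV.
apply: filterS FV => x Vx; apply: lt_le_trans aV _.
by apply: ereal_inf_lbound; exists x.
Qed.

Lemma le_limf_einf f F (a : \bar R) :
  (\forall x \near F, (a <= f x)%E) -> (a <= limf_einf f F)%E.
Proof.
move=> Fa; rewrite limf_einfE; apply: ereal_sup_ge.
exists (ereal_inf (f @` [set x | (a <= f x)%E])); first by exists [set x | (a <= f x)%E].
by apply: le_ereal_inf_tmp => _ [x ? <-].
Qed.

End einf_filters.

Section einf_sequences.
Variable R : realType.
Implicit Types (u : nat -> \bar R) (a : \bar R).

Lemma lt_limn_einf u a :
  (a < limn_einf u)%E -> \forall n \near \oo, (a < u n)%E.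
Proof. exact: lt_limf_einf. Qed.

Lemma le_limn_einf u a :
  (\forall n \near \oo, (a <= u n)%E) -> (a <= limn_einf u)%E.
Proof. exact: le_limf_einf. Qed.

Lemma limn_einf_le u a :
  (\forall n \near \oo, (u n <= a)%E) -> (limn_einf u <= a)%E.
Proof.
move=> ua; rewrite leNgt; apply/negP => /lt_limn_einf au.
case: (filterI ua au) => n _ /(_ n (leqnn n))[+ +].
by move=> H; rewrite ltNge H.
Qed.

Lemma le_limn_einfD u v : (forall n, 0 <= u n)%E -> (forall n, 0 <= v n)%E ->
  (limn_einf u + limn_einf v <= limn_einf (fun n => u n + v n))%E.
Proof.
move=> u0 v0.
have e0 w n : (forall n, 0 <= w n)%E -> (0 <= einfs w n)%E.
  by move=> w0; apply: le_ereal_inf_tmp => _ [m _ <-].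
have l0 w : (forall n, 0 <= w n)%E -> (0 <= limn (einfs w))%E.
  move=> w0; apply: lime_ge; first exact: is_cvg_einfs.
  by apply: nearW => n; exact: e0.
rewrite !limn_einf_lim.
have cuv : (einfs u n + einfs v n @[n --> \oo] --> limn (einfs u) + limn (einfs v))%E.
  by apply: cvgeD; [apply: ge0_adde_def; rewrite inE l0|exact: is_cvg_einfs..].
rewrite -(cvg_lim _ cuv)//; apply: lee_lim.
- by apply/cvg_ex; eexists; exact: cuv.
- exact: is_cvg_einfs.
- apply: nearW => n; apply: le_ereal_inf_tmp => _ [m nm <-].
  by apply: leeD; apply: ereal_inf_lbound; exists m.
Qed.

Lemma limn_einfZ_ge u (c : R) (l : \bar R) : 0 < c -> (0 <= l)%E ->
  (l <= limn_einf u)%E -> (c%:E * l <= limn_einf (fun n => c%:E * u n))%E.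
Proof.
move=> c0 l0 lu.
have H r : (r%:E < l)%E -> ((c * r)%:E <= limn_einf (fun n => c%:E * u n))%E.
  move=> /lt_le_trans/(_ lu)/lt_limn_einf ru; apply: le_limn_einf.
  by apply: filterS ru => n /ltW ru; rewrite EFinM lee_pmul2l.
case: l l0 lu H => [l| |]// _ _ H.
  apply/lee_subgt0Pr => e e0; rewrite -EFinM -EFinB.
  have -> : c * l - e = c * (l - e / c) by field; rewrite gt_eqF.
  by apply: H; rewrite lte_fin gtrBl divr_gt0.
rewrite gt0_muley ?lte_fin//; rewrite leye_eq; apply/eqP/eqyP => A A0.
have := H (A / c) (ltry _); have -> // : c * (A / c) = A by field; rewrite gt_eqF.
Qed.

End einf_sequences.

(** * Integration of functions measurable up to a null set *)

Section ae_integration.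
Context d (T : measurableType d) (R : realType).
Variables (mu : {measure set T -> \bar R}) (D : set T) (mD : measurable D).
Implicit Types f g : T -> R.

Import HBNNSimple.

(** No measurability is involved: the integral of a nonnegative function is a supremum over simple
    functions below it. A simple function below [f], set to zero on the exceptional null set, keeps
    its integral and lies below [g]. *)
Lemma ge0_ae_le_integral_nm (f g : T -> \bar R) :
  (forall x, D x -> 0 <= f x)%E -> (forall x, D x -> 0 <= g x)%E ->
  {ae mu, forall x, D x -> (f x <= g x)%E} ->
  (\int[mu]_(x in D) f x <= \int[mu]_(x in D) g x)%E.
Proof.
move=> f0 g0 [N [mN N0 fgN]].
rewrite !ge0_integralE//; apply: ge_ereal_sup => _ [h hf <-].
have mC : measurable (~` N) by exact: measurableC.
have [h' h'E] : exists h' : {nnsfun T >-> R},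
  forall x, h' x = h x * (x \in ~` N)%:R.
  by exists (mul_nnsfun h (indic_nnsfun R mC)).
apply: ereal_sup_ge; exists (sintegral mu h').
  exists h' => // x /=; rewrite h'E.
  have := hf x; rewrite !patchE; case: ifPn => [/set_mem Dx|_] hx.
    have [xN|xN] := pselect (N x).
      by rewrite memNset ?mulr0 ?g0// => /(_ xN).
    rewrite mem_set// mulr1; apply: (le_trans hx).
    by apply: contrapT => nfg; apply: xN; apply: fgN => /(_ Dx).
  have -> : h x = 0 by apply/le_anti/andP; split => //; rewrite -lee_fin.
  by rewrite mul0r.
rewrite -!integralT_nnsfun.
rewrite (@ge0_negligible_integral _ _ _ mu setT N (EFin \o h))//; last first.
- by move=> x _ /=; rewrite lee_fin.
- exact/measurable_EFinP.
rewrite setTD integral_mkcond; apply: ge0_le_integral => //.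
- by move=> x _; apply: erestrict_ge0 => y _ /=; rewrite lee_fin.
- apply/(measurable_restrictT _ _).1 => //; apply/measurable_EFinP.
  exact: measurable_funTS.
- by apply/measurable_EFinP.
- move=> x _; rewrite patchE /= h'E; case: ifPn => _.
    by rewrite mulr1.
  by rewrite mulr0.
Qed.

Lemma ae_eq_integral_nm (f g : T -> \bar R) :
  {ae mu, forall x, D x -> f x = g x} ->
  (\int[mu]_(x in D) f x = \int[mu]_(x in D) g x)%E.
Proof.
move=> fg; rewrite integralE [RHS]integralE.
have H (h1 h2 : T -> \bar R) : {ae mu, forall x, D x -> h1 x = h2 x} ->
   (\int[mu]_(x in D) h1 ^\+ x = \int[mu]_(x in D) h2 ^\+ x)%E /\
   (\int[mu]_(x in D) h1 ^\- x = \int[mu]_(x in D) h2 ^\- x)%E.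
  move=> h12; split; apply/eqP; rewrite eq_le; apply/andP; split;
   apply: ge0_ae_le_integral_nm => //;
   by apply: filterS h12 => x h12 Dx; rewrite ?funeposE ?funenegE h12.
by have [-> ->] := H _ _ fg.
Qed.

(* Limits and selections are only measurable after modification on a null set,
   which [Rintegral] does not see by [ae_eq_integral_nm]. *)
Definition aemeas f := exists2 f0, measurable_fun D f0 &
  {ae mu, forall x, D x -> f x = f0 x}.

Definition aeint f := exists2 f0, mu.-integrable D (EFin \o f0) &
  {ae mu, forall x, D x -> f x = f0 x}.

Lemma aeint_aemeas f : aeint f -> aemeas f.
Proof.
by case=> f0 /measurable_int mf0 e; exists f0 => //; exact/measurable_EFinP.
Qed.

Lemma aemeas_ae f g : {ae mu, forall x, D x -> f x = g x} ->
  aemeas f -> aemeas g.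
Proof.
move=> fg [f0 mf0 e]; exists f0 => //.
by apply: filterS2 fg e => x fg e Dx; rewrite -fg// e.
Qed.

Lemma aeint_ae f g : {ae mu, forall x, D x -> f x = g x} ->
  aeint f -> aeint g.
Proof.
move=> fg [f0 mf0 e]; exists f0 => //.
by apply: filterS2 fg e => x fg e Dx; rewrite -fg// e.
Qed.

Lemma Rint_ae f g : {ae mu, forall x, D x -> f x = g x} ->
  \int[mu]_(x in D) f x = \int[mu]_(x in D) g x.
Proof.
move=> fg; congr fine; apply: ae_eq_integral_nm.
by apply: filterS fg => x fg Dx; rewrite fg.
Qed.

Lemma EFin_Rint f : aeint f ->
  (\int[mu]_(x in D) (f x)%:E)%E = (\int[mu]_(x in D) f x)%:E.
Proof.
move=> [f0 mf0 e]; rewrite /Rintegral fineK//.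
rewrite (@ae_eq_integral_nm _ (EFin \o f0)).
  exact: integrable_fin_num.
by apply: filterS e => x e Dx; rewrite e.
Qed.

Lemma measurable_aemeas f : measurable_fun D f -> aemeas f.
Proof. by move=> mf; exists f => //; exact: aeW. Qed.

Lemma integrable_aeint f : mu.-integrable D (EFin \o f) -> aeint f.
Proof. by move=> mf; exists f => //; exact: aeW. Qed.

Lemma aemeasD f g : aemeas f -> aemeas g -> aemeas (fun x => f x + g x).
Proof.
move=> [f0 mf ef] [g0 mg eg]; exists (f0 \+ g0).
  exact: measurable_funD.
by apply: filterS2 ef eg => x ef eg Dx; rewrite ef// eg.
Qed.

Lemma aemeasZ k f : aemeas f -> aemeas (fun x => k * f x).
Proof.
move=> [f0 mf ef]; exists (fun x => k * f0 x).
  exact: measurable_funM.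
by apply: filterS ef => x ef Dx; rewrite ef.
Qed.

Lemma aemeasM f g : aemeas f -> aemeas g -> aemeas (fun x => f x * g x).
Proof.
move=> [f0 mf ef] [g0 mg eg]; exists (f0 \* g0).
  exact: measurable_funM.
by apply: filterS2 ef eg => x ef eg Dx; rewrite ef// eg.
Qed.

(** The measurable representatives are cut off to zero on a null set outside which they converge to
    [f], so that they converge everywhere on [D]. *)
Lemma aemeas_lim (F : nat -> T -> R) f : (forall n, aemeas (F n)) ->
  {ae mu, forall x, D x -> F n x @[n --> \oo] --> f x} -> aemeas f.
Proof.
move=> /choice2[F0 [mF0 eF]] cF.
have {eF cF} [N [mN N0 cN]] : {ae mu, forall x, D x -> F0 n x @[n --> \oo] --> f x}.
  have {}eF := ae_foralln eF.
  apply: filterS2 eF cF => x eF cF Dx.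
  apply: cvg_trans (cF Dx); apply: near_eq_cvg; apply: nearW => n.
  by rewrite (eF n Dx).
exists (fun x => if x \in ~` N then f x else 0); last first.
  exists N; split => // x /= nf; apply: contrapT => xN; apply: nf => _.
  by rewrite mem_set.
apply: (@measurable_fun_cvg _ _ _ D (fun n => F0 n \* \1_(~` N))).
  move=> n; apply: measurable_funM => //.
  by apply: measurable_indic; exact: measurableC.
move=> x Dx /=; rewrite indicE; case: ifPn => [/set_mem xN|_].
  under eq_fun do rewrite mulr1.
  by apply: contrapT => nc; apply: xN; apply: cN => /(_ Dx).
under eq_fun do rewrite mulr0.
exact: cvg_cst.
Qed.

Lemma aeintD f g : aeint f -> aeint g -> aeint (fun x => f x + g x).
Proof.
move=> [f0 mf ef] [g0 mg eg]; exists (f0 \+ g0).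
  by apply: eq_integrable (integrableD mD mf mg) => // x _.
by apply: filterS2 ef eg => x ef eg Dx; rewrite ef// eg.
Qed.

Lemma RintD f g : aeint f -> aeint g ->
  \int[mu]_(x in D) (f x + g x) = \int[mu]_(x in D) f x + \int[mu]_(x in D) g x.
Proof.
move=> [f0 mf ef] [g0 mg eg]; rewrite (Rint_ae ef) (Rint_ae eg) -RintegralD//.
by apply: Rint_ae; apply: filterS2 ef eg => x ef eg Dx; rewrite ef// eg.
Qed.

Lemma aeintZ k f : aeint f -> aeint (fun x => k * f x).
Proof.
move=> [f0 mf ef]; exists (fun x => k * f0 x).
  by apply: eq_integrable (integrableZl mD k mf) => // x _.
by apply: filterS ef => x ef Dx; rewrite ef.
Qed.

Lemma RintZ k f : aeint f ->
  \int[mu]_(x in D) (k * f x) = k * \int[mu]_(x in D) f x.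
Proof.
move=> [f0 mf ef]; rewrite (Rint_ae ef) -RintegralZl//.
by apply: Rint_ae; apply: filterS ef => x ef Dx; rewrite ef.
Qed.

Lemma aeintB f g : aeint f -> aeint g -> aeint (fun x => f x - g x).
Proof.
move=> hf /(aeintZ (-1)) hg; apply: aeint_ae (aeintD hf hg).
by apply: aeW => x _; rewrite mulN1r.
Qed.

Lemma RintB f g : aeint f -> aeint g ->
  \int[mu]_(x in D) (f x - g x) = \int[mu]_(x in D) f x - \int[mu]_(x in D) g x.
Proof.
move=> hf hg; rewrite -mulN1r -RintZ// -RintD//; last exact: aeintZ.
by apply: Rint_ae; apply: aeW => x _; rewrite mulN1r.
Qed.

Lemma le_Rint f g : aeint f -> aeint g ->
  {ae mu, forall x, D x -> f x <= g x} ->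
  \int[mu]_(x in D) f x <= \int[mu]_(x in D) g x.
Proof.
move=> hf hg fg; rewrite -subr_ge0 -RintB//.
rewrite (@Rint_ae _ (fun x => Num.max 0 (g x - f x))).
  by apply: Rintegral_ge0 => x _; rewrite le_max lexx.
apply: filterS fg => x fg Dx; apply/esym/max_idPr.
by rewrite subr_ge0 fg.
Qed.

Lemma le_aeint f g : aemeas f -> aeint g ->
  {ae mu, forall x, D x -> `|f x| <= g x} -> aeint f.
Proof.
move=> [f0 mf ef] [g0 mg eg] fg.
exists f0 => //; apply/integrableP; split; first exact/measurable_EFinP.
apply: (@le_lt_trans _ _ (\int[mu]_(x in D) `|(g0 x)%:E|)%E); last first.
  by move/integrableP : mg => [].
apply: ge0_ae_le_integral_nm => //=.
apply: filterS3 ef eg fg => x ef eg fg Dx.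
by rewrite lee_fin -ef// -eg// (le_trans (fg Dx))// ler_norm.
Qed.

Lemma ge0_aeint f : aemeas f -> (forall x, D x -> 0 <= f x) ->
  (\int[mu]_(x in D) (f x)%:E < +oo)%E -> aeint f.
Proof.
move=> [f0 mf ef] fge0 foo; exists f0 => //.
apply/integrableP; split; first exact/measurable_EFinP.
apply: le_lt_trans foo; apply: ge0_ae_le_integral_nm => //.
apply: filterS ef => x ef Dx.
by rewrite /= -ef// ger0_norm// fge0.
Qed.

Lemma aeint_norm f : aeint f -> aeint (fun x => `|f x|).
Proof.
move=> [f0 mf ef]; exists (fun x => `|f0 x|).
  by have := integrable_abse mf; apply: eq_integrable.
by apply: filterS ef => x ef Dx; rewrite ef.
Qed.

(** Fatou's lemma, applied to the absolute values of integrable representatives, which are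
    nonnegative everywhere and not only almost everywhere. *)
Lemma aeint_ge0_lim (F : nat -> T -> R) f (b : R) : (forall n, aeint (F n)) ->
  aemeas f ->
  (forall n, {ae mu, forall x, D x -> 0 <= F n x}) ->
  {ae mu, forall x, D x -> 0 <= f x} ->
  {ae mu, forall x, D x -> ((f x)%:E <= limn_einf (fun n => (F n x)%:E))%E} ->
  (\forall n \near \oo, \int[mu]_(x in D) F n x <= b) ->
  aeint f /\ \int[mu]_(x in D) f x <= b.
Proof.
move=> iF mf F0 f0 fF Fb.
have /choice2[G [mG eG]] := fun n => aeint_norm (iF n).
have aeF := ae_foralln eG.
have F0' := ae_foralln F0.
have eGF : {ae mu, forall x, D x -> forall n, `|G n x| = F n x}.
  apply: filterS2 aeF F0' => x eg F0x Dx n.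
  by rewrite -eg// normr_id ger0_norm// F0x.
have mG' n : measurable_fun D (fun x => `|(G n x)%:E|)%E.
  by have := measurable_int mu (mG n); apply: measurableT_comp.
have := @fatou _ _ _ mu D mD (fun n x => `|(G n x)%:E|)%E mG'
  (fun n x _ => abse_ge0 _).
have -> : (fun n => \int[mu]_(x in D) `|(G n x)%:E|)%E =
          (fun n => (\int[mu]_(x in D) F n x)%:E).
  apply/funext => n; rewrite -EFin_Rint//; apply: ae_eq_integral_nm.
  by apply: filterS eGF => x e Dx; rewrite /= e.
have lb : (limn_einf (fun n => (\int[mu]_(x in D) F n x)%:E) <= b%:E)%E.
  by apply: limn_einf_le; apply: filterS Fb => n; rewrite lee_fin.
move=> /le_trans/(_ lb) fb.
have fb' : (\int[mu]_(x in D) `|(f x)%:E| <= b%:E)%E.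
  apply: le_trans fb; apply: ge0_ae_le_integral_nm => //.
    by move=> x Dx; apply: le_limn_einf; apply: nearW => n; exact: abse_ge0.
  apply: filterS3 f0 fF eGF => x f0 fF e Dx.
  rewrite /= ger0_norm ?f0//; apply: le_trans (fF Dx) _.
  by under [X in (_ <= limn_einf X)%E]eq_fun do rewrite /= e//.
have fi : aeint f.
  case: mf => g mg eg; exists g => //; apply/integrableP; split.
    exact/measurable_EFinP.
  apply: (le_lt_trans _ (ltry b)); apply: le_trans fb'.
  apply: ge0_ae_le_integral_nm => //.
  by apply: filterS eg => x eg Dx /=; rewrite eg.
split=> //; rewrite -lee_fin -EFin_Rint//; apply: le_trans fb'.
rewrite (@ae_eq_integral_nm _ (fun x => `|(f x)%:E|)%E)//.
by apply: filterS f0 => x f0 Dx /=; rewrite ger0_norm// f0.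
Unshelve. all: by end_near. Qed.

(** By Fatou's lemma the lower limit has a finite integral. Applied to subgradients, this yields at
    almost every time infinitely many of them in a common ball. *)
Lemma ae_limn_einf_lty (F : nat -> T -> R) (b : R) : (forall n, aeint (F n)) ->
  {ae mu, forall x, D x -> forall n, 0 <= F n x} ->
  (forall n, \int[mu]_(x in D) F n x <= b) ->
  {ae mu, forall x, D x -> (limn_einf (fun n => (F n x)%:E) < +oo)%E}.
Proof.
move=> iF F0 Fb.
have /choice2[G [mG eG]] := fun n => iF n.
have mG' n : measurable_fun D (fun x => `|(G n x)%:E|)%E.
  by have := measurable_int mu (mG n); apply: measurableT_comp.
have aeF := ae_foralln eG.
have e : {ae mu, forall x, D x -> forall n, (F n x)%:E = `|(G n x)%:E|%E}.
  apply: filterS2 aeF F0 => x eg F0 Dx n.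
  by rewrite /= -eg// ger0_norm// F0.
have := @fatou _ _ _ mu D mD (fun n x => `|(G n x)%:E|)%E mG'
  (fun n x _ => abse_ge0 _).
have -> : (fun n => \int[mu]_(x in D) `|(G n x)%:E|)%E =
          (fun n => (\int[mu]_(x in D) F n x)%:E).
  apply/funext => n; rewrite -EFin_Rint//; apply: ae_eq_integral_nm.
  by apply: filterS e => x e Dx; rewrite e.
have lb : (limn_einf (fun n => (\int[mu]_(x in D) F n x)%:E) <= b%:E)%E.
  by apply: limn_einf_le; apply: nearW => n; rewrite lee_fin.
move=> /le_trans/(_ lb) fb.
have mli : measurable_fun D (fun x => limn_einf (fun n => `|(G n x)%:E|)%E).
  rewrite /limn_einf; apply: measurableT_comp => //.
  by apply: measurable_fun_limn_esup => n; exact: measurableT_comp.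
have /integrable_ae - /(_ mD) : mu.-integrable D
    (fun x => limn_einf (fun n => `|(G n x)%:E|)%E).
  apply/integrableP; split => //.
  apply: le_lt_trans (ltry b); apply: le_trans fb.
  rewrite le_eqVlt; apply/orP; left; apply/eqP; apply: eq_integral => x _.
  rewrite gee0_abs//; apply: le_limn_einf.
  by apply: nearW => n; exact: abse_ge0.
apply: filterS2 e => x e fi Dx.
have {}fi := fi Dx.
under [X in limn_einf X]eq_fun do rewrite (e Dx).
by move: fi; rewrite fin_numE ltey => /andP[].
Qed.

Lemma ae_cvgn_of_Rint (F : nat -> T -> R) (b : R) : (forall n, aeint (F n)) ->
  {ae mu, forall x, D x -> forall n, 0 <= F n x} ->
  {ae mu, forall x, D x -> {homo F ^~ x : m n / (m <= n)%N >-> m <= n}} ->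
  (forall n, \int[mu]_(x in D) F n x <= b) ->
  {ae mu, forall x, D x -> cvgn (F ^~ x)}.
Proof.
move=> iF F0 ndF Fb.
apply: filterS3 (ae_limn_einf_lty iF F0 Fb) F0 ndF => x fy F0 ndF Dx.
apply: nondecreasing_is_cvgn; first exact: ndF.
have {}fy := fy Dx.
have l0 : (0 <= limn_einf (fun n => (F n x)%:E))%E.
  by apply: le_limn_einf; apply: nearW => n; rewrite lee_fin F0.
have [r rfy] : exists r : R, (limn_einf (fun n => (F n x)%:E) < r%:E)%E.
  exists (fine (limn_einf (fun n => (F n x)%:E)) + 1).
  by rewrite EFinD fineK ?lteDl ?lte01// ge0_fin_numE.
exists r => _ [n _ <-]; rewrite leNgt; apply/negP => rF.
move: rfy; rewrite ltNge => /negP; apply; apply: le_limn_einf.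
exists n => // m /= nm; rewrite lee_fin; apply: le_trans (ltW rF) _.
exact: ndF.
Qed.

(** The minorant [- g] makes the negative part integrable, so that an integral below [+oo] controls
    the positive part. The density in [G_DG] is of this kind. *)
Lemma aeint_lower_bound f g : aemeas f -> aeint g ->
  {ae mu, forall x, D x -> 0 <= g x /\ - g x <= f x} ->
  (\int[mu]_(x in D) (f x)%:E < +oo)%E -> aeint f.
Proof.
move=> [f0 mf ef] [g0 mg eg] gf.
rewrite (@ae_eq_integral_nm _ (EFin \o f0)); last first.
  by apply: filterS ef => x ef Dx; rewrite ef.
have mf' : measurable_fun D (EFin \o f0) by exact/measurable_EFinP.
have ineg : (\int[mu]_(x in D) (EFin \o f0)^\- x < +oo)%E.
  apply: (@le_lt_trans _ _ (\int[mu]_(x in D) `|(g0 x)%:E|)%E); last first.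
    by move/integrableP : mg => [].
  apply: ge0_ae_le_integral_nm => //.
  apply: filterS3 ef eg gf => x ef eg gf Dx; have [h1 h2] := gf Dx.
  rewrite funenegE /= -ef// -eg// ger0_norm// ge_max !lee_fin h1 andbT.
  by rewrite lerNl.
rewrite integralE => foo; exists f0 => //; apply/integrableP; split => //.
have -> : (fun x => `|(EFin \o f0) x|)%E = ((EFin \o f0)^\+ \+ (EFin \o f0)^\-)%E.
  by rewrite -fune_abse.
rewrite ge0_integralD//; [|exact: measurable_funepos|exact: measurable_funeneg].
rewrite lte_add_pinfty// ltey; apply/eqP => poo.
move: foo; rewrite poo.
have : (\int[mu]_(x in D) (EFin \o f0)^\- x)%E \is a fin_num.
  by rewrite ge0_fin_numE//; apply: integral_ge0.
by move=> /fineK <-.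
Qed.

End ae_integration.

Lemma aeint_sub d (T : measurableType d) (R : realType) (mu : {measure set T -> \bar R})
    (A B : set T) f : measurable A -> measurable B -> A `<=` B ->
  aeint mu B f -> aeint mu A f.
Proof.
move=> mA mB AB [f0 mf ef]; exists f0; first exact: integrableS mf.
by apply: filterS ef => x ef /AB; exact: ef.
Qed.

(** * Decreasing convex sets in Hilbert spaces *)

(* Points [c k] of almost minimal [q]-value in [P k] form a Cauchy sequence by the
   parallelogram law; this replaces weak compactness. *)
Lemma nested_convex_cauchy (R : realType) (V : lmodType R) (L : set V)
    (q : V -> R) (P : nat -> set V) (M : R) :
  (forall x, 0 <= q x) ->
  (forall x y, L x -> L y -> q (x + y) + q (x - y) = 2 * q x + 2 * q y) ->
  (forall x, L x -> q (2^-1 *: x) = 4^-1 * q x) ->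
  (forall x y, L x -> L y -> L (x + y)) ->
  (forall k, P k `<=` L) ->
  (forall k l, (k <= l)%N -> P l `<=` P k) ->
  (forall k x y, P k x -> P k y -> P k (2^-1 *: (x + y))) ->
  (forall k, exists2 x, P k x & q x <= M) ->
  exists c : nat -> V, (forall k, P k (c k)) /\
    forall e : R, 0 < e -> exists N, forall k l, (N <= k)%N -> (k <= l)%N ->
      q (c k - c l) <= e.
Proof.
move=> q0 par qh LD PL Pdec Pmid PM.
pose d k := inf (q @` P k).
have lbd k : has_lbound (q @` P k) by exists 0 => _ [x _ <-].
have hid k : has_inf (q @` P k).
  by split; [have [x Px _] := PM k; exists (q x), x|exact: lbd].
have dle k x : P k x -> d k <= q x by move=> Px; apply: ge_inf => //; exists x.
have dM k : d k <= M by have [x Px] := PM k; apply: le_trans; exact: dle.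
have dinc k l : (k <= l)%N -> d k <= d l.
  move=> kl; apply: lb_le_inf; first by case: (hid l).
  by move=> _ [x Px <-]; apply: dle; exact: Pdec Px.
have hs : has_sup (range d).
  by split; [exists (d 0%N), 0%N|exists M => _ [k _ <-]].
have dsup k : d k <= sup (range d) by apply: ub_le_sup; [case: hs|exists k].
have /choice2[c [Pc qc]] : forall k, exists2 x, P k x & q x < d k + k.+1%:R^-1.
  move=> k; have [|_ [x Px <-] lt] := @inf_adherent _ _ k.+1%:R^-1 _ (hid k).
    by rewrite invr_gt0 ltr0n.
  by exists x.
exists c; split => // e e0.
(* Three errors below [e / 8], each doubled by the parallelogram law: the excesses of [q (c k)] over
   [d k] and of [q (c l)] over [d l], and the increment [d l - d k]. *)
have e8 : 0 < e / 8 by rewrite divr_gt0.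
have [_ [N1 _ <-] dN] := sup_adherent e8 hs.
have [N2 _ hN2] := near_infty_natSinv_lt (PosNum e8).
exists (maxn N1 N2) => k l; rewrite geq_max => /andP[k1 k2] kl.
have Pl : P k (c l) by apply: Pdec kl _ _.
have mid := dle _ _ (Pmid _ _ _ (Pc k) Pl).
have Lk := PL _ _ (Pc k); have Ll := PL _ _ (Pc l).
rewrite qh in mid; last exact: LD.
have p := par _ _ Lk Ll.
have h1 := qc k; have h2 := qc l; have h3 := dinc _ _ k1; have h4 := dsup l.
have h5 : k.+1%:R^-1 < e / 8 := hN2 _ k2.
have h6 : l.+1%:R^-1 < e / 8 := hN2 _ (leq_trans k2 kl).
move: (k.+1%:R^-1) (l.+1%:R^-1) (sup _) (q (c k + c l)) (q (c k - c l)) h1 h2 h3 h4 h5 h6 dN mid p => a b S u v.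
move: (q (c k)) (q (c l)) (d k) (d l) (d N1) => x y dk dl dn h1 h2 h3 h4 h5 h6 dN mid p.
lra.
Qed.

Lemma ltr_of_sqr (R : realDomainType) (x y : R) : 0 <= y -> x ^+ 2 < y ^+ 2 -> x < y.
Proof. by move=> y0; rewrite !ltNge; apply: contraNN => yx; rewrite ler_sqr ?nnegrE// (le_trans y0). Qed.

Lemma ler_of_sqr (R : realDomainType) (x y : R) : 0 <= y -> x ^+ 2 <= y ^+ 2 -> x <= y.
Proof. by move=> y0; rewrite !leNgt; apply: contraNN => yx; rewrite ltr_sqr ?nnegrE// (le_trans y0)// ltW. Qed.

(** * Identities and inequalities for the inner product *)

Section inner_product.
Context {R : realType} {H : normedModType R}.
Variables (ip : H -> H -> R) (ipP : is_inner_product ip).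

Lemma ipC x y : ip x y = ip y x. Proof. by case: ipP. Qed.
Lemma ipxx x : ip x x = `|x| ^+ 2. Proof. by case: ipP. Qed.

Lemma ip0l y : ip 0 y = 0.
Proof.
case: ipP => _ lin _; have := lin 1 0 0 y.
by rewrite scaler0 addr0 mul1r => E; lra.
Qed.

Lemma ipDl x y z : ip (x + y) z = ip x z + ip y z.
Proof. by case: ipP => _ lin _; rewrite -{1}(scale1r x) lin mul1r. Qed.

Lemma ipZl a x z : ip (a *: x) z = a * ip x z.
Proof. by case: ipP => _ lin _; rewrite -(addr0 (a *: x)) lin ip0l addr0. Qed.

Lemma ipNl x z : ip (- x) z = - ip x z.
Proof. by rewrite -scaleN1r ipZl mulN1r. Qed.

Lemma ipBl x y z : ip (x - y) z = ip x z - ip y z.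
Proof. by rewrite ipDl ipNl. Qed.

Lemma ip0r y : ip y 0 = 0. Proof. by rewrite ipC ip0l. Qed.
Lemma ipDr x y z : ip z (x + y) = ip z x + ip z y.
Proof. by rewrite !(ipC z) ipDl. Qed.
Lemma ipZr a x z : ip z (a *: x) = a * ip z x.
Proof. by rewrite !(ipC z) ipZl. Qed.
Lemma ipNr x z : ip z (- x) = - ip z x.
Proof. by rewrite !(ipC z) ipNl. Qed.
Lemma ipBr x y z : ip z (x - y) = ip z x - ip z y.
Proof. by rewrite !(ipC z) ipBl. Qed.

Lemma normD2 x y : `|x + y| ^+ 2 = `|x| ^+ 2 + 2 * ip x y + `|y| ^+ 2.
Proof. by rewrite -!ipxx ipDl !ipDr (ipC y x); ring. Qed.

Lemma normB2 x y : `|x - y| ^+ 2 = `|x| ^+ 2 - 2 * ip x y + `|y| ^+ 2.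
Proof. by rewrite normD2 ipNr normrN; ring. Qed.

Lemma normD2_le (x y : H) : `|x + y| ^+ 2 <= 2 * `|x| ^+ 2 + 2 * `|y| ^+ 2.
Proof. by have := normB2 x y; have := normD2 x y; have := sqr_ge0 `|x - y|; lra. Qed.

Lemma ip_young (a : R) x y : 0 < a ->
  `|ip x y| <= a / 2 * `|x| ^+ 2 + (2 * a)^-1 * `|y| ^+ 2.
Proof.
move=> a0.
have h1 := sqr_ge0 `|a *: x + y|; have h2 := sqr_ge0 `|a *: x - y|.
rewrite normD2 normrZ exprMn real_normK ?num_real// ipZl in h1.
rewrite normB2 normrZ exprMn real_normK ?num_real// ipZl in h2.
have -> : a / 2 * `|x| ^+ 2 + (2 * a)^-1 * `|y| ^+ 2 =
   (a ^+ 2 * `|x| ^+ 2 + `|y| ^+ 2) / (2 * a).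
  by field; rewrite gt_eqF.
rewrite ler_pdivlMr ?mulr_gt0//.
have -> : `|ip x y| * (2 * a) = `|2 * (a * ip x y)|.
  by rewrite !normrM (gtr0_norm a0) (@gtr0_norm _ 2)//; ring.
by rewrite ler_norml; apply/andP; split; lra.
Qed.

Lemma ip_le x y : `|ip x y| <= 2^-1 * `|x| ^+ 2 + 2^-1 * `|y| ^+ 2.
Proof. by have := @ip_young 1 x y ltr01; rewrite mulr1 mul1r. Qed.

(** Young's inequality with the weight [|y| / |x|], for which both terms equal half of the product
    of the norms. *)
Lemma ip_cauchy_schwarz x y : `|ip x y| <= `|x| * `|y|.
Proof.
have [->|x0] := eqVneq x 0; first by rewrite ip0l !normr0 mul0r.
have [->|y0] := eqVneq y 0; first by rewrite ip0r !normr0 mulr0.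
have nx : 0 < `|x| by rewrite normr_gt0.
have ny : 0 < `|y| by rewrite normr_gt0.
apply: le_trans (@ip_young (`|y| / `|x|) x y (divr_gt0 ny nx)) _.
have -> : `|y| / `|x| / 2 * `|x| ^+ 2 + (2 * (`|y| / `|x|))^-1 * `|y| ^+ 2 =
  `|x| * `|y| by field; rewrite !gt_eqF.
exact: lexx.
Qed.

(** If [x] were nonzero, some [h] in [D] would be nearer to [x] than the origin is, whereas
    orthogonality gives $|x-h|^2=|x|^2+|h|^2$. *)
Lemma ip_eq0 (x : H) (D : set H) : dense D -> (forall h, D h -> ip x h = 0) -> x = 0.
Proof.
move=> dD xD; apply: contrapT => /eqP x0.
have nx : 0 < `|x| by rewrite normr_gt0.
have [h [/= hx Dh]] : (ball x `|x| `&` D) !=set0.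
  by apply: dD; [exists x; exact: ballxx|exact: ball_open].
move: hx; rewrite -ball_normE /= => hx.
have := normB2 x h; rewrite xD// mulr0 subr0 => E.
have : `|x - h| ^+ 2 < `|x| ^+ 2 by rewrite !expr2 ltr_pM.
by have := sqr_ge0 `|h|; lra.
Qed.

End inner_product.

Lemma cauchy_seq_cvgn (R : realType) (H : completeNormedModType R) (c : nat -> H) :
  (forall e : R, 0 < e -> exists N, forall k l, (N <= k)%N -> (k <= l)%N ->
     `|c k - c l| < e) -> cvgn c.
Proof.
move=> cc; apply: cauchy_cvg; apply/cauchy_ballP => e e0.
have [N hN] := cc e e0.
exists (c @` [set k | (N <= k)%N], c @` [set k | (N <= k)%N]) => /=.
  by split; exists N => // n /= Nn; exists n.
move=> [_ _] [/= [k Nk <-] [l Nl <-]]; rewrite -ball_normE /=.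
have [kl|/ltnW lk] := leqP k l; first exact: hN.
by rewrite distrC; exact: hN.
Qed.

(** The Cauchy sequence of almost minimal points lies in [P k] from index [k] on, hence so does its
    limit. *)
Lemma nested_convex_nonempty (R : realType) (H : completeNormedModType R)
    (ip : H -> H -> R) (P : nat -> set H) (M : R) : is_inner_product ip ->
  (forall k, closed (P k)) ->
  (forall k l, (k <= l)%N -> P l `<=` P k) ->
  (forall k x y, P k x -> P k y -> P k (2^-1 *: (x + y))) ->
  (forall k, exists2 x, P k x & `|x| <= M) ->
  exists x, forall k, P k x.
Proof.
move=> ipP Pcl Pdec Pmid PM.
have [||||||c [Pc cc]] := @nested_convex_cauchy R H setT (fun x => `|x| ^+ 2) P (M ^+ 2) _ _ _ _ _ Pdec Pmid.
- by move=> x; exact: sqr_ge0.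
- by move=> x y _ _; rewrite (normD2 ipP) (normB2 ipP); ring.
- by move=> x _; rewrite normrZ exprMn real_normK ?num_real//; congr (_ * _); field.
- by [].
- by [].
- move=> k; have [x Px xM] := PM k; exists x => //.
  by rewrite ler_pXn2r// nnegrE// (le_trans _ xM).
have /cvg_ex[x cx] : cvgn c.
  apply: cauchy_seq_cvgn => e e0.
  have e2 : 0 < e ^+ 2 / 4 by rewrite divr_gt0// exprn_gt0.
  have [N hN] := cc _ e2; exists N => k l Nk kl.
  apply: ltr_of_sqr; first exact: ltW.
  apply: le_lt_trans (hN _ _ Nk kl) _.
  by rewrite ltr_pdivrMr// ltr_pMr ?exprn_gt0// ltr1n.
exists x => k.
apply: (@closed_cvg _ _ _ eventually_filter c (P k) _ _ _ cx) => //.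
by exists k => // l /= kl; exact: Pdec kl _ (Pc l).
Qed.

Lemma le_of_natSinv (R : realType) (x y B : R) (N : nat) : 0 <= B ->
  (forall k, (N <= k)%N -> x <= y + B * k.+1%:R^-1) -> x <= y.
Proof.
move=> B0 h; apply/ler_addgt0Pr => e e0.
have B1 : 0 < B + 1 by rewrite ltr_wpDl.
have e1 : 0 < e / (B + 1) by rewrite divr_gt0.
have [M _ hM] := near_infty_natSinv_lt (PosNum e1).
have /= hk := hM _ (leq_maxr N M).
apply: le_trans (h _ (leq_maxl N M)) _; rewrite lerD2l.
move: hk; rewrite ltr_pdivlMr// => hk.
have k0 : 0 <= (maxn N M).+1%:R^-1 :> R by rewrite invr_ge0 ler0n.
by rewrite mulrC; apply: le_trans (ltW hk); rewrite ler_wpM2l// lerDl.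
Qed.

(** * The Frechet subdifferential *)

Section subdifferential.
Context {R : realType} {H : normedModType R}.
Variables (ip : H -> H -> R) (ipP : is_inner_product ip).

(** The lower limit of the quotient, cleared of its denominator. At [w = y] the inequality is
    trivial, so that the neighbourhood need not be punctured. *)
Lemma frechet_subdiffP (phi : H -> \bar R) (y xi : H) :
  frechet_subdiff ip phi y xi <-> phi y \is a fin_num /\
  forall e : R, 0 < e -> \forall w \near y,
    (phi y + (ip xi (w - y) - e * `|w - y|)%:E <= phi w)%E.
Proof.
have key w (e : R) : phi y \is a fin_num -> w != y ->
  ((- e)%:E <= (phi w - phi y - (ip xi (w - y))%:E) * (`|w - y|^-1)%:E)%E =
  (phi y + (ip xi (w - y) - e * `|w - y|)%:E <= phi w)%E.
  move=> + wy; have n0 : 0 < `|w - y| by rewrite normr_gt0 subr_eq0.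
  case: (phi y) => [a _| |]//; case: (phi w) => [b| |].
  - rewrite -!EFinB -EFinM -!EFinD !lee_fin ler_pdivlMr//.
    by apply/idP/idP => h; lra.
  - by rewrite leey/= mulyr gtr0_sg ?invr_gt0// mul1e leey.
  - by rewrite /= mulNyr gtr0_sg ?invr_gt0// mul1e.
split=> -[fy h]; split => //.
  move=> e e0.
  have : ((- e)%:E < limf_einf (fun w => ((phi w - phi y - (ip xi (w - y))%:E) * (`|w - y|^-1)%:E)%E) y^')%E.
    by apply: lt_le_trans h; rewrite lte_fin oppr_lt0.
  move/lt_limf_einf; rewrite near_withinE; apply: filterS => w hw.
  have [->|wy] := eqVneq w y.
    by rewrite !subrr (ip0r ipP) normr0 mulr0 subrr adde0.
  by rewrite -key// ltW// hw.
apply/lee_addgt0Pr => e e0; rewrite -leeBlDr// sub0e -EFinN.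
apply: le_limf_einf; rewrite near_withinE; apply: filterS (h e e0) => w hw wy.
by rewrite key//; exact/eqP.
Qed.

Definition convex_subdiff (phi : H -> \bar R) (y xi : H) :=
  phi y \is a fin_num /\ forall z, (phi y + (ip xi (z - y))%:E <= phi z)%E.

(** Convexity carries the local bound to any [z]: it is applied at [y + l (z - y)] with [l] small
    and divided by [l]. A local error of [e / |z - y|] per unit of length becomes [e] at [z]. *)
Lemma convex_frechetP (phi : H -> \bar R) (y xi : H) :
  convex_fun phi -> (forall x, (-oo < phi x)%E) ->
  frechet_subdiff ip phi y xi <-> convex_subdiff phi y xi.
Proof.
move=> cvx phiN; rewrite frechet_subdiffP; split => -[fy h]; split => //; last first.
  move=> e e0; apply: nearW => w; apply: le_trans (h w).
  by rewrite leeD2lE// lee_fin gerBl mulr_ge0// ltW.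
move=> z; have [->|zy] := eqVneq z y.
  by rewrite subrr (ip0r ipP) adde0.
have n0 : 0 < `|z - y| by rewrite normr_gt0 subr_eq0.
apply/lee_addgt0Pr => e e0.
have e'0 : 0 < e / `|z - y| by rewrite divr_gt0.
have /nbhs_ballP[r /= r0 hr] := h _ e'0.
pose l := Num.min 1 (r / 2 / `|z - y|).
have l0 : 0 < l by rewrite lt_min ltr01 !divr_gt0.
have l1 : l <= 1 by rewrite ge_min lexx.
have wE : l *: z + (1 - l) *: y - y = l *: (z - y).
  by rewrite scalerBl scale1r scalerBr addrA addrAC addrK.
have bw : ball y r (l *: z + (1 - l) *: y).
  rewrite -ball_normE /= distrC wE normrZ gtr0_norm//.
  rewrite -ltr_pdivlMr//; apply: (@le_lt_trans _ _ (r / 2 / `|z - y|)).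
    by rewrite ge_min lexx orbT.
  by rewrite ltr_pM2r ?invr_gt0// ltr_pdivrMr// ltr_pMr// ltr1n.
have {hr} := hr _ bw.
rewrite /= wE (ipZr ipP) normrZ (gtr0_norm l0) => hw.
have lr : 0 <= l <= 1 by rewrite (ltW l0) l1.
have := le_trans hw (cvx z y l lr).
move: fy; case: (phi y) => [a _| |]//; case: (phi z) (phiN z) => [b _ | _ | //].
  rewrite -!EFinM -!EFinD !lee_fin.
  have -> : e / `|z - y| * (l * `|z - y|) = l * e.
    by field; rewrite gt_eqF.
  by move=> hh; rewrite -(ler_pM2l l0); lra.
by move=> _; rewrite leey.
Qed.

Lemma frechet_sumP (phi : H -> \bar R) (f : H -> R) (Df y xi : H) :
  (forall e, 0 < e -> \forall w \near y,
     `|f w - f y - ip Df (w - y)| <= e * `|w - y|) ->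
  frechet_subdiff ip (fun x => (phi x + (f x)%:E)%E) y xi <->
  frechet_subdiff ip phi y (xi - Df).
Proof.
move=> fD; rewrite !frechet_subdiffP.
have -> : (phi y + (f y)%:E \is a fin_num)%E = (phi y \is a fin_num).
  by rewrite fin_numD andbT.
split=> -[fy h]; split => // e e0.
all: have e2 : 0 < e / 2 by rewrite divr_gt0.
all: apply: filterS2 (h _ e2) (fD _ e2) => w.
all: case: (phi y) fy => [a _| |]//; case: (phi w) => [b| |]; rewrite ?leey//=.
all: rewrite -?EFinD ?leeNy_eq// !lee_fin (ipBl ipP) ler_norml => + /andP[].
all: by move: (ip xi _) (ip Df _) `|w - y| => A B C *; lra.
Qed.

End subdifferential.

Section subdifferential_closed.
Context {R : realType} {H : completeNormedModType R}.
Variables (ip : H -> H -> R) (ipP : is_inner_product ip).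
Variables (phi1 : H -> \bar R) (phi2 : H -> R) (Df : H -> H) (L : R).
Hypothesis phi1_proper : proper_fun phi1.
Hypothesis phi1_convex : convex_fun phi1.
Hypothesis phi1_lsc : lower_semicontinuous phi1.
Hypothesis DfL : forall x y, `|Df x - Df y| <= L * `|x - y|.
Hypothesis DfP : forall y e, 0 < e -> \forall w \near y,
      `|phi2 w - phi2 y - ip (Df y) (w - y)| <= e * `|w - y|.

Let phi x := (phi1 x + (phi2 x)%:E)%E.

(** Trades the local condition on subgradients of [phi] for inequalities over the whole space, which
    pass to limits. *)
Lemma subdiff_phiP y xi :
  frechet_subdiff ip phi y xi <-> convex_subdiff ip phi1 y (xi - Df y).
Proof.
rewrite /phi frechet_sumP//; last by move=> e e0; exact: DfP.
by apply: convex_frechetP => //; case: phi1_proper.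
Qed.

(* The set of almost subgradients at [y] attached to the ball of radius [1/k]
   decreases to the set of subgradients at [y] in the ball [|xi - d| <= c]. *)
Lemma subdiff_bounded_closed (d : H) (c : R) :
  closed [set y | exists2 xi, frechet_subdiff ip phi y xi & `|xi - d| <= c].
Proof.
move=> y cy.
have cS (k : nat) : exists w, [/\ `|w - y| < k.+1%:R^-1 &
   exists2 xi, frechet_subdiff ip phi w xi & `|xi - d| <= c].
  have /cy[w [wS]] : nbhs y (ball y (k.+1%:R^-1)) by apply: nbhsx_ballx; rewrite invr_gt0 ltr0n.
  by rewrite -ball_normE /= distrC => wy; exists w.
have c0 : 0 <= c by have [w [_ [xi _ /(le_trans (normr_ge0 _))]]] := cS 0%N.
have L0 : 0 <= `|L| by [].
pose m := d - Df y.
pose B := c + `|L| + `|m|.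
(* The conditions inherited by [eta = xi - Df w] for [w] within [1/(k+1)] of [y]: replacing [w] by
   [y] costs [|L|/(k+1)] in the ball condition and [B/(k+1)] in the subgradient inequality, [B]
   being a bound on [|eta|]. A lower bound [a] of [phi1] on the ball stands for the value
   [phi1 w]. *)
pose P (k : nat) := [set eta | `|eta - m| <= c + `|L| * k.+1%:R^-1 /\
   forall z (a : R), (forall w, `|w - y| < k.+1%:R^-1 -> (a%:E <= phi1 w)%E) ->
     ((a + ip eta (z - y) - B * k.+1%:R^-1)%:E <= phi1 z)%E].
have B0 : 0 <= B by rewrite !addr_ge0.
have inv_gt0 k : 0 < k.+1%:R^-1 :> R by rewrite invr_gt0 ltr0n.
have inv_le1 k : k.+1%:R^-1 <= 1 :> R by rewrite invf_le1 ?ler1n// ltr0n.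
have [eta Peta] : exists eta, forall k, P k eta.
  apply: (@nested_convex_nonempty R H ip P B) => //.
  - move=> k eta ceta.
    have near_eta e : 0 < e -> exists2 zeta, P k zeta & `|eta - zeta| < e.
      move=> e0; have [zeta [Pz]] := ceta _ (nbhsx_ballx eta e e0).
      by rewrite -ball_normE /=; exists zeta.
    split.
      apply/ler_addgt0Pr => e e0; have [zeta [h _] ez] := near_eta _ e0.
      have -> : eta - m = (zeta - m) + (eta - zeta) by rewrite [RHS]addrC subrKA.
      by apply: le_trans (ler_normD _ _) _; rewrite lerD// ltW.
    move=> z a ha; apply/lee_addgt0Pr => e e0.
    have e'0 : 0 < e / (`|z - y| + 1) by rewrite divr_gt0// ltr_wpDl.
    have [zeta [_ h] ez] := near_eta _ e'0.
    apply: le_trans (leeD2r e%:E (h z a ha)); rewrite -EFinD lee_fin.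
    have : ip (eta - zeta) (z - y) <= e.
      apply: le_trans (ler_norm _) _.
      apply: le_trans (ip_cauchy_schwarz ipP _ _) _.
      have zy : 0 < `|z - y| + 1 by rewrite ltr_wpDl.
      move: ez; rewrite ltr_pdivlMr// => /ltW; apply: le_trans.
      by rewrite ler_wpM2l// lerDl.
    by rewrite (ipBl ipP); move: (B / _) => b; lra.
  - move=> k l kl eta [h1 h2].
    have lk : l.+1%:R^-1 <= k.+1%:R^-1 :> R.
      by rewrite lef_pV2 ?posrE ?ltr0n// ler_nat ltnS.
    split; first by apply: le_trans h1 _; rewrite lerD2l ler_wpM2l.
    move=> z a ha; apply: le_trans (h2 z a _); last first.
      by move=> w wl; apply: ha; exact: lt_le_trans lk.
    by rewrite lee_fin lerD2l lerN2 ler_wpM2l.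
  - move=> k eta zeta [h1 h2] [h3 h4]; split.
      have -> : 2^-1 *: (eta + zeta) - m = 2^-1 *: (eta - m) + 2^-1 *: (zeta - m).
        rewrite -scalerDr (addrACA eta) -opprD scalerBr; congr (_ - _).
        rewrite scalerDr -scalerDl; have -> : 2^-1 + 2^-1 = 1 :> R by field.
        by rewrite scale1r.
      apply: le_trans (ler_normD _ _) _.
      by rewrite !normrZ gtr0_norm//; move: (_ / _) h1 h3 => b; lra.
    move=> z a ha; have := h2 z a ha; have := h4 z a ha.
    rewrite (ipZl ipP) (ipDl ipP); case: (phi1 z) => [b| |]; rewrite ?leey// !lee_fin.
    by move: (B / _) => b'; lra.
  - move=> k; have [w [wy [xi /subdiff_phiP[fw sw] xid]]] := cS k.
    have e1 : `|xi - Df w - m| <= c + `|L| * k.+1%:R^-1.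
      have -> : xi - Df w - m = (xi - d) - (Df w - Df y).
        by rewrite !opprB addrACA [RHS]addrACA (addrC (- Df w)).
      apply: le_trans (ler_normB _ _) _; apply: lerD => //.
      apply: le_trans (DfL _ _) _; apply: (@le_trans _ _ (`|L| * `|w - y|)).
        by rewrite ler_wpM2r// ler_norm.
      by rewrite ler_wpM2l// ltW.
    have e2 : `|xi - Df w| <= B.
      rewrite -(subrK m (xi - Df w)).
      apply: le_trans (ler_normD _ _) _; rewrite /B lerD2r.
      by apply: le_trans e1 _; rewrite lerD2l ler_piMr.
    exists (xi - Df w) => //; split => // z a ha.
    apply: le_trans (sw z); have := ha _ wy.
    case: (phi1 w) fw => [b _| |]//; rewrite -EFinD !lee_fin => ab.
    have : `|ip (xi - Df w) (y - w)| <= B * k.+1%:R^-1.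
      apply: le_trans (ip_cauchy_schwarz ipP _ _) _.
      by apply: ler_pM => //; rewrite distrC ltW.
    rewrite ler_norml => /andP[+ _].
    have -> : z - w = (z - y) + (y - w) by rewrite addrA subrK.
    by rewrite (ipDr ipP (z - y)); move: (B / _) => b'; lra.
exists (eta + Df y); last first.
  apply: (@le_of_natSinv _ _ _ `|L| 0) => // k _.
  by have := (Peta k).1; rewrite opprB addrA.
apply/subdiff_phiP; rewrite addrK.
(* By lower semicontinuity every [a] below [phi1 y] is a lower bound of [phi1] on a small ball
   around [y], hence allowed in [P k] for large [k]. *)
have claim z (a : R) : (a%:E < phi1 y)%E -> ((a + ip eta (z - y))%:E <= phi1 z)%E.
  move=> /phi1_lsc[V /nbhs_ballP[r /= r0 rV] hV].
  have [N _ hN] := near_infty_natSinv_lt (PosNum r0).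
  have main k : (N <= k)%N ->
     ((a + ip eta (z - y) - B * k.+1%:R^-1)%:E <= phi1 z)%E.
    move=> Nk; apply: (Peta k).2 => w wk; apply/ltW/hV/rV.
    by rewrite -ball_normE /= distrC (lt_trans wk)//; exact: hN.
  case: (phi1 z) main => [b| |] main; rewrite ?leey//.
    rewrite lee_fin; apply: (@le_of_natSinv _ _ _ B N) => // k Nk.
    by have := main _ Nk; rewrite lee_fin; move: (B / _) => b'; lra.
  by have := main _ (leqnn N).
case: phi1_proper => -[x0 x0y] phiN.
have := phiN y; case E : (phi1 y) => [v| |]// _; last first.
  have := phiN x0; case E0 : (phi1 x0) x0y => [u| |]// _ _.
  (* If [phi1 y] were infinite, every real [a] would be allowed; this one gives [u + 1 <= u] at the
     point [x0] of finite value. *)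
  have := claim x0 (u - ip eta (x0 - y) + 1); rewrite E E0 ltry lee_fin.
  by move=> /(_ isT); lra.
split; rewrite E// => z; apply/lee_addgt0Pr => e e0.
have := claim z (v - e); rewrite E lte_fin gtrBl => /(_ e0).
rewrite -EFinD; case: (phi1 z) => [b| |]; rewrite ?leey// ?lee_fin//=.
by lra.
Qed.

End subdifferential_closed.

(** * Bochner square-integrable functions *)

#[local] Instance ae_lebesgue_filter (R : realType) :
  Filter (nbhs (almost_everywhere (@lebesgue_measure R))).
Proof. exact: ae_filter_ringOfSetsType. Qed.

Section finite_range.
Context {R : realType} (D : set R).

(** The target has no structure, so that vectors, norms, indices and booleans fall under the same
    composition lemma. *)
Definition simple_on (A : Type) (s : R -> A) := finite_set (range s) /\
  forall v, measurable (D `&` s @^-1` [set v]).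

Lemma simple_on_comp2 (A B C : choiceType) (op : A -> B -> C) (s : R -> A) (r : R -> B) :
  simple_on s -> simple_on r -> simple_on (fun t => op (s t) (r t)).
Proof.
move=> [fs ms] [fr mr]; split.
  apply: sub_finite_set (finite_image2 op fs fr).
  by move=> _ [t _ <-]; exists (s t); [exists t|exists (r t) => //; exists t].
move=> v.
have -> : D `&` (fun t => op (s t) (r t)) @^-1` [set v] =
  \bigcup_(a in range s) \bigcup_(b in range r)
    if op a b == v then (D `&` s @^-1` [set a]) `&` (D `&` r @^-1` [set b]) else set0.
  apply/seteqP; split => [t [Dt /= <-]|t [_ [a _ <-] [_ [b _ <-]]]].
    by exists (s t); [exists t|exists (r t); [exists t|rewrite eqxx]].
  by case: eqP => // <- [[Dt /= <-] [_ /= <-]].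
apply: fin_bigcup_measurable => // a _; apply: fin_bigcup_measurable => // b _.
by case: ifPn => // _; apply: measurableI.
Qed.

Lemma simple_on_measurable (s : R -> R) : simple_on s -> measurable_fun D s.
Proof.
move=> [fs ms] mD Y mY.
have -> : D `&` s @^-1` Y = \bigcup_(a in range s `&` Y) (D `&` s @^-1` [set a]).
  apply/seteqP; split => [t [Dt Yt]|t [_ [[a _ <-] Ya] [Dt /= ta]]].
    by exists (s t) => //; split => //; exists t.
  by split => //=; rewrite ta.
by apply: fin_bigcup_measurable => //; exact: finite_setIl.
Qed.

End finite_range.

Section strong_measurability.
Context {R : realType} {H : normedModType R}.
Variable T : R.
Notation mu := (@lebesgue_measure R).
Notation D := (`[0%R, T]%classic).
Implicit Types u v : R -> H.

Lemma sm_comp2 (op : H -> H -> H) u v :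
  (forall (x y : nat -> H) a b, x @ \oo --> a -> y @ \oo --> b ->
     op (x n) (y n) @[n --> \oo] --> op a b) ->
  strongly_measurable T u -> strongly_measurable T v ->
  strongly_measurable T (fun t => op (u t) (v t)).
Proof.
move=> cop [s [fs [ms cs]]] [r [fr [mr cr]]].
have h n : simple_on D (fun t => op (s n t) (r n t)).
  by apply: simple_on_comp2; split.
exists (fun n t => op (s n t) (r n t)); split; first by move=> n; case: (h n).
split; first by move=> n; case: (h n).
by apply: filterS2 cs cr => t cs cr Dt; apply: cop; [exact: cs|exact: cr].
Qed.

Lemma smD u v : strongly_measurable T u -> strongly_measurable T v ->
  strongly_measurable T (fun t => u t + v t).
Proof. by apply: sm_comp2 => x y a b; exact: cvgD. Qed.

Lemma smB u v : strongly_measurable T u -> strongly_measurable T v ->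
  strongly_measurable T (fun t => u t - v t).
Proof.
by apply: (@sm_comp2 (fun x y => x - y)) => x y a b xa yb; exact: cvgB xa yb.
Qed.

Lemma smZ (k : R) u : strongly_measurable T u ->
  strongly_measurable T (fun t => k *: u t).
Proof.
move=> hu; apply: (@sm_comp2 (fun x _ => k *: x) u u) => // x y a b xa _.
exact: cvgZr.
Qed.

Lemma sm_cst (h : H) : strongly_measurable T (fun=> h).
Proof.
exists (fun _ _ => h); split; first by move=> n; apply: sub_finite_set (finite_set1 h) => _ [t _ <-].
split; last by apply: aeW => t _; exact: cvg_cst.
move=> n v; rewrite preimage_cst; case: ifPn => _; first by rewrite setIT.
by rewrite setI0.
Qed.

Lemma sm_norm u : strongly_measurable T u -> aemeas mu D (fun t => `|u t|).
Proof.
move=> [s [fs [ms cs]]].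
apply: (@aemeas_lim _ _ R mu D (fun n t => `|s n t|)) => //.
  move=> n; apply: measurable_aemeas; apply: simple_on_measurable.
  by apply: (@simple_on_comp2 _ _ _ _ _ (fun x _ => `|x|) (s n) (s n)); split.
by apply: filterS cs => t cs Dt; apply: cvg_norm; exact: cs.
Qed.

Lemma sm_sqr u : strongly_measurable T u -> aemeas mu D (fun t => `|u t| ^+ 2).
Proof. by move=> /sm_norm h; apply: aemeasM. Qed.

(* Pettis: [u] is approximated by the nearest among the first [n] points of a dense sequence. *)
Lemma pettis (e : nat -> H) u : (forall (x : H) (r : R), 0 < r -> exists n, `|x - e n| < r) ->
  (forall n, aemeas mu D (fun t => `|u t - e n|)) -> strongly_measurable T u.
Proof.
move=> de /choice2[f [mf ef]].
(* [m n] is the running minimum of the distances to the first [n + 1] points and [idx n] the first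
   index attaining it. Both use the measurable representatives [f], so that the comparisons define
   measurable sets. *)
pose m := fix m (n : nat) (t : R) : R := if n is k.+1 then Num.min (m k t) (f k.+1 t) else f 0%N t.
pose idx := fix idx (n : nat) (t : R) : nat :=
  if n is k.+1 then (if f k.+1 t < m k t then k.+1 else idx k t) else 0%N.
have mm n : measurable_fun D (m n).
  by elim: n => [|n IH]; [exact: mf|exact: (measurable_minr IH (mf n.+1))].
have sidx n : simple_on D (idx n).
  elim: n => [|n IH] /=.
    split; first by apply: sub_finite_set (finite_set1 0%N) => _ [t _ <-].
    by move=> v; rewrite preimage_cst; case: ifPn => _; rewrite ?setIT ?setI0.
  apply: (@simple_on_comp2 _ _ _ _ _ (fun b k => if b then n.+1 else k)
    (fun t => f n.+1 t < m n t)) => //; split.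
    by apply: sub_finite_set (finite_set2 true false) => -[] _; [left|right].
  by move=> v; apply: (measurable_fun_ltr (mf n.+1) (mm n)).
have midx n t : m n t = f (idx n t) t.
  elim: n => [//|n IH] /=; rewrite minElt.
  by case: (ltgtP (m n t) (f n.+1 t)) => // <-.
have mle t n k : (k <= n)%N -> m n t <= f k t.
  elim: n => [|n IH]; first by rewrite leqn0 => /eqP ->.
  rewrite leq_eqVlt => /predU1P[->|kn] /=; first by rewrite ge_min lexx orbT.
  by rewrite ge_min IH.
exists (fun n t => e (idx n t)).
have he n : simple_on D (fun t => e (idx n t)).
  by apply: (@simple_on_comp2 _ _ _ _ _ (fun k _ => e k) (idx n) (idx n)).
split; first by move=> n; case: (he n).
split; first by move=> n; case: (he n).
apply: filterS (ae_foralln ef) => t et Dt.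
apply/cvgrPdist_lt => r r0; have [k kr] := de (u t) r r0.
exists k => // n /= kn; rewrite (et _ Dt) -midx.
by apply: le_lt_trans (mle _ _ _ kn) _; rewrite -(et _ Dt).
Qed.

End strong_measurability.

Lemma separable_seq (R : realType) (H : normedModType R) : separable_space (H := H) ->
  exists e : nat -> H, dense (range e) /\
    forall (x : H) (r : R), 0 < r -> exists n, `|x - e n| < r.
Proof.
move=> [D [/countable_injP[f finj] dD]].
(* Indices outside the image of [D] yield the default point 0, which does not harm density. *)
pose e n := xget 0 [set x | D x /\ f x = n].
have eD x : D x -> e (f x) = x.
  move=> Dx; rewrite /e; case: xgetP => [y _ [Dy fy]|/(_ x)]; last by case.
  by apply: finj => //; rewrite inE.
have de : dense (range e).
  by move=> O O0 oO; have [x [Ox Dx]] := dD O O0 oO; exists x; split => //; exists (f x) => //; rewrite eD.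
exists e; split => // x r r0.
have [y [/= + [n _ en]]] : (ball x r `&` range e) !=set0.
  by apply: de; [exists x; exact: ballxx|exact: ball_open].
by rewrite -en -ball_normE => xr; exists n.
Qed.

Section L2_space.
Context {R : realType} {H : normedModType R}.
Variables (ip : H -> H -> R) (ipP : is_inner_product ip) (T : R).
Notation mu := (@lebesgue_measure R).
Notation D := (`[0%R, T]%classic).
Notation I := (Rintegral mu D).
Implicit Types u v : R -> H.

Let mD : measurable (D : set (measurableTypeR R)). Proof. exact: measurable_itv. Qed.

Lemma L2P u : L2 T u <-> strongly_measurable T u /\ aeint mu D (fun t => `|u t| ^+ 2).
Proof.
split=> -[mu_u h]; split => //.
  by apply: ge0_aeint => //; exact: sm_sqr.
by have -> := EFin_Rint mD h; exact: ltry.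
Qed.

Lemma L2_sqr u : L2 T u -> aeint mu D (fun t => `|u t| ^+ 2).
Proof. by case/L2P. Qed.

Lemma L2_dom u (g : R -> R) : strongly_measurable T u -> aeint mu D g ->
  {ae mu, forall t, D t -> `|u t| ^+ 2 <= g t} -> L2 T u.
Proof.
move=> su ig ug; apply/L2P; split => //; apply: le_aeint ig _; first exact: sm_sqr.
by apply: filterS ug => t ug Dt; rewrite ger0_norm ?sqr_ge0// ug.
Qed.

Lemma L2D u v : L2 T u -> L2 T v -> L2 T (fun t => u t + v t).
Proof.
move=> /L2P[su iu] /L2P[sv iv].
apply: (@L2_dom _ (fun t => 2 * `|u t| ^+ 2 + 2 * `|v t| ^+ 2)); first exact: smD.
  by apply: aeintD => //; exact: aeintZ.
by apply: aeW => t _; exact: normD2_le ipP _ _.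
Qed.

Lemma L2Z (k : R) u : L2 T u -> L2 T (fun t => k *: u t).
Proof.
move=> /L2P[su iu].
apply: (@L2_dom _ (fun t => `|k| ^+ 2 * `|u t| ^+ 2)); first exact: smZ.
  exact: aeintZ.
by apply: aeW => t _; rewrite normrZ exprMn.
Qed.

Lemma L2B u v : L2 T u -> L2 T v -> L2 T (fun t => u t - v t).
Proof.
move=> hu /(L2Z (-1)) hv; have := L2D hu hv.
by under eq_fun do rewrite scaleN1r.
Qed.

(** Reduces the measurability and integrability of [ip (u t) (v t)] to those of squared norms. *)
Lemma polarization (x y : H) : ip x y = 4^-1 * (`|x + y| ^+ 2 - `|x - y| ^+ 2).
Proof. by rewrite (normD2 ipP) (normB2 ipP); field. Qed.

Lemma L2_ip u v : L2 T u -> L2 T v -> aeint mu D (fun t => ip (u t) (v t)).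
Proof.
move=> hu hv; apply: (@aeint_ae _ _ R mu D (fun t => 4^-1 * (`|u t + v t| ^+ 2 - `|u t - v t| ^+ 2))).
  by apply: aeW => t _; rewrite polarization.
by apply: aeintZ => //; apply: aeintB => //; apply: L2_sqr; [exact: L2D|exact: L2B].
Qed.

Lemma Rint_ip_young (a : R) u v : 0 < a -> L2 T u -> L2 T v ->
  `|I (fun t => ip (u t) (v t))| <=
  a / 2 * I (fun t => `|u t| ^+ 2) + (2 * a)^-1 * I (fun t => `|v t| ^+ 2).
Proof.
move=> a0 hu hv; have [iu iv] := (L2_sqr hu, L2_sqr hv).
have b : aeint mu D (fun t => a / 2 * `|u t| ^+ 2 + (2 * a)^-1 * `|v t| ^+ 2).
  by apply: aeintD => //; exact: aeintZ.
rewrite -!RintZ// -RintD//; [|exact: aeintZ|exact: aeintZ].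
rewrite ler_norml; apply/andP; split; last first.
  apply: le_Rint => //; first exact: L2_ip.
  by apply: aeW => t _; apply: le_trans (ler_norm _) (ip_young ipP _ _ a0).
rewrite -mulN1r -RintZ//; apply: le_Rint => //; [exact: aeintZ|exact: L2_ip|].
apply: aeW => t _; rewrite mulN1r lerNl.
by apply: le_trans (ip_young ipP _ _ a0); rewrite -normrN ler_norm.
Qed.

Lemma aeint_cst (k : R) : aeint mu D (fun=> k).
Proof.
apply: integrable_aeint; apply: measurable_bounded_integrable => //.
  by apply: (@le_lt_trans _ _ (mu `[0%R, T]%classic)) => //; rewrite lebesgue_measure_itv; case: ifP => _; rewrite ?ltry.
by exists `|k|; split => // x kx y _; exact: ltW.
Qed.

Lemma Rint_cst (k : R) : 0 <= T -> I (fun=> k) = k * T.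
Proof.
move=> T0; rewrite Rintegral_cst// /= lebesgue_measure_itv/=.
case: ifPn => [_|]; first by rewrite sube0.
by rewrite lte_fin -leNgt => T0'; congr (_ * _); apply/eqP; rewrite eq_le T0 T0'.
Qed.

End L2_space.

(** * Completeness of $L^2(0,T;H)$ *)

Section riesz_fischer.
Context {R : realType} {H : completeNormedModType R}.
Variables (ip : H -> H -> R) (ipP : is_inner_product ip) (T : R).
Hypothesis sepH : separable_space (H := H).
Hypothesis T0 : 0 < T.
Notation mu := (@lebesgue_measure R).
Notation D := (`[0%R, T]%classic).
Notation I := (Rintegral mu D).

Let mD : measurable (D : set (measurableTypeR R)). Proof. exact: measurable_itv. Qed.

(** Along a fast subsequence the increments are summable almost everywhere, hence it converges
    pointwise. Fatou's lemma then compares each term of the whole sequence with this limit. *)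
Lemma L2_complete (c : nat -> R -> H) : (forall k, L2 T (c k)) ->
  (forall e : R, 0 < e -> exists N, forall k l, (N <= k)%N -> (k <= l)%N ->
      I (fun t => `|c k t - c l t| ^+ 2) <= e) ->
  exists2 g, L2 T g & forall e : R, 0 < e -> exists N, forall k, (N <= k)%N ->
      I (fun t => `|c k t - g t| ^+ 2) <= e.
Proof.
move=> Lc cc.
have [e [_ de]] := separable_seq sepH.
have /choice[sg sgP] : forall k, exists N, forall i j, (N <= i)%N -> (i <= j)%N ->
    I (fun t => `|c i t - c j t| ^+ 2) <= (4^-1) ^+ k.
  by move=> k; apply: cc; rewrite exprn_gt0.
pose s := fix s k := (if k is k'.+1 then (s k' + sg k).+1 else sg 0%N)%N.
have sge k : (sg k <= s k)%N by case: k => [//|k] /=; rewrite leqW// leq_addl.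
have sS k : (s k <= s k.+1)%N by rewrite /= leqW// leq_addr.
have sinc k l : (k <= l)%N -> (s k <= s l)%N.
  by move=> kl; apply: (homo_leq (leqnn) (@leq_trans) sS).
have sgrow k : (k <= s k)%N.
  by elim: k => [//|k IH] /=; rewrite ltnS (leq_trans IH)// leq_addr.
pose a k t := `|c (s k) t - c (s k.+1) t|.
have ia2 k : aeint mu D (fun t => a k t ^+ 2) by apply: L2_sqr; exact: (L2B ipP).
have ima k : aemeas mu D (a k).
  by apply: sm_norm; apply: smB; [exact: (Lc _).1|exact: (Lc _).1].
have p0 k : 0 < 2 ^+ k :> R by rewrite exprn_gt0.
(* Young's inequality with weight [2 ^ k] turns the bound [4^-k] on the integral of [a k ^ 2] into
   one of order [2^-k] on the integral of [a k]. *)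
have abnd k t : a k t <= 2^-1 * (2 ^+ k * a k t ^+ 2 + (2^-1) ^+ k).
  rewrite -(ler_pM2l (p0 k)) exprVn.
  have -> : 2 ^+ k * (2^-1 * (2 ^+ k * a k t ^+ 2 + (2 ^+ k)^-1)) =
    2^-1 * ((2 ^+ k * a k t) ^+ 2 + 1) by field; rewrite gt_eqF.
  by have := sqr_ge0 (2 ^+ k * a k t - 1); move: (2 ^+ k * a k t) => x; lra.
have ib k : aeint mu D (fun t => 2 ^+ k * a k t ^+ 2 + (2^-1) ^+ k).
  by apply: aeintD => //; [exact: aeintZ|exact: aeint_cst].
have ia k : aeint mu D (a k).
  apply: le_aeint (aeintZ mD 2^-1 (ib k)) _ => //; apply: aeW => t _.
  by rewrite ger0_norm ?normr_ge0//; exact: abnd.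
have Ia k : I (a k) <= (2^-1) ^+ k * ((1 + T) / 2).
  apply: le_trans (le_Rint mD (ia k) (aeintZ mD 2^-1 (ib k)) _) _.
    by apply: aeW => t _; exact: abnd.
  rewrite RintZ// RintD//; [|exact: aeintZ|exact: aeint_cst].
  rewrite RintZ// Rint_cst ?(ltW T0)//.
  have h : I (fun t => a k t ^+ 2) <= (4^-1) ^+ k.
    by apply: sgP => //; exact: sge.
  have e4 : (4^-1) ^+ k = (2^-1) ^+ k * (2^-1) ^+ k :> R.
    by rewrite -exprMn; congr (_ ^+ _); field.
  have e1 : 2 ^+ k * (2^-1) ^+ k = 1 :> R by rewrite -exprMn mulfV// expr1n.
  have : 2 ^+ k * I (fun t => a k t ^+ 2) <= (2^-1) ^+ k.
    have -> : (2^-1) ^+ k = 2 ^+ k * (4^-1) ^+ k :> R by rewrite e4 mulrA e1 mul1r.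
    by rewrite ler_pM2l.
  by move: (2 ^+ k * _) (2^-1 ^+ k) => x q; lra.
pose S n t := \sum_(k < n) a k t.
have SS n : S n.+1 = fun t => S n t + a n t.
  by apply/funext => t; rewrite /S big_ord_recr.
have iS n : aeint mu D (S n).
  elim: n => [|n IH]; last by rewrite SS; apply: aeintD.
  apply: aeint_ae (aeint_cst _ 0); apply: aeW => t _.
  by rewrite /S big_ord0.
have IS n : I (S n) <= 1 + T.
  suff : I (S n) <= (1 - (2^-1) ^+ n) * (1 + T).
    move/le_trans; apply; apply: ler_piMl; first by rewrite addr_ge0 ?(ltW T0).
    by rewrite gerBl exprn_ge0.
  elim: n => [|n IH].
    rewrite expr0 subrr mul0r (@Rint_ae _ _ R mu D _ (fun=> 0)).
      by rewrite Rint_cst ?mul0r// ltW.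
    by apply: aeW => t _; rewrite /S big_ord0.
  rewrite SS RintD// exprS; have := Ia n; move: (2^-1 ^+ n) IH => q; lra.
have cS : {ae mu, forall t, D t -> cvgn (S ^~ t)}.
  apply: (ae_cvgn_of_Rint mD iS) IS.
    by apply: aeW => t _ n; apply: sumr_ge0 => k _; exact: normr_ge0.
  apply: aeW => t _; apply/nondecreasing_seqP => n.
  by rewrite SS lerDl normr_ge0.
have cc' : {ae mu, forall t, D t -> cvgn (fun k => c (s k) t)}.
  apply: filterS cS => t cS /cS/cvg_ex[l /cvgrPdist_lt Sl].
  have cS' k m : `|c (s k) t - c (s (k + m)%N) t| <= S (k + m)%N t - S k t.
    elim: m => [|m IH]; first by rewrite addn0 !subrr normr0.
    rewrite addnS SS; apply: le_trans (ler_distD (c (s (k + m)%N) t) _ _) _.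
    by rewrite addrAC lerD.
  apply: cauchy_seq_cvgn => r r0; have r2 : 0 < r / 2 by rewrite divr_gt0.
  have [N _ hN] := Sl _ r2; exists N => k m Nk km.
  rewrite -(subnKC km); apply: le_lt_trans (cS' _ _) _; rewrite (subnKC km).
  have := hN _ Nk; have := hN _ (leq_trans Nk km).
  by rewrite /= !ltr_norml => /andP[? ?] /andP[? ?]; lra.
pose g t := limn (fun k => c (s k) t).
have cg : {ae mu, forall t, D t -> c (s k) t @[k --> \oo] --> g t}.
  by apply: filterS cc' => t h /h.
have sg_ : strongly_measurable T g.
  apply: (pettis de) => n.
  apply: (@aemeas_lim _ _ R mu D (fun k t => `|c (s k) t - e n|)).
    move=> k; apply: sm_norm; apply: smB; [exact: (Lc _).1|exact: sm_cst].
  apply: filterS cg => t cg Dt; apply: cvg_norm; apply: cvgB; first exact: cg.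
  exact: cvg_cst.
have fatou N r i : (forall k l, (N <= k)%N -> (k <= l)%N ->
      I (fun t => `|c k t - c l t| ^+ 2) <= r) -> (N <= i)%N ->
   aeint mu D (fun t => `|c i t - g t| ^+ 2) /\ I (fun t => `|c i t - g t| ^+ 2) <= r.
  move=> Nr Ni.
  apply: (@aeint_ge0_lim _ _ R mu D mD (fun k t => `|c i t - c (s k) t| ^+ 2)).
  - by move=> k; apply: L2_sqr; apply: (L2B ipP).
  - by apply: sm_sqr; apply: smB => //; exact: (Lc _).1.
  - by move=> k; apply: aeW => t _; exact: sqr_ge0.
  - by apply: aeW => t _; exact: sqr_ge0.
  - apply: filterS cg => t cg Dt.
    have : (`|c i t - c (s k) t| ^+ 2)%:E @[k --> \oo] --> (`|c i t - g t| ^+ 2)%:E.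
      apply: cvg_EFin; first exact: nearW.
      rewrite /comp /=; under eq_fun do rewrite expr2.
      rewrite expr2; apply: cvgM; apply: cvg_norm; apply: cvgB => //;
        by [exact: cvg_cst|exact: cg].
    by move=> /cvg_limn_einf_sup[-> _].
  - by exists i => // k /= ik; apply: Nr => //; exact: leq_trans (sgrow k).
have Lg : L2 T g.
  have [N hN] := cc 1 ltr01.
  have [ig _] := fatou N 1 N hN (leqnn N).
  have : L2 T (fun t => c N t - (c N t - g t)).
    apply: (L2B ipP) => //; apply/L2P; split => //.
    by apply: smB => //; exact: (Lc _).1.
  by under eq_fun do rewrite subKr.
exists g => // r r0; have [N hN] := cc r r0; exists N => i Ni.
by have [] := fatou N r i hN Ni.
Qed.

End riesz_fischer.

(** * Absolutely continuous functions *)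

Section absolute_continuity.
Context {R : realType}.
Notation mu := (@lebesgue_measure R).
Implicit Types (f k : R -> R) (a b : R).

Lemma abs_continuous_onB a b f g : abs_continuous_on a b f ->
  abs_continuous_on a b g -> abs_continuous_on a b (fun t => f t - g t).
Proof.
move=> cf cg e e0; have e2 : 0 < e / 2 by rewrite divr_gt0.
have [d1 d10 h1] := cf _ e2; have [d2 d20 h2] := cg _ e2.
exists (Num.min d1 d2); first by rewrite lt_min d10.
move=> n l r lr dis; rewrite lt_min => /andP[s1 s2].
have := ltrD (h1 n l r lr dis s1) (h2 n l r lr dis s2).
rewrite -splitr -big_split; apply: le_lt_trans; apply: ler_sum => i _ /=.
have -> : f (r i) - g (r i) - (f (l i) - g (l i)) =
  (f (r i) - f (l i)) - (g (r i) - g (l i)) by ring.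
exact: ler_normB.
Qed.

(** Disjoint intervals as a list ordered from right to left: a construction that advances to the
    right adds each new interval at the head. *)
Lemma abs_continuous_on_seq a b f (e : R) : abs_continuous_on a b f -> 0 < e ->
  exists2 d, 0 < d & forall s : seq (R * R),
    (forall p, p \in s -> [/\ a <= p.1, p.1 <= p.2 & p.2 <= b]) ->
    pairwise (fun p q => q.2 <= p.1) s ->
    \sum_(p <- s) (p.2 - p.1) < d -> \sum_(p <- s) `|f p.2 - f p.1| < e.
Proof.
move=> cf e0; have [d d0 h] := cf e e0; exists d => // s sab spw sd.
have := h (size s) (fun i => (nth (0, 0) s i).1) (fun i => (nth (0, 0) s i).2).
rewrite !(big_nth (0, 0)) !big_mkord in sd *; apply => //.
  by move=> i; have [? ? ?] := sab _ (mem_nth (0, 0) (ltn_ord i)).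
move=> i j; rewrite neq_ltn => /orP[ij|ij].
  by right; have /(pairwiseP (0, 0)) := spw; apply => //; rewrite inE.
by left; have /(pairwiseP (0, 0)) := spw; apply => //; rewrite inE.
Qed.

Lemma derive1_0_near f t (e : R) : derivable f t 1 -> derive1 f t = 0 -> 0 < e ->
  exists2 d, 0 < d & forall s, `|s - t| < d -> `|f s - f t| <= e * `|s - t|.
Proof.
move=> df f0 e0.
have /cvg_ex[l fl] := df.
have l0 : l = 0.
  by rewrite -f0 derive1E; apply/esym/cvg_lim.
move: fl => /cvgrPdist_lt/(_ e e0); rewrite near_withinE => /nbhs_ballP[d /= d0 hd].
exists d => // s st; have [->|nst] := eqVneq s t.
  by rewrite !subrr normr0 mulr0.
have := hd (s - t); rewrite /ball /= sub0r normrN => /(_ st).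
rewrite subr_eq0 => /(_ nst); rewrite l0 sub0r normrN.
rewrite /GRing.scale /= mulr1 subrK normrM normfV.
by rewrite mulrC ltr_pdivrMr ?normr_gt0 ?subr_eq0// => /ltW.
Qed.

(* A gauge argument: around a point with zero derivative the increment of [f] is at most [e]
   times the length; the remaining points lie in an open set of measure [< d],
   where absolute continuity bounds the sum of the increments. *)
Lemma abs_continuous_cst a b f : a <= b -> abs_continuous_on a b f ->
  {ae mu, forall t, `]a, b[%classic t -> derivable f t 1 /\ derive1 f t = 0} ->
  f b = f a.
Proof.
move=> ab cf [N [mN N0 fN]].
apply/eqP; rewrite -subr_eq0 -normr_le0; apply/ler_addgt0Pr => e' e'0; rewrite add0r.
(* The final bound is [e * (b - a) + e]: the first term comes from the points with zero derivative,
   the second from absolute continuity. *)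
pose e : R := e' / (b - a + 1).
have ba1 : 0 < b - a + 1 by rewrite ltr_wpDl// subr_ge0.
have e0 : 0 < e by rewrite divr_gt0.
have [d d0 hd] := abs_continuous_on_seq cf e0.
(* The endpoints, where nothing is known on the derivative, join the exceptional set. *)
have mN' : measurable (N `|` [set a; b]) by apply: measurableU => //; apply: measurableU.
have N'0 : mu (N `|` [set a; b]) = 0%E.
  apply/(negligibleP mu mN'); apply: negligibleU; first exact/negligibleP.
  by apply: negligibleU; apply/negligibleP => //; exact: lebesgue_measure_set1.
have [V [oV NV Vd]] : exists V : set R, [/\ open V, N `|` [set a; b] `<=` V & (mu V < d%:E)%E].
  have N'oo : (mu (N `|` [set a; b]) < +oo)%E by have -> := N'0; exact: ltry.
  have [V [oV NV Vd]] := lebesgue_regularity_outer mN' N'oo d0.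
  exists V; split => //; apply: le_lt_trans Vd.
  rewrite -{1}(setDUK NV) -[leRHS]add0e -N'0; apply: measureU2 => //.
  by apply: measurableD => //; exact: open_measurable.
have mO : measurable (V : set (measurableTypeR R)) by exact: open_measurable.
have gauge c : a <= c <= b -> exists2 r, 0 < r &
   (forall t t', a <= t -> t' <= b -> c - r < t -> t <= c -> c <= t' -> t' < c + r ->
      `|f t' - f t| <= e * (t' - t)) \/ (forall x, `|x - c| < r -> V x).
  move=> /andP[ac cb]; have [cN|cN] := pselect ((N `|` [set a; b]) c).
    have /nbhs_ballP[r /= r0 hr] : nbhs c V by apply: open_nbhs_nbhs; split => //; exact: NV.
    by exists r => //; right => x xc; apply: hr; rewrite /ball /= distrC.
  have cab : `]a, b[%classic c.
    rewrite /= in_itv /= !lt_neqAle ac cb !andbT; apply/andP; split; apply/eqP => h.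
      by apply: cN; right; left.
    by apply: cN; right; right.
  have [df f0] : derivable f c 1 /\ derive1 f c = 0.
    apply: contrapT => nd; apply: cN; left; apply: fN => /(_ cab).
    exact: nd.
  have [r r0 hr] := derive1_0_near df f0 e0; exists r => //; left.
  move=> t t' at_ t'b crt tc ct' t'cr.
  have n1 : `|t' - c| = t' - c by rewrite ger0_norm ?subr_ge0.
  have n2 : `|t - c| = c - t by rewrite distrC ger0_norm ?subr_ge0.
  have h1 : `|f t' - f c| <= e * (t' - c) by rewrite -n1 hr// n1; lra.
  have h2 : `|f t - f c| <= e * (c - t) by rewrite -n2 hr// n2; lra.
  apply: le_trans (ler_distD (f c) _ _) _; rewrite (distrC (f c)).
  by have -> : e * (t' - t) = e * (t' - c) + e * (c - t); [ring|exact: lerD].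
pose ok t (s : seq (R * R)) := [/\
  forall p, p \in s -> [/\ a <= p.1, p.1 <= p.2 & p.2 <= t],
  pairwise (fun p q => q.2 <= p.1) s,
  ((\sum_(p <- s) (p.2 - p.1))%:E <= mu (V `&` `[a, t[))%E &
  `|f t - f a| <= e * (t - a) + \sum_(p <- s) `|f p.2 - f p.1|].
pose S := [set t | a <= t <= b /\ exists s, ok t s].
suff : S b.
  move=> [_ [s [sab spw sO sf]]].
  apply: le_trans sf _.
  have : \sum_(p <- s) `|f p.2 - f p.1| < e.
    apply: hd => //; rewrite -lte_fin; apply: le_lt_trans sO _; apply: le_lt_trans Vd.
    by apply: le_measure; rewrite ?inE//; exact: measurableI.
  move=> /ltW h; apply: le_trans (lerD (lexx _) h) _.
  by rewrite /e; have -> : e' / (b - a + 1) * (b - a) + e' / (b - a + 1) = e' by field; rewrite gt_eqF.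
have mOitv x y : measurable (V `&` `[x, y[%classic : set (measurableTypeR R)).
  exact: measurableI.
(* Reachability passes across every [c]. Applied at the supremum of [S], this shows that the
   supremum is [b] and belongs to [S]. *)
have step c : a <= c <= b -> exists2 r, 0 < r &
    forall t t', S t -> c - r < t -> t <= c -> c <= t' -> t' < c + r -> t' <= b -> S t'.
  move=> cab; have [r r0 hr] := gauge c cab; exists r => // t t'.
  move=> [/andP[at_ tb] [s [sab spw sO sf]]] crt tc ct' t'cr t'b.
  have tt' : t <= t' by exact: le_trans ct'.
  split; first by rewrite (le_trans at_ tt').
  case: hr => [hr|hr].
    exists s; split => //.
    - by move=> p /sab[? ? ?]; split => //; exact: le_trans tt'.
    - apply: le_trans sO _; apply: le_measure; rewrite ?inE//.
      by apply: setIS; apply: subset_itvl; rewrite bnd_simp.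
    - have := hr t t' at_ t'b crt tc ct' t'cr.
      have := ler_distD (f t) (f t') (f a); move: (\sum_(_ <- _) _) sf => x; lra.
  exists ((t, t') :: s); split => //.
  - move=> p; rewrite inE => /predU1P[-> //|/sab[? ? ?]].
    by split => //; exact: le_trans tt'.
  - by rewrite /= spw andbT; apply/allP => p /sab[].
  - rewrite big_cons /= EFinD.
    have <- : mu `[t, t'[%classic = (t' - t)%:E.
      rewrite lebesgue_measure_itv/= lte_fin; case: ltP => //.
      by move=> t't; have -> : t' = t; [by apply/eqP; rewrite eq_le t't tt'|rewrite subrr].
    apply: le_trans (leeD (lexx _) sO) _.
    rewrite addeC -measureU//; last first.
      apply/seteqP; split => // x [[_ /=]]; rewrite !in_itv/= => /andP[_ xt] /andP[tx _].
      by move: xt; rewrite ltNge tx.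
    apply: le_measure; rewrite ?inE//; first exact: measurableU.
    move=> x [[Ox]|]; rewrite /= !in_itv/= => /andP[h1 h2].
      by split => //; rewrite h1 (lt_le_trans h2).
    by split; [apply: hr; rewrite ltr_norml; lra|rewrite h2 (le_trans at_)].
  - rewrite big_cons /=; have := ler_distD (f t) (f t') (f a).
    have : e * (t - a) <= e * (t' - a) by rewrite ler_wpM2l ?(ltW e0)// lerD2r.
    by move: (\sum_(_ <- _) _) sf => x; lra.
have Sa : S a.
  split; first by rewrite lexx.
  exists [::]; split => //; rewrite ?big_nil//.
  by rewrite !subrr normr0 mulr0 addr0.
have hS : has_sup S by split; [exists a|exists b => t [/andP[]]].
pose c := sup S.
have Sle t : S t -> t <= c by move=> St; apply: ub_le_sup => //; case: hS.
have cab : a <= c <= b.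
  by rewrite Sle//=; apply: ge_sup; [exists a|move=> t [/andP[]]].
have [r r0 hr] := step c cab.
have [t St ct] := sup_adherent r0 hS.
have [ac cb] := andP cab.
have [bc|bc] := leP b c.
  have -> : b = c by apply/eqP; rewrite eq_le bc cb.
  by apply: (hr t) => //; [exact: Sle|rewrite ltrDl].
have : S (Num.min b (c + r / 2)).
  apply: (hr t) => //; [exact: Sle| | |by rewrite ge_min lexx].
  - by rewrite le_min cb; lra.
  - by rewrite gt_min; apply/orP; right; lra.
move=> /Sle; rewrite ge_min leNgt bc /= => h; lra.
Qed.

(** The disjoint intervals form a set of small measure, over which the integral of [|k|] is
    small. *)
Lemma abs_continuous_on_primitive a b k : mu.-integrable setT (EFin \o k) ->
  abs_continuous_on a b (fun t => \int[mu]_(x in `[a, t]) k x).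
Proof.
move=> ik e e0; have [d [d0 hd]] := integral_normr_continuous ik e0.
exists d => // n l r lr dis sd.
have iS (A : set (measurableTypeR R)) : measurable A -> mu.-integrable A (EFin \o k).
  by move=> mA; exact: integrableS ik.
pose A i : set (measurableTypeR R) := `]l i, r i]%classic.
have mA i : measurable (A i) by exact: measurable_itv.
have tA : trivIset [set` index_enum 'I_n] A.
  apply/trivIsetP => i j _ _ ij; apply/seteqP; split => // x [].
  rewrite /A /= !in_itv/= => /andP[h1 h2] /andP[h3 h4].
  by have [h|h] := dis _ _ ij; lra.
have mU : measurable (\big[setU/set0]_(i <- index_enum 'I_n) A i).
  by apply: bigsetU_measurable.
have muA i : mu (A i) = (r i - l i)%:E.
  rewrite /A lebesgue_measure_itv/= lte_fin; case: ltP => // ri.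
  have [_ [li _]] := lr i.
  by have -> : r i = l i; [apply/eqP; rewrite eq_le ri li|rewrite subrr].
have muU : (mu (\big[setU/set0]_(i <- index_enum 'I_n) A i) < d%:E)%E.
  rewrite -[X in (X < _)%E]mul1e -integral_cst// ge0_integral_bigsetU//; last first.
    exact: index_enum_uniq.
  rewrite (eq_bigr (fun i => (r i - l i)%:E)); first by rewrite sumEFin lte_fin.
  by move=> i _; rewrite integral_cst// mul1e; exact: muA.
apply: le_lt_trans (hd _ mU muU).
have iN (B : set (measurableTypeR R)) : measurable B ->
    (\int[mu]_(x in B) `|k x|)%:E = (\int[mu]_(x in B) (`|k x|)%:E)%E.
  move=> mB; rewrite /Rintegral fineK//; apply: integrable_fin_num => //.
  exact: (integrable_norm (iS _ mB)).
rewrite -lee_fin iN// ge0_integral_bigsetU//=; last 2 first.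
- exact: index_enum_uniq.
- by have /measurable_int := integrable_norm (iS _ mU).
rewrite -sumEFin; apply: lee_sum => i _.
have [al [lri rb]] := lr i.
rewrite Rintegral_itvB ?bnd_simp//; last exact: iS.
rewrite -iN// lee_fin; apply: le_normr_Rintegral => //; exact: iS.
Qed.

(** The primitive is that of an integrable representative of [k], extended by zero to the line; it
    is differentiable at almost every point. *)
Lemma primitive_exists a b k : aeint mu `[a, b]%classic k ->
  exists F, [/\ forall x, a <= x <= b -> F x = \int[mu]_(t in `[a, x]) k t,
    abs_continuous_on a b F &
    {ae mu, forall t, `]a, b[%classic t -> derivable F t 1 /\ derive1 F t = k t}].
Proof.
move=> [k0 ik ek].
pose K : R -> R := k0 \_ `[a, b].
have mab : measurable (`[a, b]%classic : set (measurableTypeR R)).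
  exact: measurable_itv.
have iK : mu.-integrable setT (EFin \o K).
  have := (integrable_mkcond (EFin \o k0) mab).1 ik.
  by rewrite /K -restrict_EFin.
have eK : {ae mu, forall t, `[a, b]%classic t -> k t = K t}.
  by apply: filterS ek => t ek Dt; rewrite ek// /K patchE mem_set.
exists (fun x => \int[mu]_(t in `[a, x]) K t); split.
- move=> x /andP[ax xb]; apply: Rint_ae; apply: filterS eK => t eK Dt.
  rewrite eK//; move: Dt; rewrite /= !in_itv/= => /andP[-> tx].
  exact: le_trans xb.
- exact: abs_continuous_on_primitive.
- have := @FTC1 R K (BLeft a).
  have iK' y : mu.-integrable [set` Interval (BLeft a) (BRight y)] (EFin \o K).
    by apply: integrableS iK => //; exact: measurable_itv.
  move=> /(_ iK' (open_integrable_locally openT iK)) h.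
  apply: filterS2 eK h => t eK h tab.
  move: (tab); rewrite /= in_itv /= => /andP[at_ tb].
  have [df f't] := h at_; split => //.
  by rewrite f't eK//= in_itv/= (ltW at_) (ltW tb).
Qed.

(** [f] minus a primitive of [k] is absolutely continuous with zero derivative almost everywhere,
    hence takes the same value at both ends. *)
Lemma ftc_abs_continuous a b f k : a <= b -> abs_continuous_on a b f ->
  aeint mu `[a, b]%classic k ->
  {ae mu, forall t, `]a, b[%classic t -> derivable f t 1 /\ derive1 f t = k t} ->
  f b - f a = \int[mu]_(t in `[a, b]) k t.
Proof.
move=> ab cf /primitive_exists[F [FE cF dF]] df.
have : f b - F b = f a - F a.
  apply: (abs_continuous_cst ab (abs_continuous_onB cf cF)).
  apply: filterS2 df dF => t df dF tab.
  have [df1 df2] := df tab; have [dF1 dF2] := dF tab; split.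
    exact: derivableB.
  by rewrite derive1E (deriveB df1 dF1) -!derive1E df2 dF2 subrr.
rewrite (FE b) ?lexx ?ab// (FE a) ?lexx ?ab// set_itv1 Rintegral_set1.
by move=> h; lra.
Qed.

Lemma ae_eq0_of_primitive a b k : aeint mu `[a, b]%classic k ->
  (forall t, a <= t <= b -> \int[mu]_(x in `[a, t]) k x = 0) ->
  {ae mu, forall t, `[a, b]%classic t -> k t = 0}.
Proof.
move=> /primitive_exists[F [FE _ dF]] k0.
have ne x : {ae mu, forall t, t != x}.
  exists [set x]; split => //; first exact: lebesgue_measure_set1.
  by move=> t /= /negP; rewrite negbK => /eqP.
apply: filterS3 dF (ne a) (ne b) => t dF ta tb.
rewrite /= in_itv/= => /andP[at_ tb'].
have tab : t \in `]a, b[ by rewrite in_itv/= !lt_neqAle at_ tb' eq_sym ta tb.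
have [_ <-] := dF tab.
rewrite derive1E (@near_eq_derive _ _ _ F (cst 0)) ?derive_cst//.
near=> x; rewrite FE ?k0//.
all: have : x \in `]a, b[ by near: x; exact: near_in_itvoo.
all: by rewrite in_itv/= => /andP[/ltW -> /ltW ->].
Unshelve. all: by end_near. Qed.

End absolute_continuity.

(** * The space H1 *)

(** [P] may depend on the rank [k], which allows for an accuracy of [1/(k+1)] at rank [k]; a
    constant family gives an ordinary subsequence. *)
Lemma increasing_extraction (P : nat -> nat -> Prop) :
  (forall k N, exists2 n, (N <= n)%N & P k n) ->
  exists2 s : nat -> nat, {homo s : m n / (m < n)%N >-> (m < n)%N} &
    forall k, P k (s k).
Proof.
move=> hP.
have /choice[f fP] : forall kN : nat * nat, exists n, (kN.2 <= n)%N /\ P kN.1 n.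
  by move=> [k N]; have [n] := hP k N; exists n.
pose s := fix s k := f (k, if k is k'.+1 then (s k').+1 else 0%N).
exists s; last by case=> [|k]; [have [] := fP (0%N, 0%N)|have [] := fP (k.+1, (s k).+1)].
have sS k : (s k < s k.+1)%N by have [] := fP (k.+1, (s k).+1).
exact: (homo_ltn ltn_trans sS).
Qed.

Lemma increasing_ge_id (s : nat -> nat) :
  {homo s : m n / (m < n)%N >-> (m < n)%N} -> forall n, (n <= s n)%N.
Proof. by move=> hs; elim=> [//|n IH]; exact: leq_ltn_trans (hs _ _ (ltnSn n)). Qed.

Lemma increasing_cvg (s : nat -> nat) :
  {homo s : m n / (m < n)%N >-> (m < n)%N} -> s n @[n --> \oo] --> \oo.
Proof.
move=> hs A [N _ NA]; exists N => // n /= Nn; apply: NA => /=.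
exact: leq_trans (increasing_ge_id hs n).
Qed.

Lemma cvg_subseq (V : topologicalType) (x : nat -> V) (l : V) (s : nat -> nat) :
  {homo s : m n / (m < n)%N >-> (m < n)%N} -> x @ \oo --> l ->
  x (s n) @[n --> \oo] --> l.
Proof. by move=> /increasing_cvg hs xl; exact: (cvg_comp _ _ hs xl). Qed.

Lemma limn_einf_lt_subseq (R : realType) (a : nat -> \bar R) (c : \bar R) : (limn_einf a < c)%E ->
  exists2 s : nat -> nat, {homo s : m n / (m < n)%N >-> (m < n)%N} &
    forall n, (a (s n) < c)%E.
Proof.
move=> ac; apply: (@increasing_extraction (fun _ n => (a n < c)%E)) => _ N.
apply: contrapT => h; move: ac; rewrite ltNge => /negP; apply.
apply: le_limn_einf; exists N => // n /= Nn; rewrite leNgt; apply/negP => hn.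
by apply: h; exists n.
Qed.

Section subinterval.
Context {R : realType}.
Notation mu := (@lebesgue_measure R).
Implicit Types (f : R -> R).

Lemma Rint_subset_le (A B : set (measurableTypeR R)) f :
  measurable A -> measurable B -> A `<=` B -> aeint mu B f ->
  (forall x, 0 <= f x) -> \int[mu]_(x in A) f x <= \int[mu]_(x in B) f x.
Proof.
move=> mA mB AB iB f0; have iA := aeint_sub mA mB AB iB.
rewrite -lee_fin -!EFin_Rint// integral_mkcond [leRHS]integral_mkcond.
apply: ge0_ae_le_integral_nm.
- by move=> x _; apply: erestrict_ge0 => y _; rewrite lee_fin.
- by move=> x _; apply: erestrict_ge0 => y _; rewrite lee_fin.
apply: aeW => x _; rewrite !patchE; case: ifPn => [/set_mem/AB Bx|_].
  by rewrite mem_set.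
by case: ifPn; rewrite // lee_fin.
Qed.

Lemma Rint_itvB_ae (a s t : R) f : a <= s -> s <= t ->
  aeint mu `[a, t]%classic f ->
  \int[mu]_(x in `[a, t]) f x - \int[mu]_(x in `[a, s]) f x =
  \int[mu]_(x in `]s, t]) f x.
Proof.
move=> as_ st [g ig eg].
have sub1 : `[a, s]%classic `<=` `[a, t]%classic.
  by apply: subset_itvl; rewrite bnd_simp.
have sub2 : `]s, t]%classic `<=` `[a, t]%classic.
  by apply: subset_itvr; rewrite bnd_simp.
rewrite (Rint_ae eg).
rewrite (@Rint_ae _ _ R mu `[a, s]%classic f g); last first.
  by apply: filterS eg => x eg /sub1; exact: eg.
rewrite (@Rint_ae _ _ R mu `]s, t]%classic f g); last first.
  by apply: filterS eg => x eg /sub2; exact: eg.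
by rewrite Rintegral_itvB// bnd_simp.
Qed.

End subinterval.

(** * Weak derivatives: linearity, uniqueness, Hölder estimate *)

Section H1_space.
Context {R : realType} {H : completeNormedModType R}.
Variables (ip : H -> H -> R) (ipP : is_inner_product ip) (T : R).
Hypothesis sepH : separable_space (H := H).
Hypothesis T0 : 0 < T.
Notation mu := (@lebesgue_measure R).
Notation D := (`[0%R, T]%classic).
Notation I := (Rintegral mu D).
Implicit Types u v w y z g : R -> H.

Let mD : measurable (D : set (measurableTypeR R)). Proof. exact: measurable_itv. Qed.
Let mI t : measurable (`[0%R, t]%classic : set (measurableTypeR R)).
Proof. exact: measurable_itv. Qed.
Let D0 : D 0. Proof. by rewrite /= in_itv/= lexx ltW. Qed.
Let subD t : t <= T -> `[0%R, t]%classic `<=` D.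
Proof. by move=> tT; apply: subset_itvl; rewrite bnd_simp. Qed.

Lemma L2_cst (h : H) : L2 T (fun=> h).
Proof. by apply/L2P; split; [exact: sm_cst|exact: aeint_cst]. Qed.

Lemma aeint_ip_sub (A : set (measurableTypeR R)) u v : measurable A -> A `<=` D ->
  L2 T u -> L2 T v -> aeint mu A (fun t => ip (u t) (v t)).
Proof. by move=> mA AD hu hv; apply: aeint_sub AD _ => //; exact: L2_ip. Qed.

(** [u] is integrated over all of [D], where a bound is known, and [v] over [A] alone: for constant
    [v] the last term is proportional to the length of [A]. *)
Lemma Rint_ip_young_sub (A : set (measurableTypeR R)) (a : R) u v :
  measurable A -> A `<=` D -> 0 < a -> L2 T u -> L2 T v ->
  `|\int[mu]_(t in A) ip (u t) (v t)| <=
  a / 2 * I (fun t => `|u t| ^+ 2) + (2 * a)^-1 * \int[mu]_(t in A) (`|v t| ^+ 2).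
Proof.
move=> mA AD a0 hu hv; have [iu iv] := (L2_sqr hu, L2_sqr hv).
have iuA := aeint_sub mA mD AD iu; have ivA := aeint_sub mA mD AD iv.
have iA := aeint_ip_sub mA AD hu hv.
have b : aeint mu A (fun t => a / 2 * `|u t| ^+ 2 + (2 * a)^-1 * `|v t| ^+ 2).
  by apply: aeintD => //; exact: aeintZ.
apply: (@le_trans _ _ (\int[mu]_(t in A) (a / 2 * `|u t| ^+ 2 + (2 * a)^-1 * `|v t| ^+ 2))).
  rewrite ler_norml; apply/andP; split; last first.
    apply: le_Rint => //.
    by apply: aeW => t _; apply: le_trans (ler_norm _) (ip_young ipP _ _ a0).
  rewrite -mulN1r -RintZ//; apply: le_Rint => //; first exact: aeintZ.
  apply: aeW => t _; rewrite mulN1r lerNl.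
  by apply: le_trans (ip_young ipP _ _ a0); rewrite -normrN ler_norm.
rewrite RintD//; [|exact: aeintZ|exact: aeintZ].
rewrite !RintZ// lerD2r ler_wpM2l ?divr_ge0 ?(ltW a0)//.
by apply: Rint_subset_le => // t; exact: sqr_ge0.
Qed.

Lemma is_derivP y g : is_deriv ip T y g <-> L2 T g /\ forall t, D t -> forall h,
  ip (y t) h = ip (y 0) h + \int[mu]_(s in `[0, t]) ip (g s) h.
Proof.
have key : L2 T g -> forall t, D t -> forall h,
    (\int[mu]_(s in `[0%R, t]) (ip (g s) h)%:E)%E =
    (\int[mu]_(s in `[0, t]) ip (g s) h)%:E.
  move=> Lg t; rewrite /= in_itv/= => /andP[_ tT] h.
  apply: EFin_Rint => //.
  by apply: (@aeint_ip_sub _ g (fun=> h)) => //; [exact: subD|exact: L2_cst].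
split=> -[Lg e]; split => // t Dt h; have := e t Dt h; rewrite key// -EFinD.
  by case.
by move=> ->.
Qed.

Lemma is_deriv_ext y z g : (forall t, D t -> y t = z t) ->
  is_deriv ip T y g -> is_deriv ip T z g.
Proof. by move=> yz [Lg e]; split => // t Dt h; rewrite -!yz//; exact: e. Qed.

Lemma is_derivD y z g k : is_deriv ip T y g -> is_deriv ip T z k ->
  is_deriv ip T (fun t => y t + z t) (fun t => g t + k t).
Proof.
move=> /is_derivP[Lg eg] /is_derivP[Lk ek]; apply/is_derivP.
split; first exact: (L2D ipP).
move=> t Dt h; rewrite !(ipDl ipP) eg// ek//.
have tT : t <= T by move: Dt; rewrite /= in_itv/= => /andP[].
have iC w : L2 T w -> aeint mu `[0, t]%classic (fun s => ip (w s) h).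
  by move=> Lw; apply: (@aeint_ip_sub _ w (fun=> h)) => //; [exact: subD|exact: L2_cst].
under [in RHS]eq_Rintegral do rewrite (ipDl ipP).
by rewrite RintD//; [ring|exact: iC|exact: iC].
Qed.

Lemma is_derivZ (a : R) y g : is_deriv ip T y g ->
  is_deriv ip T (fun t => a *: y t) (fun t => a *: g t).
Proof.
move=> /is_derivP[Lg eg]; apply/is_derivP; split; first exact: L2Z.
move=> t Dt h; rewrite !(ipZl ipP) eg//.
have tT : t <= T by move: Dt; rewrite /= in_itv/= => /andP[].
under [in RHS]eq_Rintegral do rewrite (ipZl ipP).
rewrite RintZ//; first by ring.
by apply: (@aeint_ip_sub _ g (fun=> h)) => //; [exact: subD|exact: L2_cst].
Qed.

Lemma is_derivB y z g k : is_deriv ip T y g -> is_deriv ip T z k ->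
  is_deriv ip T (fun t => y t - z t) (fun t => g t - k t).
Proof.
move=> hy /(is_derivZ (-1)) hz; have := is_derivD hy hz.
by under eq_fun do rewrite scaleN1r; under [X in is_deriv _ _ _ X]eq_fun do rewrite scaleN1r.
Qed.

(** Tested against a vector, the difference has zero primitive, hence vanishes almost everywhere. A
    dense sequence of vectors leaves countably many exceptional sets, whose union is null. *)
Lemma is_deriv_unique y g k : is_deriv ip T y g -> is_deriv ip T y k ->
  {ae mu, forall t, D t -> g t = k t}.
Proof.
move=> hg hk; have /is_derivP[L e] := is_derivB hg hk.
have [d [dd _]] := separable_seq sepH.
have h n : {ae mu, forall t, D t -> ip (g t - k t) (d n) = 0}.
  apply: ae_eq0_of_primitive; first by apply: (L2_ip ipP) => //; exact: L2_cst.
  move=> t Dt; have := e t Dt (d n); rewrite !subrr (ip0l ipP) add0r.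
  by move=> <-.
apply: filterS (ae_foralln h) => t ht Dt; apply/eqP; rewrite -subr_eq0; apply/eqP.
by apply: (ip_eq0 ipP dd) => _ [n _ <-]; exact: ht.
Qed.

(** The increment [z] is tested against itself, and Young's inequality with weight [t - s] gives
    $|z|^2\le (t-s)M/2+|z|^2/2$. *)
Lemma is_deriv_holder y g s t : is_deriv ip T y g -> D s -> D t ->
  `|y t - y s| ^+ 2 <= `|t - s| * I (fun r => `|g r| ^+ 2).
Proof.
move=> /is_derivP[Lg e].
wlog st : s t / s < t.
  move=> hw Ds Dt; have [st|ts|<-] := ltgtP s t; first exact: hw.
    by rewrite distrC (distrC t); exact: hw.
  by rewrite !subrr !normr0 expr0n mul0r.
move=> Ds Dt; set z := y t - y s; set M := I _.
move: (Ds) (Dt); rewrite /= !in_itv/= => /andP[s0 sT] /andP[t0 tT].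
have sub : `]s, t]%classic `<=` D.
  by apply: subset_itv; rewrite bnd_simp.
have zE : `|z| ^+ 2 = \int[mu]_(x in `]s, t]) ip (g x) z.
  rewrite -(ipxx ipP) {1}/z (ipBl ipP) (e t Dt) (e s Ds).
  rewrite -(@Rint_itvB_ae _ 0 s t)//; [by ring|exact: ltW|].
  by apply: (@aeint_ip_sub _ g (fun=> z)) => //; [exact: subD|exact: L2_cst].
have ts0 : 0 < t - s by rewrite subr_gt0.
have := @Rint_ip_young_sub `]s, t]%classic (t - s) g (fun=> z) (measurable_itv _) sub ts0 Lg (L2_cst z).
rewrite -zE Rintegral_cst//= lebesgue_measure_itv/= lte_fin st -EFinB /= -/M.
rewrite (gtr0_norm ts0) ger0_norm ?sqr_ge0//.
have -> : (2 * (t - s))^-1 * (`|z| ^+ 2 * (t - s)) = `|z| ^+ 2 / 2.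
  by field; rewrite gt_eqF.
move: M `|z| => M n; have -> : (t - s) / 2 * M = (t - s) * M / 2 by field.
by move: (n ^+ 2) ((t - s) * M) => a b; lra.
Qed.

End H1_space.

(** * Weak compactness and uniform limits in $H^1(0,T;H)$ *)

Section H1_weak.
Context {R : realType} {H : completeNormedModType R}.
Variables (ip : H -> H -> R) (ipP : is_inner_product ip) (T : R).
Hypothesis sepH : separable_space (H := H).
Hypothesis T0 : 0 < T.
Notation mu := (@lebesgue_measure R).
Notation D := (`[0%R, T]%classic).
Notation I := (Rintegral mu D).
Implicit Types u v w y z g : R -> H.

Let mD : measurable (D : set (measurableTypeR R)). Proof. exact: measurable_itv. Qed.
Let mI t : measurable (`[0%R, t]%classic : set (measurableTypeR R)).
Proof. exact: measurable_itv. Qed.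
Let D0 : D 0. Proof. by rewrite /= in_itv/= lexx ltW. Qed.
Let DT : D T. Proof. by rewrite /= in_itv/= lexx ltW. Qed.
Let subD t : t <= T -> `[0%R, t]%classic `<=` D.
Proof. by move=> tT; apply: subset_itvl; rewrite bnd_simp. Qed.

(** Extends a function continuous on [[0, T]] to a continuous function on the line, from which
    measurability is read off. *)
Definition clamp (t : R) := Num.max 0 (Num.min t T).

Lemma clamp_D t : D (clamp t).
Proof. by rewrite /= in_itv/= /clamp le_max lexx /= ge_max (ltW T0) ge_min lexx orbT. Qed.

Lemma clamp_id t : D t -> clamp t = t.
Proof.
rewrite /= in_itv/= /clamp => /andP[t0 tT].
by rewrite (min_idPl tT) (max_idPr t0).
Qed.

Lemma clamp_dist s t : `|clamp s - clamp t| <= `|s - t|.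
Proof.
wlog st : s t / s <= t.
  move=> hw; have [st|/ltW ts] := leP s t; first exact: hw.
  by rewrite distrC (distrC s); exact: hw.
have /andP[h1 h2] : 0 <= clamp t - clamp s <= t - s.
  rewrite /clamp; apply/andP; have T0' := T0; split;
  by case: (leP s T) => ?; case: (leP t T) => ?;
     case: (leP 0 s) => ?; case: (leP 0 t) => ?; rewrite ?(max_idPr (ltW T0)); lra.
by rewrite distrC (distrC s) !ger0_norm// subr_ge0.
Qed.

Lemma holder_clamp_continuous y (M : R) :
  (forall s t, D s -> D t -> `|y t - y s| ^+ 2 <= `|t - s| * M) ->
  continuous (y \o clamp).
Proof.
move=> hy x; apply/cvgrPdist_lt => r r0.
have M1 : 0 < `|M| + 1 by rewrite ltr_wpDl.
have d0 : 0 < r ^+ 2 / (`|M| + 1) by rewrite divr_gt0// exprn_gt0.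
apply/nbhs_ballP; exists (r ^+ 2 / (`|M| + 1)) => //= s.
rewrite /ball /= ltr_pdivlMr// => xs; apply: ltr_of_sqr; first exact: ltW.
apply: le_lt_trans xs; apply: le_trans (hy _ _ (clamp_D _) (clamp_D _)) _.
apply: (@le_trans _ _ (`|clamp x - clamp s| * `|M|)).
  by rewrite ler_wpM2l// ler_norm.
by apply: ler_pM => //; [exact: clamp_dist|rewrite lerDl].
Qed.

Lemma holder_L2 y (M : R) :
  (forall s t, D s -> D t -> `|y t - y s| ^+ 2 <= `|t - s| * M) -> L2 T y.
Proof.
move=> hy.
have [e [_ de]] := separable_seq sepH.
have sy : strongly_measurable T y.
  apply: (pettis de) => n.
  apply: (@aemeas_ae _ _ R mu D (fun t => `|y (clamp t) - e n|)).
    by apply: aeW => t Dt; rewrite clamp_id.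
  apply: measurable_aemeas; apply: measurable_funTS.
  apply: continuous_measurable_fun => x; apply: cvg_norm; apply: cvgB.
    exact: (holder_clamp_continuous hy).
  exact: cvg_cst.
have hy' s t : D s -> D t -> `|y t - y s| ^+ 2 <= `|t - s| * `|M|.
  by move=> Ds Dt; apply: le_trans (hy s t Ds Dt) _; rewrite ler_wpM2l// ler_norm.
apply: (@L2_dom _ _ T y (fun=> 2 * (T * `|M|) + 2 * `|y 0| ^+ 2) sy).
  exact: aeint_cst.
apply: aeW => t Dt; rewrite -(subrK (y 0) (y t)).
apply: le_trans (normD2_le ipP _ _) _; rewrite lerD2r ler_wpM2l//.
apply: le_trans (hy' _ _ D0 Dt) _; rewrite subr0 ler_wpM2r//.
by move: Dt; rewrite /= in_itv/= => /andP[t0 tT]; rewrite ger0_norm.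
Qed.

Lemma holder_deriv_L2 y g : is_deriv ip T y g -> L2 T y.
Proof.
move=> h; apply: (@holder_L2 y (I (fun r => `|g r| ^+ 2))) => s t Ds Dt.
exact: (is_deriv_holder ipP h Ds Dt).
Qed.

Lemma H1_of_deriv y g : is_deriv ip T y g -> H1 ip T y.
Proof. by move=> h; split; [exact: holder_deriv_L2 h|exists g]. Qed.

Lemma dH1P y : H1 ip T y -> is_deriv ip T y (dH1 ip T y).
Proof. by case=> _ h; exact: ClassicalEpsilon.epsilon_spec. Qed.

Lemma dH1_ae y g : is_deriv ip T y g -> {ae mu, forall t, D t -> dH1 ip T y t = g t}.
Proof.
by move=> h; apply: (is_deriv_unique ipP sepH (dH1P (H1_of_deriv h))).
Qed.

Lemma H1_ipE y z : H1 ip T y -> H1 ip T z ->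
  H1_ip ip T y z = (I (fun t => ip (y t) (z t)) + I (fun t => ip (dH1 ip T y t) (dH1 ip T z t)))%:E.
Proof.
move=> hy hz; rewrite /H1_ip EFinD !EFin_Rint//; apply: (L2_ip ipP).
- by case: (dH1P hy).
- by case: (dH1P hz).
- by case: hy.
- by case: hz.
Qed.

Lemma cvg_ipl (x : nat -> H) (l h : H) : x @ \oo --> l ->
  ip (x n) h @[n --> \oo] --> ip l h.
Proof.
move=> /cvgrPdist_lt xl; apply/cvgrPdist_lt => e e0.
have h1 : 0 < `|h| + 1 by rewrite ltr_wpDl.
have e1 : 0 < e / (`|h| + 1) by rewrite divr_gt0.
apply: filterS (xl _ e1) => n; rewrite ltr_pdivlMr// -(ipBl ipP); apply: le_lt_trans.
by apply: le_trans (ip_cauchy_schwarz ipP _ _) _; rewrite ler_wpM2l// lerDl.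
Qed.

Lemma cvg_Rint_ip (A : set (measurableTypeR R)) (gn : nat -> R -> H) g w :
  measurable A -> A `<=` D -> (forall n, L2 T (gn n)) -> L2 T g -> L2 T w ->
  (forall e : R, 0 < e -> exists N, forall k, (N <= k)%N ->
      I (fun t => `|gn k t - g t| ^+ 2) <= e) ->
  \int[mu]_(t in A) ip (gn n t) (w t) @[n --> \oo] --> \int[mu]_(t in A) ip (g t) (w t).
Proof.
move=> mA AD Ln Lg Lw cg; apply/cvgrPdist_le => e e0.
pose B := \int[mu]_(t in A) (`|w t| ^+ 2).
have B0 : 0 <= B by apply: Rintegral_ge0 => t _; exact: sqr_ge0.
(* This weight keeps the fixed term [B / (2 * a)] below [e / 2]; the other term is at most [e / 4]
   once the squared distance is at most [e / (2 * a)]. *)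
pose a := (B + 1) / e.
have B1 : 0 < B + 1 by rewrite ltr_wpDl.
have a0 : 0 < a by rewrite divr_gt0.
have ea : 0 < e / (2 * a) by rewrite divr_gt0// mulr_gt0.
have [N hN] := cg _ ea; exists N => // n /= Nn.
rewrite distrC -RintB//; [|exact: (aeint_ip_sub ipP mA AD)..].
have E : \int[mu]_(t in A) (ip (gn n t) (w t) - ip (g t) (w t)) =
         \int[mu]_(t in A) (ip (gn n t - g t) (w t)).
  by apply: eq_Rintegral => t _; rewrite (ipBl ipP).
rewrite E.
have := Rint_ip_young_sub ipP mA AD a0 (L2B ipP (Ln n) Lg) Lw.
rewrite /= -/B => h0; apply: le_trans h0 _.
have h1 : a / 2 * I (fun t => `|gn n t - g t| ^+ 2) <= e / 4.
  have -> : e / 4 = a / 2 * (e / (2 * a)) by field; rewrite gt_eqF.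
  by rewrite ler_pM2l ?divr_gt0//; exact: hN.
have h2 : (2 * a)^-1 * B <= e / 2.
  have -> : (2 * a)^-1 * B = e / 2 * (B / (B + 1)).
    by rewrite /a; field; rewrite !gt_eqF.
  by rewrite ler_piMr ?divr_ge0 ?(ltW e0)// ler_pdivrMr// mul1r lerDl.
by lra.
Qed.

Lemma is_deriv_lim (yn gn : nat -> R -> H) y g :
  (forall n, is_deriv ip T (yn n) (gn n)) -> L2 T g ->
  (forall t, D t -> yn n t @[n --> \oo] --> y t) ->
  (forall e : R, 0 < e -> exists N, forall k, (N <= k)%N ->
      I (fun t => `|gn k t - g t| ^+ 2) <= e) ->
  is_deriv ip T y g.
Proof.
move=> hyn Lg cy cg; apply/(is_derivP ipP); split => // t Dt h.
have tT : t <= T by move: Dt; rewrite /= in_itv/= => /andP[].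
have c1 := @cvg_ipl _ _ h (cy t Dt).
have c0 := @cvg_ipl _ _ h (cy 0 D0).
have Ln n : L2 T (gn n) by case: (hyn n).
have c2 := @cvg_Rint_ip _ gn g (fun=> h) (mI t) (subD tT) Ln Lg (L2_cst T h) cg.
apply: (cvg_unique (@Rhausdorff R) c1).
apply: cvg_trans (cvgD c0 c2); apply: near_eq_cvg; apply: nearW => n /=.
have /(is_derivP ipP)[_ e] := hyn n.
by rewrite (e t Dt).
Qed.

(* The derivatives [g] of the functions [1/k]-close to [y] that satisfy the lower
   bound form decreasing convex sets; their almost minimal elements converge
   strongly. *)
Lemma weak_closure_half (yn gn : nat -> R -> H) y w (M a : R) :
  (forall n, is_deriv ip T (yn n) (gn n)) ->
  (forall n, I (fun t => `|gn n t| ^+ 2) <= M) ->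
  (forall n t, D t -> `|yn n t - y t| <= n.+1%:R^-1) ->
  L2 T w -> (forall n, a <= I (fun t => ip (gn n t) (w t))) ->
  exists2 g, is_deriv ip T y g & a <= I (fun t => ip (g t) (w t)).
Proof.
move=> hyn gM yny Lw ha.
have Ln n : L2 T (gn n) by case: (hyn n).
pose q g := I (fun t => `|g t| ^+ 2).
pose P k : set (R -> H) := [set g | exists z, [/\ is_deriv ip T z g,
  forall t, D t -> `|z t - y t| <= k.+1%:R^-1 &
  a <= I (fun t => ip (g t) (w t))]].
have [||||||||c [Pc cc]] := @nested_convex_cauchy R (R -> H) (L2 T) q P M.
- by move=> g; apply: Rintegral_ge0 => t _; exact: sqr_ge0.
- move=> u v Lu Lv; have [iu iv] := (L2_sqr Lu, L2_sqr Lv).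
  rewrite /q -RintD//; [|exact: (L2_sqr (L2D ipP Lu Lv))|exact: (L2_sqr (L2B ipP Lu Lv))].
  rewrite -!RintZ// -RintD//; [|exact: aeintZ..].
  by apply: eq_Rintegral => t _; rewrite /= (normD2 ipP) (normB2 ipP); ring.
- move=> u Lu; rewrite /q -RintZ//; last exact: L2_sqr.
  apply: eq_Rintegral => t _; rewrite /= normrZ exprMn real_normK ?num_real//.
  by congr (_ * _); field.
- by move=> u v Lu Lv; exact: (L2D ipP Lu Lv).
- by move=> k g [z [[]]].
- move=> k l kl g [z [h1 h2 h3]]; exists z; split => // t Dt.
  apply: le_trans (h2 t Dt) _.
  by rewrite lef_pV2 ?posrE ?ltr0n// ler_nat ltnS.
- move=> k u v [z1 [d1 e1 f1]] [z2 [d2 e2 f2]].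
  exists (fun t => 2^-1 *: (z1 t + z2 t)); split.
  + exact: (is_derivZ ipP 2^-1 (is_derivD ipP d1 d2)).
  + move=> t Dt.
    have -> : 2^-1 *: (z1 t + z2 t) - y t =
        2^-1 *: (z1 t - y t) + 2^-1 *: (z2 t - y t).
      rewrite -scalerDr (addrACA (z1 t)) -opprD scalerBr; congr (_ - _).
      rewrite scalerDr -scalerDl; have -> : 2^-1 + 2^-1 = 1 :> R by field.
      by rewrite scale1r.
    apply: le_trans (ler_normD _ _) _; rewrite !normrZ gtr0_norm//.
    by move: (e1 t Dt) (e2 t Dt); move: (k.+1%:R^-1) => b; lra.
  + have -> : I (fun t => ip ((2^-1 *: (u + v)) t) (w t)) =
        2^-1 * (I (fun t => ip (u t) (w t)) + I (fun t => ip (v t) (w t))).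
      have [[Lu _] [Lv _]] := (d1, d2).
      rewrite -RintD//; [|exact: (L2_ip ipP)..].
      rewrite -RintZ//; last by apply: aeintD => //; exact: (L2_ip ipP).
      by apply: eq_Rintegral => t _; rewrite /= (ipZl ipP) (ipDl ipP).
    by lra.
- by move=> k; exists (gn k); [exists (yn k); split => //; exact: yny|exact: gM].
have Lc k : L2 T (c k) by have [z [[]]] := Pc k.
have [g Lg cg] := L2_complete ipP sepH T0 Lc cc.
have /choice[z zP] := Pc.
exists g.
  apply: (@is_deriv_lim z c) => //; first by move=> n; have [] := zP n.
  move=> t Dt; apply/cvgrPdist_lt => e e0.
  have [N _ hN] := near_infty_natSinv_lt (PosNum e0).
  exists N => // n /= Nn; rewrite distrC; have [_ h _] := zP n.
  by apply: le_lt_trans (h t Dt) _; exact: hN.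
have cI := @cvg_Rint_ip _ c g w mD (fun x => id) Lc Lg Lw cg.
rewrite -(cvg_lim (@Rhausdorff R) cI); apply: limr_ge; first by apply/cvg_ex; eexists; exact: cI.
by apply: nearW => n; have [] := zP n.
Qed.

(** If the integrals against [w] stayed below their expected limit by [e] along a subsequence, the
    one-sided statement for [- w] would give another derivative of [y] with the same defect, against
    uniqueness. Exchanging [w] and [- w] bounds the other side. *)
Lemma weak_closure (yn gn : nat -> R -> H) y (M : R) :
  (forall n, is_deriv ip T (yn n) (gn n)) ->
  (forall n, I (fun t => `|gn n t| ^+ 2) <= M) ->
  (forall n t, D t -> `|yn n t - y t| <= n.+1%:R^-1) ->
  exists2 g, is_deriv ip T y g & forall w, L2 T w ->
    I (fun t => ip (gn n t) (w t)) @[n --> \oo] --> I (fun t => ip (g t) (w t)).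
Proof.
move=> hyn gM yny.
have Ln n : L2 T (gn n) by case: (hyn n).
(* Against the zero function the lower bound is void; only a derivative of [y] is extracted. *)
have [g hg _] : exists2 g, is_deriv ip T y g & 0 <= I (fun t => ip (g t) 0).
  apply: (weak_closure_half hyn gM yny (L2_cst T 0)) => n.
  by apply: Rintegral_ge0 => t _; rewrite (ip0r ipP).
have Lg : L2 T g by case: hg.
exists g => //.
have LN w : L2 T w -> L2 T (fun t => - w t).
  by move=> /(L2Z (-1)); under eq_fun do rewrite scaleN1r.
have IN w u : L2 T w -> L2 T u ->
    I (fun t => ip (u t) (- w t)) = - I (fun t => ip (u t) (w t)).
  move=> Lw Lu; rewrite -mulN1r -RintZ//; last exact: (L2_ip ipP).
  by apply: eq_Rintegral => t _; rewrite (ipNr ipP) mulN1r.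
have lower w (e : R) : L2 T w -> 0 < e -> \forall n \near \oo,
    I (fun t => ip (g t) (w t)) - e < I (fun t => ip (gn n t) (w t)).
  move=> Lw e0; apply: contrapT => nh.
  set l := I (fun t => ip (g t) (w t)).
  have [s sinc sP] : exists2 s : nat -> nat, {homo s : m n / (m < n)%N >-> (m < n)%N} &
      forall k, I (fun t => ip (gn (s k) t) (w t)) <= l - e.
    apply: (@increasing_extraction (fun _ n => I (fun t => ip (gn n t) (w t)) <= l - e)).
    move=> _ N; apply: contrapT => hN; apply: nh; exists N => // n /= Nn.
    by rewrite ltNge; apply/negP => h; apply: hN; exists n.
  have LNw := LN _ Lw.
  have [|||||k hk] := @weak_closure_half (yn \o s) (gn \o s) y (fun t => - w t) M (- (l - e)).
  - by move=> n; exact: hyn.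
  - by move=> n; exact: gM.
  - move=> n t Dt; apply: le_trans (yny (s n) t Dt) _.
    by rewrite lef_pV2 ?posrE ?ltr0n// ler_nat ltnS; exact: increasing_ge_id.
  - exact: LNw.
  - by move=> n; rewrite /= IN// lerN2.
  have Lk : L2 T k by case: hk.
  rewrite IN// (@Rint_ae _ _ R mu D _ (fun t => ip (g t) (w t))); last first.
    apply: filterS (is_deriv_unique ipP sepH hk hg) => t h Dt.
    by rewrite h.
  by rewrite -/l => ?; lra.
move=> w Lw; apply/cvgrPdist_lt => e e0.
have LNw := LN _ Lw.
apply: filterS2 (lower w e Lw e0) (lower _ e LNw e0) => n h1.
by rewrite !IN// => h2; rewrite ltr_norml; apply/andP; split; lra.
Qed.

Lemma ultra_fmap (A B : Type) (f : A -> B) (F : set_system A) :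
  UltraFilter F -> UltraFilter (f @ F).
Proof.
move=> FU; split; first exact: fmap_proper_filter.
move=> G PG FG; apply/seteqP; split => [X GX|]; last exact: FG.
have [//|FX] := in_ultra_setVsetC (f @^-1` X) FU.
have : G (X `&` ~` X) by apply: filterI => //; exact: FG.
by rewrite setICr => /filter_not_empty.
Qed.

(* Pointwise limits are taken along an ultrafilter finer than [\oo], so that no
   diagonal extraction is needed. *)
Lemma ascoli (yn : nat -> R -> H) (K : set H) (M : R) : compact K ->
  (forall n t, D t -> K (yn n t)) ->
  (forall n s t, D s -> D t -> `|yn n t - yn n s| ^+ 2 <= `|t - s| * M) ->
  exists2 s : nat -> nat, {homo s : m n / (m < n)%N >-> (m < n)%N} &
    exists y, forall n t, D t -> `|yn (s n) t - y t| <= n.+1%:R^-1.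
Proof.
move=> cK Kyn hyn.
have [G [GU ooG]] := ultraFilterLemma eventually_filter.
have GF : ProperFilter G by case: GU.
have M0 : 0 <= `|M| by [].
have hyn' n s t (e : R) : 0 < e -> D s -> D t ->
    `|t - s| * `|M| < e ^+ 2 -> `|yn n t - yn n s| < e.
  move=> e0 Ds Dt h; apply: ltr_of_sqr; first exact: ltW.
  apply: le_lt_trans h; apply: le_trans (hyn n s t Ds Dt) _.
  by rewrite ler_wpM2l// ler_norm.
have /choice[y yP] : forall t, exists l : H, D t -> yn n t @[n --> G] --> l.
  move=> t; have [Dt|nDt] := pselect (D t); last by exists 0.
  move: cK; rewrite compact_ultra => /(_ (yn^~ t @ G)).
  have UG : UltraFilter (yn^~ t @ G) by exact: ultra_fmap.
  move=> /(_ UG)[|l [_ cl]]; last by exists l.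
  exact: (@filterE _ G _ (fun n => K (yn n t)) (fun n => Kyn n t Dt)).
(* Equicontinuity makes the pointwise convergence uniform over the compact interval; the limit [y]
   inherits the modulus of continuity of the [yn], which bounds the third of the three errors. *)
have unif (e : R) : 0 < e -> \forall n \near G, forall t, D t -> `|yn n t - y t| <= e.
  move=> e0; have e3 : 0 < e / 3 by rewrite divr_gt0.
  have M1 : 0 < `|M| + 1 by rewrite ltr_wpDl.
  have d0 : 0 < (e / 3) ^+ 2 / (`|M| + 1) by rewrite divr_gt0// exprn_gt0.
  have near3 (s t : R) : ball s ((e / 3) ^+ 2 / (`|M| + 1)) t -> `|t - s| * `|M| < (e / 3) ^+ 2.
    move=> st; have : `|s - t| < (e / 3) ^+ 2 / (`|M| + 1).
      by move: st; rewrite -ball_normE.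
    rewrite distrC ltr_pdivlMr//; apply: le_lt_trans.
    by rewrite ler_wpM2l// lerDl.
  have /compact_near_coveringP/near_covering_withinP := @segment_compact R 0 T.
  apply => //=.
  move=> s Ds.
  exists (ball s ((e / 3) ^+ 2 / (`|M| + 1)),
          [set n | `|y s - yn n s| < e / 3]) => /=.
    split; first exact: nbhsx_ballx.
    by have /cvgrPdist_lt := yP s Ds; apply.
  move=> [t n] /= [st sn] Dt.
  have h1 : `|yn n t - yn n s| < e / 3 by apply: hyn' => //; exact: near3.
  have h2 : `|y s - y t| <= e / 3.
    suff : closed_ball_ Num.norm (0 : H) (e / 3) (y s - y t).
      by rewrite /closed_ball_ /= sub0r normrN.
    apply: (@closed_cvg _ _ G _ (fun n => yn n s - yn n t)).
    - exact: closed_closed_ball_.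
    - apply: (@filterE _ G) => m; rewrite /closed_ball_ /= sub0r normrN distrC.
      by apply/ltW/hyn' => //; exact: near3.
    - by apply: cvgB; exact: yP.
  have -> : yn n t - y t = (yn n t - yn n s) + (yn n s - y s) + (y s - y t).
    by rewrite !subrKA.
  apply: le_trans (ler_normD _ _) _; apply: le_trans (lerD (ler_normD _ _) (lexx _)) _.
  by rewrite (distrC (yn n s)); lra.
have [s sinc sP] : exists2 s : nat -> nat, {homo s : m n / (m < n)%N >-> (m < n)%N} &
    forall n t, D t -> `|yn (s n) t - y t| <= n.+1%:R^-1.
  apply: (@increasing_extraction (fun n m => forall t, D t -> `|yn m t - y t| <= n.+1%:R^-1)).
  move=> k N; have k0 : 0 < k.+1%:R^-1 :> R by rewrite invr_gt0 ltr0n.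
  (* As [G] refines [\oo], its sets contain indices beyond any [N], which is what turns a limit
     along [G] into a subsequence. *)
  have GN : G [set n | (N <= n)%N] by apply: ooG; exists N.
  have GI := @filterI _ G _ _ _ GN (unif _ k0).
  by have [n [/= Nn hn]] := @filter_ex _ G _ _ (GI _); exists n.
by exists s => //; exists y.
Qed.

End H1_weak.

Section H1_weak_limits.
Context {R : realType} {H : completeNormedModType R}.
Variables (ip : H -> H -> R) (ipP : is_inner_product ip) (T : R).
Hypothesis sepH : separable_space (H := H).
Hypothesis T0 : 0 < T.

Notation mu := (@lebesgue_measure R).
Notation D := (`[0%R, T]%classic).
Notation I := (Rintegral mu D).
Notation dy y := (dH1 ip T y).
Implicit Types y z : R -> H.

Let mD : measurable (D : set (measurableTypeR R)). Proof. exact: measurable_itv. Qed.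
Let D0 : D 0. Proof. by rewrite /= in_itv/= lexx ltW. Qed.

(** Tested against the difference [w] of the two limits, the convergences show that the norm of [w]
    in $H^1$ vanishes. A zero derivative makes [w] constant by the Hölder estimate, and the constant
    is 0 as [T > 0]; hence equality at every [t]. *)
Lemma H1_weak_unique (yn : nat -> R -> H) y z : H1 ip T y -> H1 ip T z ->
  H1_weak_cvg ip T yn y -> H1_weak_cvg ip T yn z -> forall t, D t -> y t = z t.
Proof.
move=> hy hz cy cz.
pose w t := y t - z t.
have dw := is_derivB ipP (dH1P hy) (dH1P hz).
have hw : H1 ip T w := H1_of_deriv ipP sepH T0 dw.
have [Lw _] := hw; have [Lg _] := dw; have [Ly _] := hy; have [Lz _] := hz.
have [Ldy _] := dH1P hy; have [Ldz _] := dH1P hz; have [Ldw _] := dH1P hw.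
have : H1_ip ip T y w = H1_ip ip T z w.
  exact: (cvg_unique (@ereal_hausdorff R) (cy w hw) (cz w hw)).
rewrite !(H1_ipE ipP)// => -[E].
have aew := dH1_ae ipP sepH T0 dw.
have E1 : I (fun t => `|w t| ^+ 2) + I (fun t => `|dy w t| ^+ 2) = 0.
  have -> : I (fun t => `|w t| ^+ 2) = I (fun t => ip (y t) (w t)) - I (fun t => ip (z t) (w t)).
    rewrite -RintB//; [|exact: (L2_ip ipP)..].
    by apply: eq_Rintegral => t _; rewrite -(ipBl ipP) (ipxx ipP).
  have -> : I (fun t => `|dy w t| ^+ 2) =
      I (fun t => ip (dy y t) (dy w t)) - I (fun t => ip (dy z t) (dy w t)).
    rewrite -RintB//; [|exact: (L2_ip ipP)..].
    apply: Rint_ae; apply: filterS aew => t h Dt.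
    by rewrite -(ipBl ipP) -h// (ipxx ipP).
  by rewrite addrACA -opprD E subrr.
have w0 : 0 <= I (fun t => `|w t| ^+ 2) by apply: Rintegral_ge0 => t _; exact: sqr_ge0.
have dw0 : 0 <= I (fun t => `|dy w t| ^+ 2) by apply: Rintegral_ge0 => t _; exact: sqr_ge0.
have /andP[/eqP wz /eqP dwz] : (I (fun t => `|w t| ^+ 2) == 0) && (I (fun t => `|dy w t| ^+ 2) == 0).
  by rewrite -paddr_eq0// E1.
have wcst t : D t -> w t = w 0.
  move=> Dt; apply/eqP; rewrite -subr_eq0 -normr_eq0 -sqrf_eq0 eq_le sqr_ge0 andbT.
  apply: le_trans (is_deriv_holder ipP (dH1P hw) D0 Dt) _.
  by rewrite dwz mulr0.
have ww : I (fun t => `|w t| ^+ 2) = `|w 0| ^+ 2 * T.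
  rewrite -(Rint_cst _ (ltW T0)); apply: Rint_ae; apply: aeW => t Dt.
  by rewrite wcst.
have w00 : w 0 = 0.
  apply/eqP; rewrite -normr_eq0 -sqrf_eq0.
  by move/eqP: wz; rewrite ww mulf_eq0 (gt_eqF T0) orbF.
by move=> t Dt; apply/eqP; rewrite -subr_eq0 -/(w t) wcst// w00.
Qed.

Lemma dH1_eq_ae y z : H1 ip T y -> H1 ip T z -> (forall t, D t -> y t = z t) ->
  {ae mu, forall t, D t -> dy y t = dy z t}.
Proof.
move=> hy hz yz; apply: (dH1_ae ipP sepH T0).
by apply: (is_deriv_ext T0 _ (dH1P hz)) => t Dt; rewrite yz.
Qed.

Lemma tau_cvg_subseq (xn : nat -> (R -> H) * (R -> H)) x (s : nat -> nat) :
  {homo s : m n / (m < n)%N >-> (m < n)%N} -> tau_cvg ip T xn x ->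
  tau_cvg ip T (fun n => xn (s n)) x.
Proof.
move=> hs [c1 c2]; split; first exact: (cvg_subseq hs c1).
by move=> z hz; exact: (cvg_subseq hs (c2 z hz)).
Qed.

End H1_weak_limits.

(** * The De Giorgi functional *)

Lemma compact_closed_cluster (R : realType) (H : normedModType R) (K : set H)
    (x : nat -> H) : compact K -> (forall n, K (x n)) ->
  exists p, forall A : set H, closed A -> (\forall n \near \oo, A (x n)) -> A p.
Proof.
move=> cK Kx; have [|p [_ clp]] := cK (x @ \oo) _.
  by exists 0%N => // n _; exact: Kx.
exists p => A cA Ax; apply: cA => B nB; exact: clp.
Qed.

Section gradient_flow.
Context {R : realType} {H : completeNormedModType R}.
Variables (ip : H -> H -> R) (ipP : is_inner_product ip) (T : R).
Hypothesis sepH : separable_space (H := H).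
Hypothesis T0 : 0 < T.
Variables (phi1 : H -> \bar R) (phi2 : H -> R) (y0 : H).
Hypothesis phi1_proper : proper_fun phi1.
Hypothesis phi1_convex : convex_fun phi1.
Hypothesis phi1_lsc : lower_semicontinuous phi1.
Hypothesis phi1_single : forall y a b,
  frechet_subdiff ip phi1 y a -> frechet_subdiff ip phi1 y b -> a = b.
Hypothesis phi2_C11 : C11 ip phi2.
Let phi x := (phi1 x + (phi2 x)%:E)%E.
Hypothesis phi_compact : compact_sublevels phi.
Hypothesis phi_chain : chain_rule ip T phi.
Hypothesis phi_y0 : (phi y0 < +oo)%E.

Notation mu := (@lebesgue_measure R).
Notation D := (`[0%R, T]%classic).
Notation I := (Rintegral mu D).
Implicit Types u v w y z g : R -> H.

Let mD : measurable (D : set (measurableTypeR R)). Proof. exact: measurable_itv. Qed.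
Let D0 : D 0. Proof. by rewrite /= in_itv/= lexx ltW. Qed.
Let DT : D T. Proof. by rewrite /= in_itv/= lexx ltW. Qed.
Let subD t : t <= T -> `[0%R, t]%classic `<=` D.
Proof. by move=> tT; apply: subset_itvl; rewrite bnd_simp. Qed.

Lemma phi_gtNy x : (-oo < phi x)%E.
Proof. by case: phi1_proper => _ /(_ x); rewrite /phi; case: (phi1 x) => // r _; exact: ltNyr. Qed.

Lemma phi_fin x (c : R) : (phi x <= c%:E)%E -> phi x \is a fin_num.
Proof.
move=> h; by rewrite fin_numElt phi_gtNy (le_lt_trans h (ltry c)).
Qed.

Lemma phi_y0_fin : phi y0 \is a fin_num.
Proof. by rewrite fin_numElt phi_gtNy. Qed.

Lemma phi_closed (c : R) : closed [set x | (phi x <= c%:E)%E].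
Proof. by apply: compact_closed => //; exact: phi_compact. Qed.

(** Points with [phi (x n) <= - n] would cluster at some [p] in a compact sublevel; the sublevels
    being closed, [phi p] would be below every [- n], whereas [phi] never takes the value [-oo]. *)
Lemma phi_lower_bound : exists m : R, forall x, (m%:E <= phi x)%E.
Proof.
apply: contrapT => nb.
have /choice[x xP] : forall n : nat, exists x, (phi x <= (- n%:R)%:E)%E.
  move=> n; apply: contrapT => h; apply: nb; exists (- n%:R) => x.
  by rewrite leNgt; apply/negP => /ltW hx; apply: h; exists x.
have [|p hp] := @compact_closed_cluster _ _ _ x (@phi_compact 0).
  by move=> n; apply: le_trans (xP n) _; rewrite lee_fin oppr_le0 ler0n.
have pn n : (phi p <= (- n%:R)%:E)%E.
  apply: (hp _ (@phi_closed (- n%:R))); exists n => // m /= nm.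
  by apply: le_trans (xP m) _; rewrite lee_fin lerN2 ler_nat.
have pfin := phi_fin (pn 0%N).
have := pn (Num.truncn (`|fine (phi p)|)).+1.
rewrite -(fineK pfin) lee_fin /= leNgt => /negP; apply.
have /andP[_] := truncn_itv (normr_ge0 (fine (phi p))).
have := ler_norm (- fine (phi p)); rewrite normrN; lra.
Qed.

Let C11P : exists Df : H -> H, exists L : R,
  (forall x y : H, `|Df x - Df y| <= L * `|x - y|) /\
  forall (y : H) (e : R), 0 < e -> \forall w \near y,
      `|phi2 w - phi2 y - ip (Df y) (w - y)| <= e * `|w - y|.
Proof. by case: phi2_C11 => Df [[L h1] h2]; exists Df, L. Qed.

Lemma subdiff_unique (y a b : H) : frechet_subdiff ip phi y a ->
  frechet_subdiff ip phi y b -> a = b.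
Proof.
have [Df [L [h1 h2]]] := C11P.
have phiN : forall x, (-oo < phi1 x)%E by case: phi1_proper.
move=> /(subdiff_phiP ipP phi1_proper phi1_convex h2) ha.
move=> /(subdiff_phiP ipP phi1_proper phi1_convex h2) hb.
apply: (@addIr _ (- Df y)); apply: (@phi1_single y).
  exact/(convex_frechetP ipP).
exact/(convex_frechetP ipP).
Qed.

Lemma subdiff_selP (y : H) : (exists xi, frechet_subdiff ip phi y xi) ->
  frechet_subdiff ip phi y (subdiff_sel ip phi y).
Proof. by move=> h; exact: (xgetPex 0 h). Qed.

Lemma subdiff_sel_eq (y xi : H) : frechet_subdiff ip phi y xi -> subdiff_sel ip phi y = xi.
Proof. by move=> h; exact: subdiff_unique (subdiff_selP (ex_intro _ xi h)) h. Qed.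

Let subC (d : H) (c : R) : closed [set y : H | exists2 xi, frechet_subdiff ip phi y xi & `|xi - d| <= c].
Proof.
have [Df [L [h1 h2]]] := C11P.
exact: (subdiff_bounded_closed ipP phi1_proper phi1_convex phi1_lsc h1 h2).
Qed.

(** As the subgradient is unique, its distance to [e n] is at most [c] exactly at the times when [y]
    lies in the closed set of points with a subgradient in the ball of radius [c] around [e n].
    These times form a closed set, and Pettis' criterion applies. *)
Lemma sm_subdiff_sel y g : is_deriv ip T y g ->
  {ae mu, forall t, D t -> exists xi, frechet_subdiff ip phi (y t) xi} ->
  strongly_measurable T (fun t => subdiff_sel ip phi (y t)).
Proof.
move=> hy sy; have [e [_ de]] := separable_seq sepH.
pose y' := y \o clamp T.
have cy' : continuous y'.
  by apply: (holder_clamp_continuous T0) => s t; exact: (is_deriv_holder ipP hy).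
pose A d c := [set t | exists2 xi, frechet_subdiff ip phi (y' t) xi & `|xi - d| <= c].
have mA d c : measurable (A d c : set (measurableTypeR R)).
  apply: closed_measurable; apply: (@closed_comp _ _ y' _ _ (@subC d c)).
  by move=> t _; exact: cy'.
apply: (pettis de) => n.
pose B := \bigcup_(m : nat) A (e n) m%:R.
have mB : measurable (B : set (measurableTypeR R)) by apply: bigcup_measurable => m _.
have BP t : B t <-> exists xi, frechet_subdiff ip phi (y' t) xi.
  split=> [[m _ [xi h _]]|[xi h]]; first by exists xi.
  exists (Num.truncn `|xi - e n|).+1 => //; exists xi => //.
  by have /andP[_ /ltW] := truncn_itv (normr_ge0 (xi - e n)).
pose f t := if t \in B then `|subdiff_sel ip phi (y' t) - e n| else 0.
apply: (@aemeas_ae _ _ R mu D f).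
  apply: filterS sy => t sy Dt; have [xi h] := sy Dt.
  have y't : y' t = y t by rewrite /y' /= clamp_id.
  by rewrite /f mem_set ?y't//; apply/BP; exists xi; rewrite y't.
apply: measurable_aemeas => _; apply: (measurability _ (RGenOInfty.measurableE R)) => //.
move=> _ [_ [c ->] <-]; apply: measurableI => //; rewrite preimage_itvoy.
have [c0|c0] := ltP c 0.
  rewrite (_ : [set _ | _] = setT)//; apply/seteqP; split => // t _ /=.
  by apply: lt_le_trans c0 _; rewrite /f; case: ifPn.
rewrite (_ : [set _ | _] = B `\` A (e n) c); first exact: measurableD.
apply/seteqP; split => t /=; rewrite /f.
  case: ifPn => [/set_mem Bt ct|_]; last by rewrite ltNge c0.
  by split => // -[xi h]; rewrite leNgt -(subdiff_sel_eq h) ct.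
move=> [Bt nA]; rewrite mem_set// ltNge; apply/negP => h; apply: nA.
by exists (subdiff_sel ip phi (y' t)) => //; apply/subdiff_selP/BP.
Qed.

(** For [c ^ 2] above the lower limit, infinitely many [xk k] lie in the ball of radius [c] around
    [v], hence by closedness so does a subgradient at [y]. Uniqueness makes it the same for all
    [c]. *)
Lemma subdiff_liminf (yk xk : nat -> H) (y v : H) : yk @ \oo --> y ->
  (forall k, frechet_subdiff ip phi (yk k) (xk k)) ->
  (limn_einf (fun k => (`|xk k - v| ^+ 2)%:E) < +oo)%E ->
  frechet_subdiff ip phi y (subdiff_sel ip phi y) /\
  ((`|subdiff_sel ip phi y - v| ^+ 2)%:E <= limn_einf (fun k => (`|xk k - v| ^+ 2)%:E))%E.
Proof.
set l := limn_einf _ => cy hx loo.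
have l0 : (0 <= l)%E by apply: le_limn_einf; apply: nearW => k; rewrite lee_fin sqr_ge0.
have key (c : R) : 0 <= c -> (l < (c ^+ 2)%:E)%E ->
    exists2 xi, frechet_subdiff ip phi y xi & `|xi - v| <= c.
  move=> c0 lc; apply: (@subC v c) => B nB.
  have [N _ hN] := cy _ nB.
  have [k [Nk kc]] : exists k, (N <= k)%N /\ `|xk k - v| ^+ 2 < c ^+ 2.
    apply: contrapT => h; move: lc; rewrite ltNge => /negP; apply.
    apply: le_limn_einf; exists N => // k /= Nk; rewrite lee_fin leNgt.
    by apply/negP => hk; apply: h; exists k.
  exists (yk k); split; last exact: hN.
  by exists (xk k) => //; apply: ler_of_sqr => //; exact: ltW.
have lfin : l = (fine l)%:E by rewrite fineK// ge0_fin_numE.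
have fl0 : 0 <= fine l by rewrite fine_ge0.
have key2 (e : R) : 0 < e -> exists2 xi, frechet_subdiff ip phi y xi & `|xi - v| ^+ 2 <= fine l + e.
  move=> e0; have h0 : 0 <= fine l + e by rewrite addr_ge0// ltW.
  have [|xi h1 h2] := key (Num.sqrt (fine l + e)) (sqrtr_ge0 _).
    by rewrite sqr_sqrtr// lfin lte_fin ltrDl.
  exists xi => //; rewrite -(sqr_sqrtr h0) ler_pXn2r// nnegrE ?sqrtr_ge0//.
have [xi h _] := key2 1 ltr01.
split; first by apply: subdiff_selP; exists xi.
rewrite lfin lee_fin; apply/ler_addgt0Pr => e e0.
by have [zeta h1 h2] := key2 e e0; rewrite (subdiff_sel_eq h1).
Qed.

Notation G := (G_DG ip T phi y0).
Notation dy y := (dH1 ip T y).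
Notation xi y := (fun t => subdiff_sel ip phi (y t)).

Lemma chain_rule_integral y g k : is_deriv ip T y g -> L2 T k ->
  {ae mu, forall t, D t -> frechet_subdiff ip phi (y t) (k t)} ->
  forall t, D t -> phi (y t) \is a fin_num /\
    fine (phi (y t)) - fine (phi (y 0)) = \int[mu]_(s in `[0, t]) ip (k s) (g s).
Proof.
move=> hy Lk hk t Dt.
have [fin ac der] := phi_chain (H1_of_deriv ipP sepH T0 hy) hy Lk hk.
split; first exact: fin.
move: (Dt); rewrite /= in_itv/= => /andP[t0 tT].
apply: (@ftc_abs_continuous _ 0 t (fun s => fine (phi (y s)))) => //.
- move=> e e0; have [d d0 hd] := ac e e0; exists d => // n l r lr; apply: hd => i.
  by have [? [? ?]] := lr i; split => //; split => //; exact: le_trans tT.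
- have mt : measurable (`[0%R, t]%classic : set (measurableTypeR R)).
    exact: measurable_itv.
  by apply: (aeint_ip_sub ipP mt (subD tT)) => //; case: hy.
- apply: filterS der => s der; rewrite /= in_itv/= => /andP[s0 st]; apply: der.
  by rewrite /= in_itv/= s0 (lt_le_trans st).
Qed.

Definition energy_density u y t : R :=
  `|dy y t| ^+ 2 / 2 + `|xi y t - u t| ^+ 2 / 2 - ip (u t) (dy y t).

(** The effective domain of [G_DG]. The square integrability of the subgradient is not part of the
    definition of [G_DG] but results from its finiteness. *)
Definition admissible u y := [/\ L2 T u, H1 ip T y,
  {ae mu, forall t, D t -> frechet_subdiff ip phi (y t) (xi y t)},
  L2 T (xi y) & y 0 = y0].

Lemma aeint_half f : aeint mu D f -> aeint mu D (fun t => f t / 2).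
Proof.
move=> /(aeintZ mD 2^-1); apply: aeint_ae; apply: aeW => t _; exact: mulrC.
Qed.

Lemma Rint_half f : aeint mu D f -> I (fun t => f t / 2) = I f / 2.
Proof.
by move=> h; rewrite mulrC -RintZ//; apply: eq_Rintegral => t _; rewrite mulrC.
Qed.

Lemma aeint_energy_density u y : L2 T u -> H1 ip T y -> L2 T (xi y) ->
  aeint mu D (energy_density u y).
Proof.
move=> Lu /dH1P[Lg _] Lx; apply: aeintB => //; last exact: (L2_ip ipP).
by apply: aeintD => //; apply: aeint_half; apply: L2_sqr => //; exact: (L2B ipP).
Qed.

Lemma Rint_energy_density u y : L2 T u -> H1 ip T y -> L2 T (xi y) ->
  I (energy_density u y) = I (fun t => `|dy y t| ^+ 2) / 2 +
    I (fun t => `|xi y t - u t| ^+ 2) / 2 - I (fun t => ip (u t) (dy y t)).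
Proof.
move=> Lu /dH1P[Lg _] Lx.
have i1 := L2_sqr Lg; have i2 := L2_sqr (L2B ipP Lx Lu).
rewrite RintB//; [|by apply: aeintD => //; exact: aeint_half|exact: (L2_ip ipP)].
by rewrite RintD//; [rewrite !Rint_half|exact: aeint_half..].
Qed.

Lemma G_admissible u y : admissible u y ->
  phi (y T) \is a fin_num /\
  G u y = (I (energy_density u y) + fine (phi (y T)) - fine (phi y0))%:E.
Proof.
move=> [Lu hy hx Lx y00].
have [fin _] := chain_rule_integral (dH1P hy) Lx hx DT; split => //.
rewrite /G_DG; case: pselect => /= [?|h]; last first.
  exfalso; apply: h; split; [by split|split => //].
  by apply: filterS hx => t h Dt; exists (xi y t); exact: h.
rewrite (EFin_Rint mD (aeint_energy_density Lu hy Lx)).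
by rewrite -(fineK fin) -{1}(fineK phi_y0_fin) EFinB EFinD.
Qed.

(** The density equals $\frac12|u-y'|^2+\frac12|\xi-u|^2-\frac12|u|^2$. Being at least
    $-\frac12|u|^2$, it is integrable as soon as its integral is below [+oo], and then it controls
    $|\xi-u|^2$. *)
Lemma admissible_of_G u y : (G u y < +oo)%E -> admissible u y.
Proof.
rewrite /G_DG; case: pselect => /= [[[Lu hy] [sy y00]] Goo|//].
have hx : {ae mu, forall t, D t -> frechet_subdiff ip phi (y t) (xi y t)}.
  by apply: filterS sy => t sy Dt; apply: subdiff_selP; exact: sy.
have sx := sm_subdiff_sel (dH1P hy) sy.
have [Lg _] := dH1P hy.
have msx : aemeas mu D (fun t => `|xi y t - u t| ^+ 2).
  by apply: sm_sqr; apply: smB => //; case: Lu.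
have half f : aemeas mu D f -> aemeas mu D (fun t => f t / 2).
  by move=> /(aemeasZ 2^-1); apply: aemeas_ae; apply: aeW => t _; exact: mulrC.
have iu := L2_sqr Lu; have ig := L2_sqr Lg; have iug := L2_ip ipP Lu Lg.
have me : aemeas mu D (energy_density u y).
  apply: (@aemeas_ae _ _ R mu D (fun t => `|dy y t| ^+ 2 / 2 + `|xi y t - u t| ^+ 2 / 2 + (-1) * ip (u t) (dy y t))).
    by apply: aeW => t _; rewrite mulN1r.
  apply: aemeasD; last by apply: aemeasZ; exact: aeint_aemeas.
  by apply: aemeasD; apply: half => //; exact: aeint_aemeas.
have ie : aeint mu D (energy_density u y).
  apply: (aeint_lower_bound mD me (aeint_half iu)).
    apply: aeW => t _; split; first by rewrite divr_ge0// sqr_ge0.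
    have := sqr_ge0 `|xi y t - u t|; have := normB2 ipP (u t) (dy y t).
    by have := sqr_ge0 `|u t - dy y t|; rewrite /energy_density; lra.
  move: Goo; rewrite -[X in (X + _ - _)%E]/(\int[mu]_(t in D) (energy_density u y t)%:E)%E.
  set J := (\int[mu]_(_ in _) _)%E; have := phi_gtNy (y T).
  rewrite -(fineK phi_y0_fin); case: J => [j _ _| |]//; first exact: ltry.
  by case: (phi (y T)).
have hsx : aeint mu D (fun t => `|xi y t - u t| ^+ 2).
  apply: (le_aeint msx (aeintZ mD 2 (aeintD mD ie (aeint_half iu)))).
  apply: aeW => t _; rewrite ger0_norm ?sqr_ge0//.
  have := normB2 ipP (u t) (dy y t).
  by have := sqr_ge0 `|u t - dy y t|; rewrite /energy_density; lra.
have Lxu : L2 T (fun t => xi y t - u t).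
  by apply/L2P; split => //; apply: smB => //; case: Lu.
by have := L2D ipP Lxu Lu; under eq_fun do rewrite subrK.
Qed.

Lemma G_square u y : admissible u y ->
  G u y = (I (fun t => `|dy y t + xi y t - u t| ^+ 2 / 2))%:E.
Proof.
move=> ad; have [_ ->] := G_admissible ad; case: ad => Lu hy hx Lx y00; congr (_%:E).
have [fin fT] := chain_rule_integral (dH1P hy) Lx hx DT.
rewrite -addrA -y00 fT -RintD//; last 2 first.
- exact: aeint_energy_density.
- by apply: (L2_ip ipP) => //; case: (dH1P hy).
apply: eq_Rintegral => t _; rewrite /energy_density.
have -> : dy y t + xi y t - u t = dy y t + (xi y t - u t) by rewrite addrA.
by rewrite (normD2 ipP (dy y t)) (ipBr ipP) (ipC ipP (u t)) (ipC ipP (xi y t)); lra.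
Qed.

Lemma G_ge0 u y : (0 <= G u y)%E.
Proof.
have [Goo|] := ltP (G u y) +oo%E; last exact: le_trans.
rewrite (G_square (admissible_of_G Goo)) lee_fin.
by apply: Rintegral_ge0 => t _; rewrite divr_ge0// sqr_ge0.
Qed.

Lemma L2_cvg_Rint (un : nat -> R -> H) u : (forall n, L2 T (un n)) -> L2 T u ->
  L2_cvg T un u -> I (fun t => `|un n t - u t| ^+ 2) @[n --> \oo] --> 0.
Proof.
move=> Ln Lu; rewrite /L2_cvg => h.
have E : (fun n => (\int[mu]_(t in D) (`|un n t - u t| ^+ 2)%:E)%E) =
         (fun n => (I (fun t => `|un n t - u t| ^+ 2))%:E).
  by apply/funext => n; apply: EFin_Rint => //; apply: L2_sqr; exact: (L2B ipP).
by move: h; rewrite E => /fine_cvg.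
Qed.

(** Young's inequality absorbs the cross term into half of the term in $y_n'$ at the price of
    $|u_n|^2$, and the final value of [phi] is replaced by its lower bound. The bound on [phi] at
    time [t] then follows from the chain rule on [[0, t]]. *)
Lemma energy_bounds (un yn : nat -> R -> H) u (C : R) : L2 T u ->
  (forall n, admissible (un n) (yn n)) ->
  I (fun t => `|un n t - u t| ^+ 2) @[n --> \oo] --> 0 ->
  (forall n, (G (un n) (yn n) <= C%:E)%E) ->
  exists M : R, forall n, [/\ I (fun t => `|dy (yn n) t| ^+ 2) <= M,
    I (fun t => `|xi (yn n) t - un n t| ^+ 2) <= M,
    I (fun t => `|un n t - u t| ^+ 2) <= M &
    forall t, D t -> (phi (yn n t) <= M%:E)%E].
Proof.
move=> Lu ad qc GC; have [m hm] := phi_lower_bound.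
have [B hB] : exists B : R, forall n, I (fun t => `|un n t - u t| ^+ 2) <= B.
  have /cvg_seq_bounded[B [_ hB]] : cvgn (fun n => I (fun t => `|un n t - u t| ^+ 2)).
    by apply/cvg_ex; exists 0.
  exists (B + 1) => n; apply: le_trans (ler_norm _) _.
  by apply: (hB (B + 1)) => //; rewrite ltrDl.
pose Bu := 2 * B + 2 * I (fun t => `|u t| ^+ 2).
have Lun n : L2 T (un n) by case: (ad n).
have hBu n : I (fun t => `|un n t| ^+ 2) <= Bu.
  have i1 : aeint mu D (fun t => `|un n t - u t| ^+ 2).
    by apply: L2_sqr; exact: (L2B ipP).
  have i2 := L2_sqr Lu.
  apply: (@le_trans _ _ (I (fun t => 2 * `|un n t - u t| ^+ 2 + 2 * `|u t| ^+ 2))).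
    apply: le_Rint => //; [exact: L2_sqr|by apply: aeintD => //; exact: aeintZ|].
    by apply: aeW => t _; have := normD2_le ipP (un n t - u t) (u t); rewrite subrK.
  rewrite RintD//; [|exact: aeintZ..].
  by rewrite !RintZ// /Bu lerD2r ler_pM2l.
pose C1 := C + fine (phi y0) - m + Bu.
have key n : I (fun t => `|dy (yn n) t| ^+ 2) / 4 + I (fun t => `|xi (yn n) t - un n t| ^+ 2) / 2 <= C1.
  have [Lu' hy hx Lx y00] := ad n; have [Lg _] := dH1P hy.
  have [fin GE] := G_admissible (ad n).
  have := GC n; rewrite GE lee_fin => hG.
  have hmT : m <= fine (phi (yn n T)) by rewrite -lee_fin fineK.
  have ig := L2_sqr Lg; have ix := L2_sqr (L2B ipP Lx Lu'); have iu := L2_sqr Lu'.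
  have ie := aeint_energy_density Lu' hy Lx.
  have : 4^-1 * I (fun t => `|dy (yn n) t| ^+ 2) + 2^-1 * I (fun t => `|xi (yn n) t - un n t| ^+ 2) <=
      I (energy_density (un n) (yn n)) + I (fun t => `|un n t| ^+ 2).
    rewrite -!RintZ// -!RintD//; [|exact: aeintZ..].
    apply: (le_Rint mD); [by apply: aeintD => //; exact: aeintZ|exact: aeintD|].
    apply: aeW => t _; rewrite /energy_density.
    have := @ip_young _ _ _ ipP 2 (un n t) (dy (yn n) t) (ltr0n _ 2).
    have := ler_norm (ip (un n t) (dy (yn n) t)).
    have -> : (2 * 2)^-1 = 4^-1 :> R by congr (_^-1); ring.
    by lra.
  by have := hBu n; rewrite /C1; lra.
have g0 n : 0 <= I (fun t => `|dy (yn n) t| ^+ 2).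
  by apply: Rintegral_ge0 => t _; exact: sqr_ge0.
have x0 n : 0 <= I (fun t => `|xi (yn n) t - un n t| ^+ 2).
  by apply: Rintegral_ge0 => t _; exact: sqr_ge0.
have C10 : 0 <= C1 by apply: le_trans (key 0%N); rewrite addr_ge0// divr_ge0.
have Bu0 : 0 <= Bu.
  by apply: le_trans (hBu 0%N); apply: Rintegral_ge0 => t _; exact: sqr_ge0.
(* A common bound: [key] gives [4 * C1] for the derivatives and [2 * C1] for the subgradients minus
   [un], and Young's inequality bounds the increase of [phi] along [yn] by [4 * C1 + Bu]. *)
pose M := `|fine (phi y0)| + 4 * C1 + (2 * C1 + Bu) + `|B|.
exists M => n.
have hg : I (fun t => `|dy (yn n) t| ^+ 2) <= 4 * C1.
  by have := key n; have := x0 n; lra.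
have hx : I (fun t => `|xi (yn n) t - un n t| ^+ 2) <= 2 * C1.
  by have := key n; have := g0 n; lra.
split.
- apply: le_trans hg _; rewrite /M; have := normr_ge0 (fine (phi y0)).
  by have := normr_ge0 B; lra.
- apply: le_trans hx _; rewrite /M; have := normr_ge0 (fine (phi y0)).
  by have := normr_ge0 B; lra.
- apply: le_trans (hB n) _; rewrite /M; have := normr_ge0 (fine (phi y0)).
  by have := ler_norm B; lra.
move=> t Dt; have [Lu' hy hxi Lx y00] := ad n; have dyn := dH1P hy.
have [fin E] := chain_rule_integral dyn Lx hxi Dt.
have Lg : L2 T (dy (yn n)) by case: dyn.
rewrite -(fineK fin) lee_fin.
move: (Dt); rewrite /= in_itv/= => /andP[_ tT].
have mt : measurable (`[0%R, t]%classic : set (measurableTypeR R)) by exact: measurable_itv.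
have := Rint_ip_young_sub ipP mt (subD tT) ltr01 Lx Lg.
rewrite -E => hyoung.
have sub : \int[mu]_(s in `[0, t]) (`|dy (yn n) s| ^+ 2) <= 4 * C1.
  by apply: le_trans hg; apply: Rint_subset_le => //; [exact: subD|exact: L2_sqr].
have hx2 : I (fun t => `|xi (yn n) t| ^+ 2) <= 4 * C1 + 2 * Bu.
  have ix := L2_sqr (L2B ipP Lx Lu'); have iu := L2_sqr Lu'.
  apply: (@le_trans _ _ (I (fun t => 2 * `|xi (yn n) t - un n t| ^+ 2 + 2 * `|un n t| ^+ 2))).
    apply: le_Rint => //; [exact: L2_sqr|by apply: aeintD => //; exact: aeintZ|].
    by apply: aeW => s _; have := normD2_le ipP (xi (yn n) s - un n s) (un n s); rewrite subrK.
  rewrite RintD//; [|exact: aeintZ..].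
  by rewrite !RintZ//; have := hBu n; lra.
have := ler_norm (fine (phi (yn n t)) - fine (phi (yn n 0))).
have := ler_norm (fine (phi y0)); rewrite y00 in hyoung *.
have := normr_ge0 B; rewrite mulr1 mul1r in hyoung; rewrite /M; lra.
Qed.

(** The terms without subgradient are asymptotically at least their values at the limit: the final
    value of [phi] by closed sublevels, the terms in $y_n'$ by weak convergence. The bound [C] thus
    becomes an upper bound on the integrals of $|\xi_n-u|^2$, ready for Fatou's lemma. *)
Lemma energy_limit (un yn : nat -> R -> H) u y (C M : R) : L2 T u ->
  (forall n, admissible (un n) (yn n)) ->
  I (fun t => `|un n t - u t| ^+ 2) @[n --> \oo] --> 0 ->
  (forall n, (G (un n) (yn n) <= C%:E)%E) ->
  (forall n, [/\ I (fun t => `|dy (yn n) t| ^+ 2) <= M,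
    I (fun t => `|xi (yn n) t - un n t| ^+ 2) <= M,
    I (fun t => `|un n t - u t| ^+ 2) <= M &
    forall t, D t -> (phi (yn n t) <= M%:E)%E]) ->
  H1 ip T y -> (forall t, D t -> yn n t @[n --> \oo] --> y t) ->
  (forall w, L2 T w -> I (fun t => ip (dy (yn n) t) (w t)) @[n --> \oo] -->
     I (fun t => ip (dy y t) (w t))) ->
  (G u y <= C%:E)%E.
Proof.
move=> Lu ad qc GC bd hy cy cdy.
set q := (fun n => I (fun t => `|un n t - u t| ^+ 2)) in qc.
have Lun n : L2 T (un n) by case: (ad n).
have Lgn n : L2 T (dy (yn n)) by have [_ /dH1P[]] := ad n.
have Lxn n : L2 T (xi (yn n)) by case: (ad n).
have [Lg _] := dH1P hy.
have iq n : aeint mu D (fun t => `|un n t - u t| ^+ 2) by apply: L2_sqr; exact: (L2B ipP).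
have ixn n : aeint mu D (fun t => `|xi (yn n) t - un n t| ^+ 2) by apply: L2_sqr; exact: (L2B ipP).
have ixu n : aeint mu D (fun t => `|xi (yn n) t - u t| ^+ 2) by apply: L2_sqr; exact: (L2B ipP).
have M0 : 0 <= M.
  have [h _ _ _] := bd 0%N; apply: le_trans h.
  by apply: Rintegral_ge0 => t _; exact: sqr_ge0.
have q0 n : 0 <= q n by apply: Rintegral_ge0 => t _; exact: sqr_ge0.
have qsmall (e : R) : 0 < e -> \forall n \near \oo, q n < e.
  move=> e0; have /cvgrPdist_lt/(_ e e0) := qc; apply: filterS => n.
  by rewrite sub0r normrN ger0_norm.
have y00 : y 0 = y0.
  have := cy 0 D0; have -> : (fun n => yn n 0) = (fun=> y0).
    by apply/funext => n; case: (ad n).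
  by move/(cvg_unique (@norm_hausdorff _ _)); apply; exact: cvg_cst.
(* Young's inequality with a small weight [d]. *)
have Fle (d : R) n : 0 < d -> I (fun t => `|xi (yn n) t - u t| ^+ 2) <=
    I (fun t => `|xi (yn n) t - un n t| ^+ 2) + d * M + (1 + d^-1) * q n.
  move=> d0; have [_ h _ _] := bd n.
  have [i1 i2] := (ixn n, iq n).
  apply: (@le_trans _ _ (I (fun t => (1 + d) * `|xi (yn n) t - un n t| ^+ 2 +
      (1 + d^-1) * `|un n t - u t| ^+ 2))).
    apply: (le_Rint mD) => //; first by apply: aeintD => //; exact: aeintZ.
    apply: aeW => t _.
    have -> : xi (yn n) t - u t = (xi (yn n) t - un n t) + (un n t - u t) by rewrite subrKA.
    rewrite (normD2 ipP (xi (yn n) t - un n t)).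
    have := ip_young ipP (xi (yn n) t - un n t) (un n t - u t) d0.
    have := ler_norm (ip (xi (yn n) t - un n t) (un n t - u t)).
    rewrite invfM; move: (d^-1) => d'; move: `|un n t - u t| `|_ - _| (ip _ _) => a b c.
    lra.
  rewrite RintD//; [|exact: aeintZ..].
  rewrite !RintZ// -/(q n) lerD2r mulrDl mul1r lerD2l.
  by rewrite ler_wpM2l// ltW.
have sy : {ae mu, forall t, D t -> frechet_subdiff ip phi (y t) (xi y t) /\
   ((`|xi y t - u t| ^+ 2)%:E <= limn_einf (fun n => (`|xi (yn n) t - u t| ^+ 2)%:E))%E}.
  have hB n : I (fun t => `|xi (yn n) t - u t| ^+ 2) <= 4 * M.
    apply: le_trans (Fle 1 n ltr01) _; rewrite invr1 mul1r.
    by have [_ h1 h2 _] := bd n; rewrite /q; lra.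
  have fin := @ae_limn_einf_lty _ _ _ _ _ mD _ (4 * M) ixu
    (aeW _ (fun t _ n => sqr_ge0 _)) hB.
  have hx : {ae mu, forall t, forall n, D t -> frechet_subdiff ip phi (yn n t) (xi (yn n) t)}.
    by apply: ae_foralln => n; case: (ad n).
  apply: filterS2 fin hx => t fin hx Dt.
  exact: (subdiff_liminf (cy t Dt) (fun n => hx n Dt) (fin Dt)).
have sx : strongly_measurable T (xi y).
  apply: (sm_subdiff_sel (dH1P hy)); apply: filterS sy => t sy Dt.
  by have [h _] := sy Dt; exists (xi y t).
have pfin : phi (y T) \is a fin_num.
  apply: (@phi_fin _ M).
  apply: (@closed_cvg _ _ \oo _ (fun n => yn n T) _ (@phi_closed M)); last exact: cy.
  by apply: nearW => n; have [_ _ _ h] := bd n; exact: h.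
set p := fine (phi (y T)).
have plow (e : R) : 0 < e -> \forall n \near \oo, p - e < fine (phi (yn n T)).
  move=> e0; apply: contrapT => nh.
  have [s sinc sP] : exists2 s : nat -> nat, {homo s : m n / (m < n)%N >-> (m < n)%N} &
      forall k, (phi (yn (s k) T) <= (p - e)%:E)%E.
    apply: (@increasing_extraction (fun _ n => (phi (yn n T) <= (p - e)%:E)%E)) => _ N.
    apply: contrapT => hN; apply: nh; exists N => // n /= Nn.
    rewrite ltNge; apply/negP => h; apply: hN; exists n => //.
    have [_ _ _ hM] := bd n.
    by rewrite -(fineK (phi_fin (hM T DT))) lee_fin.
  have : (phi (y T) <= (p - e)%:E)%E.
    apply: (@closed_cvg _ _ \oo _ (fun n => yn (s n) T) _ (@phi_closed (p - e))).
      by apply: nearW => n; exact: sP.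
    exact: (cvg_subseq sinc (cy T DT)).
  by rewrite -(fineK pfin) lee_fin -/p; lra.
pose A := I (fun t => `|dy y t| ^+ 2) / 2 - I (fun t => ip (u t) (dy y t)).
(* [|y_n'|^2 / 2 >= (y_n', y') - |y'|^2 / 2], and [y'] is fixed in the limit. *)
have alow (e : R) : 0 < e -> \forall n \near \oo,
    A - e < I (fun t => `|dy (yn n) t| ^+ 2) / 2 - I (fun t => ip (un n t) (dy (yn n) t)).
  move=> e0; have e2 : 0 < e / 8 by rewrite divr_gt0.
  (* This weight leaves [e / 2] for the term in $y_n'$, bounded by [M], and [e / 4] for the one in
     [q n]; weak convergence costs a further [e / 8]. *)
  pose a := (M + 1) / e.
  have a0 : 0 < a by rewrite divr_gt0// ltr_wpDl.
  have ea : 0 < e / (2 * a) by rewrite divr_gt0// mulr_gt0.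
  (* A single test function handles the products of $y_n'$ with both $y'$ and [u]. *)
  have Ldu : L2 T (fun t => dy y t - u t) by exact: (L2B ipP).
  have /cvgrPdist_lt/(_ _ e2) := cdy _ Ldu.
  apply: filterS2 (qsmall _ ea) => n qn.
  have Lunu : L2 T (fun t => un n t - u t) by exact: (L2B ipP).
  have E1 v : L2 T v -> I (fun t => ip (v t) (dy y t - u t)) =
      I (fun t => ip (v t) (dy y t)) - I (fun t => ip (v t) (u t)).
    move=> Lv; rewrite -RintB//; [|exact: (L2_ip ipP)..].
    by apply: eq_Rintegral => t _; rewrite (ipBr ipP).
  have E2 : I (fun t => ip (un n t) (dy (yn n) t)) =
      I (fun t => ip (un n t - u t) (dy (yn n) t)) + I (fun t => ip (dy (yn n) t) (u t)).
    rewrite -RintD//; [|exact: (L2_ip ipP)..].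
    by apply: eq_Rintegral => t _; rewrite (ipBl ipP) (ipC ipP (u t)) subrK.
  have E3 : I (fun t => ip (dy y t) (dy y t)) = I (fun t => `|dy y t| ^+ 2).
    by apply: eq_Rintegral => t _; rewrite (ipxx ipP).
  have E4 : I (fun t => ip (u t) (dy y t)) = I (fun t => ip (dy y t) (u t)).
    by apply: eq_Rintegral => t _; rewrite (ipC ipP).
  have h1 : I (fun t => ip (dy (yn n) t) (dy y t)) <=
      2^-1 * I (fun t => `|dy (yn n) t| ^+ 2) + 2^-1 * I (fun t => `|dy y t| ^+ 2).
    have i1 := L2_sqr (Lgn n); have i2 := L2_sqr Lg.
    rewrite -!RintZ// -RintD//; [|exact: aeintZ..].
    apply: (le_Rint mD); [exact: (L2_ip ipP)|by apply: aeintD => //; exact: aeintZ|].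
    by apply: aeW => t _; apply: le_trans (ler_norm _) (ip_le ipP _ _).
  have h2 := Rint_ip_young ipP a0 Lunu (Lgn n).
  have h3 : a / 2 * q n <= e / 4.
    have -> : e / 4 = a / 2 * (e / (2 * a)) by field; rewrite gt_eqF.
    by apply: ler_wpM2l; [rewrite divr_ge0// ltW|exact: ltW].
  have h4 : (2 * a)^-1 * I (fun t => `|dy (yn n) t| ^+ 2) <= e / 4 + e / 4.
    apply: (@le_trans _ _ ((2 * a)^-1 * M)).
      by apply: ler_wpM2l; [rewrite invr_ge0 mulr_ge0// ltW|have [] := bd n].
    have -> : e / 4 + e / 4 = (2 * a)^-1 * (M + 1).
      by rewrite /a; field; rewrite !gt_eqF// ltr_wpDl.
    by apply: ler_wpM2l; [rewrite invr_ge0 mulr_ge0// ltW|rewrite lerDl].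
  rewrite (E1 _ Lg) (E1 _ (Lgn n)) E3 ltr_norml => /andP[_ h5].
  rewrite E2 /A E4.
  have h6 := ler_norm (I (fun t => ip (un n t - u t) (dy (yn n) t))).
  move: h1 h2 h3 h4 h5 h6; rewrite -/(q n).
  move: (a / 2 * q n) ((2 * a)^-1 * _) `|_| => b1 b2 b3.
  move: (I _) (I _) (I _) (I _) (I _) (I _) => j1 j2 j3 j4 j5 j6; lra.
(* The factor 2 undoes the half in the density. The error [2 * e] consists of [e / 2] from [d * M],
   [e] from [q n], and twice the two errors [e / 8] of [plow] and [alow]. *)
have key (e : R) : 0 < e -> aeint mu D (fun t => `|xi y t - u t| ^+ 2) /\
    I (fun t => `|xi y t - u t| ^+ 2) <= 2 * (C + fine (phi y0) - A - p + e).
  move=> e0; apply: (@aeint_ge0_lim _ _ R mu D mD (fun n t => `|xi (yn n) t - u t| ^+ 2)) => //.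
  - by apply: sm_sqr; apply: smB => //; case: Lu.
  - by move=> n; apply: aeW => t _; exact: sqr_ge0.
  - by apply: aeW => t _; exact: sqr_ge0.
  - by apply: filterS sy => t sy Dt; have [] := sy Dt.
  have e8 : 0 < e / 8 by rewrite divr_gt0.
  pose d := e / (2 * (M + 1)).
  have M1 : 0 < M + 1 by rewrite ltr_wpDl.
  have d0 : 0 < d by rewrite divr_gt0// mulr_gt0.
  have dM : d * M <= e / 2.
    have -> : e / 2 = d * (M + 1) by rewrite /d; field; rewrite gt_eqF.
    by rewrite ler_wpM2l ?(ltW d0)// lerDl.
  have c0 : 0 < 1 + d^-1 by rewrite addr_gt0// invr_gt0.
  have ec : 0 < e / (1 + d^-1) by rewrite divr_gt0.
  apply: filterS3 (qsmall _ ec) (plow _ e8) (alow _ e8) => n qn pn an.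
  apply: le_trans (Fle d n d0) _.
  have qn' : (1 + d^-1) * q n <= e by rewrite mulrC -ler_pdivlMr// ltW.
  have [_ hyn _ _ _] := ad n.
  have [_ GE] := G_admissible (ad n).
  have := GC n; rewrite GE lee_fin Rint_energy_density// => hG.
  lra.
have [ix _] := key 1 ltr01.
have Lxu : L2 T (fun t => xi y t - u t).
  by apply/L2P; split => //; apply: smB => //; case: Lu.
have Lx : L2 T (xi y).
  by have := L2D ipP Lxu Lu; under eq_fun do rewrite subrK.
have ad' : admissible u y.
  by split => //; apply: filterS sy => t sy Dt; have [] := sy Dt.
have [_ ->] := G_admissible ad'; rewrite lee_fin.
apply/ler_addgt0Pr => e e0; have [_ hk] := key e e0.
rewrite Rint_energy_density// -/p; rewrite /A in hk.
lra.
Qed.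

(** The bound [C] is carried to the limit along with compactness, so that the lower semicontinuity
    of [G] can be deduced from this single statement. *)
Lemma G_compact (un yn : nat -> R -> H) u (C : R) : L2 T u -> L2_cvg T un u ->
  (forall n, (G (un n) (yn n) <= C%:E)%E) ->
  exists2 s : nat -> nat, {homo s : m n / (m < n)%N >-> (m < n)%N} &
    exists y, [/\ H1 ip T y, H1_weak_cvg ip T (fun n => yn (s n)) y & (G u y <= C%:E)%E].
Proof.
move=> Lu uc GC.
have ad n : admissible (un n) (yn n).
  by apply: admissible_of_G; apply: le_lt_trans (GC n) (ltry C).
have Lun n : L2 T (un n) by case: (ad n).
have hyn n : H1 ip T (yn n) by case: (ad n).
have qc := L2_cvg_Rint Lun Lu uc.
have [M bd] := energy_bounds Lu ad qc GC.
have [s sinc [y yP]] := @ascoli _ _ T yn _ M (@phi_compact M)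
  (fun n t Dt => let: And4 _ _ _ h := bd n in h t Dt)
  (fun n s t Ds Dt => le_trans (is_deriv_holder ipP (dH1P (hyn n)) Ds Dt)
     (ler_wpM2l (normr_ge0 _) (let: And4 h _ _ _ := bd n in h))).
exists s => //; exists y.
have [g hg gc] := weak_closure ipP sepH T0 (fun n => dH1P (hyn (s n)))
  (fun n => let: And4 h _ _ _ := bd (s n) in h) yP.
have hy := H1_of_deriv ipP sepH T0 hg.
have cdy w : L2 T w -> I (fun t => ip (dy (yn (s n)) t) (w t)) @[n --> \oo] -->
     I (fun t => ip (dy y t) (w t)).
  move=> Lw; have := gc w Lw; rewrite (@Rint_ae _ _ R mu D (fun t => ip (dy y t) (w t)) (fun t => ip (g t) (w t)))//.
  by apply: filterS (dH1_ae ipP sepH T0 hg) => t h Dt; rewrite h.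
have cy t : D t -> yn (s n) t @[n --> \oo] --> y t.
  move=> Dt; apply/cvgrPdist_lt => e e0.
  have [N _ hN] := near_infty_natSinv_lt (PosNum e0).
  exists N => // n /= Nn; rewrite distrC.
  by apply: le_lt_trans (yP n t Dt) _; exact: hN.
split => //.
  move=> z hz; have [Lz _] := hz; have [Ly _] := hy; have [Ldz _] := dH1P hz.
  rewrite (H1_ipE ipP hy hz).
  have -> : (fun n => H1_ip ip T (yn (s n)) z) = (fun n =>
     (I (fun t => ip (yn (s n) t) (z t)) + I (fun t => ip (dy (yn (s n)) t) (dy z t)))%:E).
    by apply/funext => n; exact: (H1_ipE ipP (hyn _) hz).
  apply: cvg_EFin; first exact: nearW.
  apply: cvgD; last exact: cdy.
  apply: (cvg_Rint_ip ipP mD (fun x => id)) => //; first by move=> n; case: (hyn (s n)).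
  (* The distance is at most [1/(k+1)], hence at most 1, and so its square is at most [1/(k+1)]
     too. *)
  move=> e e0; have eT : 0 < e / (T + 1) by rewrite divr_gt0// addr_gt0.
  have [N _ hN] := near_infty_natSinv_lt (PosNum eT).
  exists N => k Nk.
  apply: (@le_trans _ _ (I (fun=> e / (T + 1)))).
    apply: (le_Rint mD); last 1 first.
    - apply: aeW => t Dt; have := yP k t Dt.
      have k1 : k.+1%:R^-1 <= 1 :> R by rewrite invf_le1 ?ler1n// ltr0n.
      have k2 : k.+1%:R^-1 < e / (T + 1) := hN _ Nk.
      move=> h; rewrite expr2; apply: (@le_trans _ _ (k.+1%:R^-1 * 1)).
        by apply: ler_pM => //; exact: le_trans k1.
      by rewrite mulr1 ltW.
    - by apply: L2_sqr; apply: (L2B ipP) => //; case: (hyn (s k)).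
    - exact: aeint_cst.
  rewrite Rint_cst ?(ltW T0)//.
  have T1 : 0 < T + 1 by rewrite addr_gt0.
  by rewrite mulrAC ler_pdivrMr// ler_pM2l// lerDl.
apply: (@energy_limit (fun n => un (s n)) (fun n => yn (s n)) u y C M) => //.
exact: (cvg_subseq sinc qc).
Qed.

(** Weak limits are identified on [[0, T]] only; as functions on the line they may differ. *)
Lemma G_congr_le u y z : H1 ip T y -> (forall t, D t -> y t = z t) ->
  (G u y <= G u z)%E.
Proof.
move=> hy yz; rewrite {2}/G_DG; case: pselect => /= [[[Lu hz] [sz z0]]|_]; last exact: leey.
rewrite /G_DG; case: pselect => /= [_|h]; last first.
  exfalso; apply: h; split; first by split.
  split; last by rewrite yz.
  by apply: filterS sz => t sz Dt; rewrite yz//; exact: sz.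
rewrite (yz T DT) le_eqVlt; apply/orP; left; apply/eqP.
congr (_ + _ - _)%E; apply: ae_eq_integral_nm.
apply: filterS (dH1_eq_ae ipP sepH T0 hy hz yz) => t h Dt.
by rewrite (yz _ Dt) (h Dt).
Qed.

(** A value [c] strictly between the lower limit and [G x] would bound [G] along a subsequence. By
    compactness a further subsequence has a weak limit with [G] at most [c], and this limit agrees
    with [x] on [[0, T]]. *)
Lemma G_lsc : tau_lsc ip T G.
Proof.
move=> xn x hxn [Lu hy] cx; rewrite leNgt; apply/negP => lt.
have l0 : (0 <= limn_einf (fun n => G (xn n).1 (xn n).2))%E.
  by apply: le_limn_einf; apply: nearW => n; exact: G_ge0.
have [c lc cG] : exists2 c : R, (limn_einf (fun n => G (xn n).1 (xn n).2) < c%:E)%E &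
    (c%:E < G x.1 x.2)%E.
  move: lt l0; set l := limn_einf _; case: l => [r| |]//; last by rewrite ltNge leey.
  case: (G x.1 x.2) => [v| |]//.
    rewrite lte_fin => rv _; exists ((r + v) / 2); rewrite lte_fin; lra.
  by move=> _ _; exists (r + 1); rewrite ?ltry// lte_fin ltrDl.
have [s sinc sc] := limn_einf_lt_subseq lc.
have [cu cw] := tau_cvg_subseq sinc cx.
have [s' s'inc [y [hy' cy Gy]]] := G_compact Lu cu (fun n => ltW (sc n)).
have yy := H1_weak_unique ipP sepH T0 hy hy' (fun z hz => cvg_subseq s'inc (cw z hz)) cy.
by move: cG; rewrite ltNge (le_trans (G_congr_le _ hy yy) Gy).
Qed.

End gradient_flow.

(** * Penalization *)

(** Otherwise some subsequence, and with it all its subsequences, would avoid a neighbourhood of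
    [l]. *)
Lemma cvg_subsubseq (V : topologicalType) (a : nat -> V) (l : V) :
  (forall s : nat -> nat, {homo s : m n / (m < n)%N >-> (m < n)%N} ->
    exists2 s' : nat -> nat, {homo s' : m n / (m < n)%N >-> (m < n)%N} &
      a (s (s' n)) @[n --> \oo] --> l) -> a @ \oo --> l.
Proof.
move=> h A nA; apply: contrapT => nh.
have [s sinc sP] : exists2 s : nat -> nat, {homo s : m n / (m < n)%N >-> (m < n)%N} &
    forall n, ~ A (a (s n)).
  apply: (@increasing_extraction (fun _ n => ~ A (a n))) => _ N.
  apply: contrapT => hN; apply: nh; exists N => // n /= Nn.
  by apply: contrapT => hn; apply: hN; exists n.
have [s' _ /(_ _ nA)[N _ hN]] := h s sinc.
exact: (sP (s' N)) (hN N (leqnn N)).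
Qed.

Section penalization.
Context {R : realType} {H : completeNormedModType R}.
Variables (ip : H -> H -> R) (ipP : is_inner_product ip) (T : R).
Hypothesis sepH : separable_space (H := H).
Hypothesis T0 : 0 < T.
Variables (U : set (R -> H)) (F G : (R -> H) -> (R -> H) -> \bar R).
Hypothesis U_L2 : U `<=` L2 T.
Hypothesis U_compact : forall un : nat -> R -> H, (forall n, U (un n)) ->
  exists2 s : nat -> nat, {homo s : m n / (m < n)%N >-> (m < n)%N} &
    exists2 u, U u & L2_cvg T (fun n => un (s n)) u.
Hypothesis F_ge0 : forall x, Xset ip T x -> (0 <= F x.1 x.2)%E.
Hypothesis F_lsc : tau_lsc ip T F.
Hypothesis F_U : forall x, Xset ip T x -> (F x.1 x.2 < +oo)%E -> U x.1.
Hypothesis G_ge0 : forall u y, (0 <= G u y)%E.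
Hypothesis G_lsc : tau_lsc ip T G.
Hypothesis G_compact : forall (un yn : nat -> R -> H) u (C : R), L2 T u ->
  L2_cvg T un u -> (forall n, (G (un n) (yn n) <= C%:E)%E) ->
  exists2 s : nat -> nat, {homo s : m n / (m < n)%N >-> (m < n)%N} &
    exists y, [/\ H1 ip T y, H1_weak_cvg ip T (fun n => yn (s n)) y & (G u y <= C%:E)%E].

Notation mu := (@lebesgue_measure R).
Notation D := (`[0%R, T]%classic).
Notation X := (Xset ip T).
Notation E := (E_eps F G).
Notation E0 := (E_0 F G).
Implicit Types (x : (R -> H) * (R -> H)) (eps : R).

(** Serves as a minimizer when [E eps] is infinite on all of [X]. *)
Lemma Xset0 : X (fun=> 0, fun=> 0).
Proof.
split; first exact: L2_cst.
apply: (@H1_of_deriv _ _ _ ipP _ sepH T0 _ (fun=> 0)); apply/(is_derivP ipP).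
split; first exact: L2_cst.
move=> t Dt h /=; rewrite (ip0l ipP) add0r.
by rewrite /Rintegral integral0_eq.
Qed.

Lemma tau_cvg_cst x : X x -> tau_cvg ip T (fun=> x) x.
Proof.
move=> [Lu hy]; split; last by move=> z hz; exact: cvg_cst.
rewrite /L2_cvg (_ : (fun _ => _) = fun=> 0%E); first exact: cvg_cst.
apply/funext => n; rewrite integral0_eq// => t _.
by rewrite subrr normr0 expr0n.
Qed.

Lemma tau_cvg_Xeq (xn : nat -> (R -> H) * (R -> H)) x x' : X x -> X x' ->
  Xeq T x' x -> tau_cvg ip T xn x' -> tau_cvg ip T xn x.
Proof.
move=> [Lu hy] [Lu' hy'] [eu ey] [c1 c2]; split.
  rewrite /L2_cvg; under eq_fun => n.
    rewrite (_ : (\int[mu]_(t in D) _)%E =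
      (\int[mu]_(t in D) (`|(xn n).1 t - x'.1 t| ^+ 2)%:E)%E); first by over.
    by apply: ae_eq_integral_nm; apply: filterS eu => t eu Dt; rewrite eu.
  exact: c1.
move=> z hz; rewrite (_ : H1_ip ip T x.2 z = H1_ip ip T x'.2 z); first exact: c2.
rewrite /H1_ip; congr (_ + _)%E; apply: ae_eq_integral_nm.
  by apply: aeW => t Dt; rewrite ey.
by apply: filterS (dH1_eq_ae ipP sepH T0 hy' hy ey) => t h Dt; rewrite h.
Qed.

Lemma compact_X (xn : nat -> (R -> H) * (R -> H)) (C : R) : (forall n, X (xn n)) ->
  (forall n, (F (xn n).1 (xn n).2 < +oo)%E) ->
  (forall n, (G (xn n).1 (xn n).2 <= C%:E)%E) ->
  exists2 s : nat -> nat, {homo s : m n / (m < n)%N >-> (m < n)%N} &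
    exists2 x, X x & tau_cvg ip T (fun n => xn (s n)) x.
Proof.
move=> hX hF hG.
have [s1 s1inc [u Uu cu]] := U_compact (fun n => F_U (hX n) (hF n)).
have [s2 s2inc [y [hy cy _]]] := @G_compact (fun n => (xn (s1 n)).1) (fun n => (xn (s1 n)).2) u C (U_L2 Uu) cu (fun n => hG (s1 n)).
exists (s1 \o s2); first by move=> m n mn; apply: s1inc; exact: s2inc.
exists (u, y); first by split => //; exact: U_L2.
split => //; exact: (cvg_subseq s2inc cu).
Qed.

Lemma E_ge0 eps x : 0 < eps -> X x -> (0 <= E eps x.1 x.2)%E.
Proof.
by move=> e0 hx; rewrite /E_eps adde_ge0 ?F_ge0// mule_ge0// lee_fin invr_ge0 ltW.
Qed.

Lemma F_le_E eps x : 0 < eps -> (F x.1 x.2 <= E eps x.1 x.2)%E.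
Proof. by move=> e0; rewrite /E_eps leeDl// mule_ge0// lee_fin invr_ge0 ltW. Qed.

Lemma G_le_E eps x (c : R) : 0 < eps -> X x -> (E eps x.1 x.2 <= c%:E)%E ->
  (G x.1 x.2 <= (eps * c)%:E)%E.
Proof.
move=> e0 hx; rewrite /E_eps => h.
have : ((eps^-1)%:E * G x.1 x.2 <= c%:E)%E by apply: le_trans h; rewrite leeDr// F_ge0.
case: (G x.1 x.2) (G_ge0 x.1 x.2) => [g _| |]//.
  by rewrite -EFinM !lee_fin ler_pdivrMl.
by rewrite gt0_muley ?lte_fin ?invr_gt0// leye_eq.
Qed.

Lemma E_lsc eps : 0 < eps -> tau_lsc ip T (E eps).
Proof.
move=> e0 xn x hxn hx cx; have ei : 0 < eps^-1 by rewrite invr_gt0.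
apply: le_trans (le_limn_einfD _ _); last 2 first.
- by move=> n; exact: F_ge0.
- by move=> n; apply: mule_ge0 => //; rewrite lee_fin ltW.
apply: leeD; first exact: F_lsc.
by apply: limn_einfZ_ge => //; exact: G_lsc.
Qed.

Lemma infX_ge0 eps : 0 < eps -> (0 <= infX ip T (E eps))%E.
Proof. by move=> e0; apply: le_ereal_inf_tmp => _ [x hx <-]; exact: E_ge0. Qed.

Lemma infX_le eps x : X x -> (infX ip T (E eps) <= E eps x.1 x.2)%E.
Proof. by move=> hx; apply: ereal_inf_lbound; exists x. Qed.

Lemma minimizer_exists eps : 0 < eps -> exists x, is_minimizer ip T (E eps) x.
Proof.
move=> e0; have [ioo|] := ltP (infX ip T (E eps)) +oo%E; last first.
  move=> ioo; exists (fun=> 0, fun=> 0); split; first exact: Xset0.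
  by move=> x' hx'; apply: le_trans (leey _) _; apply: le_trans ioo _; exact: infX_le.
have ifin : infX ip T (E eps) = (fine (infX ip T (E eps)))%:E.
  by rewrite fineK// ge0_fin_numE// infX_ge0.
set i := fine _ in ifin.
have /choice[xn xnP] : forall n : nat, exists x, X x /\ (E eps x.1 x.2 <= (i + n.+1%:R^-1)%:E)%E.
  move=> n; have : (infX ip T (E eps) < (i + n.+1%:R^-1)%:E)%E.
    by rewrite ifin lte_fin ltrDl invr_gt0 ltr0n.
  by move=> /ereal_inf_lt[_ [x hx <-] /ltW h]; exists x.
have xn1 n : (E eps (xn n).1 (xn n).2 <= (i + 1)%:E)%E.
  apply: le_trans (xnP n).2 _; rewrite lee_fin lerD2l.
  by rewrite invf_le1 ?ler1n// ltr0n.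
have [|||s sinc [x hx cx]] := @compact_X xn (eps * (i + 1)).
- by move=> n; case: (xnP n).
- move=> n; apply: le_lt_trans (F_le_E _ e0) _; apply: le_lt_trans (xn1 n) _.
  exact: ltry.
- by move=> n; apply: G_le_E => //; case: (xnP n).
exists x; split => // x' hx'; apply: le_trans (infX_le eps hx').
apply: le_trans (E_lsc e0 (fun n => (xnP (s n)).1) hx cx) _.
rewrite ifin; apply/lee_addgt0Pr => e e'0; apply: limn_einf_le.
have [N _ hN] := near_infty_natSinv_lt (PosNum e'0).
exists N => // n /= Nn; apply: le_trans (xnP (s n)).2 _.
rewrite -EFinD lee_fin lerD2l; apply/ltW/hN.
exact: leq_trans Nn (increasing_ge_id sinc n).
Qed.

(** Along a subsequence with energies below [c], [G] is at most [eps * c] and tends to 0, so that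
    [G] vanishes at [x] by lower semicontinuity; and [F] is at most the energy. *)
Lemma gamma_liminf (eps : nat -> R) (xn : nat -> (R -> H) * (R -> H)) x :
  (forall n, 0 < eps n) -> eps @ \oo --> (0 : R) ->
  (forall n, X (xn n)) -> X x -> tau_cvg ip T xn x ->
  (E0 x.1 x.2 <= limn_einf (fun n => E (eps n) (xn n).1 (xn n).2))%E.
Proof.
move=> e0 ce hxn hx cx; rewrite leNgt; apply/negP => lt.
have l0 : (0 <= limn_einf (fun n => E (eps n) (xn n).1 (xn n).2))%E.
  by apply: le_limn_einf; apply: nearW => n; exact: E_ge0.
have [c lc cE] : exists2 c : R, (limn_einf (fun n => E (eps n) (xn n).1 (xn n).2) < c%:E)%E &
    (c%:E < E0 x.1 x.2)%E.
  move: lt l0; set l := limn_einf _; case: l => [r| |]//; last by rewrite ltNge leey.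
  case: (E0 x.1 x.2) => [v| |]//.
    by rewrite lte_fin => rv _; exists ((r + v) / 2); rewrite lte_fin; lra.
  by move=> _ _; exists (r + 1); rewrite ?ltry// lte_fin ltrDl.
have [s sinc sc] := limn_einf_lt_subseq lc.
have cs := tau_cvg_subseq sinc cx.
have c0 : 0 <= c.
  by rewrite -lee_fin; apply: le_trans (ltW (sc 0%N)); exact: E_ge0.
have G0 : G x.1 x.2 = 0%E.
  apply/eqP; rewrite eq_le G_ge0 andbT.
  apply: le_trans (G_lsc (fun n => hxn (s n)) hx cs) _.
  apply/lee_addgt0Pr => e e'0; rewrite add0e; apply: limn_einf_le.
  have c1 : 0 < c + 1 by rewrite ltr_wpDl.
  have ec : 0 < e / (c + 1) by rewrite divr_gt0.
  have /cvgrPdist_lt/(_ _ ec) := cvg_subseq sinc ce; apply: filterS => n.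
  rewrite sub0r normrN gtr0_norm// ltr_pdivlMr// => h.
  apply: le_trans (G_le_E (e0 (s n)) (hxn (s n)) (ltW (sc n))) _.
  rewrite lee_fin; apply: le_trans (ltW h).
  by rewrite ler_pM2l// lerDl.
move: cE; rewrite /E_0 G0 eqxx ltNge => /negP; apply.
apply: le_trans (F_lsc (fun n => hxn (s n)) hx cs) _.
apply: limn_einf_le; apply: nearW => n.
exact: le_trans (F_le_E _ (e0 (s n))) (ltW (sc n)).
Qed.

(** Constant sequences are recovery sequences: where [G = 0] the energy does not depend on [eps],
    and elsewhere [E0] is infinite. *)
Lemma gamma_cvg_E : gamma_cvg ip T E E0.
Proof.
move=> eps e0 ce; split; first by move=> xn x; exact: gamma_liminf.
move=> x hx; exists (fun=> x); split => //; split; first exact: tau_cvg_cst.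
rewrite /E_0; case: eqP => [G0|_]; last exact: leey.
rewrite (_ : (fun n => E (eps n) x.1 x.2) = fun=> F x.1 x.2); last first.
  by apply/funext => n; rewrite /E_eps G0 mule0 adde0.
have [_ ->//] := @cvg_limn_einf_sup R (fun=> F x.1 x.2) (F x.1 x.2) (cvg_cst _).
Qed.

(** A competitor with [G = 0] may not exist. Instead, a point [xb] of finite energy at one parameter
    has finite [F] and [G], so that [eps * E eps] stays bounded at [xb] as [eps] tends to 0; this
    bounds [G] along the quasiminimizers. *)
Lemma quasiminimizers_compact (eps : nat -> R) xn : (forall n, 0 < eps n) ->
  eps @ \oo --> (0 : R) -> quasiminimizers ip T E eps xn ->
  exists2 s : nat -> nat, {homo s : m n / (m < n)%N >-> (m < n)%N} &
    exists2 x, is_minimizer ip T E0 x & tau_cvg ip T (fun n => xn (s n)) x.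
Proof.
move=> e0 ce [hxn qm].
have small (e : R) : 0 < e -> \forall n \near \oo,
    infX ip T (E (eps n)) \is a fin_num /\
    (E (eps n) (xn n).1 (xn n).2 <= infX ip T (E (eps n)) + e%:E)%E.
  move=> e'0; have /fine_cvgP[qfin qc] := qm.
  have /cvgrPdist_lt/(_ e e'0) := qc.
  apply: filterS2 qfin => n; rewrite /= sub0r normrN.
  have := infX_ge0 (e0 n).
  (* An infinite infimum would make the difference infinite, which its convergence to 0 excludes for
     large [n]. *)
  case: (infX _ _ _) => [i _| |]//=; last first.
    by case: (E _ _ _).
  case: (E _ _ _) => [v| |]//= _ /(le_lt_trans (ler_norm _)) h; split => //.
  by rewrite -EFinD lee_fin; lra.
have [N0 _ hN0] := small 1 ltr01.
have [ifin0 _] := hN0 N0 (leqnn N0).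
have [xb hxb Eb] : exists2 x, X x & (E (eps N0) x.1 x.2 < +oo)%E.
  have : (infX ip T (E (eps N0)) < +oo)%E by rewrite -ge0_fin_numE// infX_ge0.
  by move=> /ereal_inf_lt[_ [x hx <-] h]; exists x.
have Ebfin : E (eps N0) xb.1 xb.2 = (fine (E (eps N0) xb.1 xb.2))%:E.
  by rewrite fineK// ge0_fin_numE// E_ge0.
set cb := fine _ in Ebfin.
have [f Ff] : exists f : R, F xb.1 xb.2 = f%:E.
  exists (fine (F xb.1 xb.2)); rewrite fineK// ge0_fin_numE ?F_ge0//.
  exact: le_lt_trans (F_le_E xb (e0 N0)) Eb.
have [g Gg] : exists g : R, G xb.1 xb.2 = g%:E.
  exists (fine (G xb.1 xb.2)); rewrite fineK// ge0_fin_numE//.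
  have := @G_le_E (eps N0) xb cb (e0 N0) hxb; rewrite Ebfin => /(_ (lexx _)).
  by move=> /le_lt_trans; apply; exact: ltry.
have f0 : 0 <= f by rewrite -lee_fin -Ff F_ge0.
have g0 : 0 <= g by rewrite -lee_fin -Gg G_ge0.
have [N1 _ hN1] : \forall n \near \oo, eps n < 1.
  have /cvgrPdist_lt/(_ 1 ltr01) := ce; apply: filterS => n.
  by rewrite sub0r normrN gtr0_norm.
pose N := maxn N0 N1.
have Ele n : (N <= n)%N -> (E (eps n) (xn n).1 (xn n).2 <= (f + g / eps n + 1)%:E)%E.
  rewrite /N geq_max => /andP[Nn _]; have [_ h] := hN0 n Nn.
  apply: le_trans h _; rewrite EFinD leeD2r//.
  apply: le_trans (infX_le _ hxb) _.
  by rewrite /E_eps Ff Gg -EFinM -EFinD lee_fin mulrC.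
(* For [eps < 1], [eps * (f + g / eps + 1)] is at most [f + g + 1]. *)
have [|||s sinc [x hx cx]] := @compact_X (fun n => xn (n + N)%N) (f + g + 1).
- by [].
- move=> n; apply: le_lt_trans (F_le_E _ (e0 (n + N)%N)) _.
  by apply: le_lt_trans (Ele _ (leq_addl _ _)) _; exact: ltry.
- move=> n; have Nn : (N <= n + N)%N by rewrite leq_addl.
  apply: le_trans (G_le_E (e0 (n + N)%N) (hxn _) (Ele _ Nn)) _.
  rewrite lee_fin.
  have e1 : eps (n + N)%N < 1.
    by apply: hN1; rewrite /= (leq_trans _ Nn)// /N leq_maxr.
  have -> : eps (n + N)%N * (f + g / eps (n + N)%N + 1) = eps (n + N)%N * (f + 1) + g.
    by field; rewrite gt_eqF.
  have : eps (n + N)%N * (f + 1) <= f + 1 by rewrite ler_piMl ?addr_ge0// ltW.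
  by lra.
pose s' n := (s n + N)%N.
have s'inc : {homo s' : m n / (m < n)%N >-> (m < n)%N}.
  by move=> m n mn; rewrite /s' ltn_add2r; exact: sinc.
exists s' => //; exists x => //; split => // x' hx'.
have [G0|nG0] := eqVneq (G x'.1 x'.2) 0%E; last by rewrite [leRHS]/E_0 (negbTE nG0) leey.
apply: le_trans (@gamma_liminf (fun n => eps (s' n)) (fun n => xn (s' n)) x _ _ _ hx cx) _ => //.
  exact: (cvg_subseq s'inc ce).
rewrite /E_0 G0 eqxx; apply/lee_addgt0Pr => e e'0; apply: limn_einf_le.
have [N2 _ hN2] := small e e'0; exists N2 => // n /= Nn.
have [_ h] := hN2 _ (leq_trans Nn (increasing_ge_id s'inc n)).
apply: le_trans h _; rewrite leeD2r//; apply: le_trans (infX_le _ hx') _.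
by rewrite /E_eps G0 mule0 adde0.
Qed.

(** Each subsequence is again quasiminimizing for the extracted parameters, hence has a further
    subsequence that converges to a minimizer, which is [x] up to [Xeq]. *)
Lemma quasiminimizers_cvg x : is_minimizer ip T E0 x ->
  (forall x', is_minimizer ip T E0 x' -> Xeq T x' x) ->
  forall (eps : nat -> R) xn, (forall n, 0 < eps n) -> eps @ \oo --> (0 : R) ->
    quasiminimizers ip T E eps xn -> tau_cvg ip T xn x.
Proof.
move=> mx ux eps xn e0 ce [hxn qm].
have sub (s : nat -> nat) : {homo s : m n / (m < n)%N >-> (m < n)%N} ->
    exists2 s' : nat -> nat, {homo s' : m n / (m < n)%N >-> (m < n)%N} &
      tau_cvg ip T (fun n => xn (s (s' n))) x.
  move=> sinc.
  have [|||s' s'inc [x' mx' cx']] := @quasiminimizers_compact (fun n => eps (s n)) (fun n => xn (s n)).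
  - by [].
  - exact: (cvg_subseq sinc ce).
  - by split => //; exact: (cvg_subseq sinc qm).
  exists s' => //; apply: tau_cvg_Xeq (ux _ mx') cx'; first by case: mx.
  by case: mx'.
split; first by apply: cvg_subsubseq => s /sub[s' s'inc [c1 _]]; exists s'.
by move=> z hz; apply: cvg_subsubseq => s /sub[s' s'inc [_ c2]]; exists s' => //; exact: c2.
Qed.

End penalization.

Theorem theorem4p1 (R : realType) (H : completeNormedModType R) (ip : H -> H -> R)
  (T : R) (phi1 : H -> \bar R) (phi2 : H -> R) (y0 : H)
  (U : set (R -> H)) (F : (R -> H) -> (R -> H) -> \bar R) :
  is_inner_product ip ->
  separable_space (H := H) ->
  0 < T ->
  (* phi1 proper, convex, lsc, with single-valued subdifferential *)
  proper_fun phi1 -> convex_fun phi1 -> lower_semicontinuous phi1 ->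
  (forall y a b, frechet_subdiff ip phi1 y a -> frechet_subdiff ip phi1 y b -> a = b) ->
  (* phi2 in C^{1,1}(H) *)
  C11 ip phi2 ->
  (* phi = phi1 + phi2 has compact sublevels and satisfies the chain rule *)
  compact_sublevels (fun x => (phi1 x + (phi2 x)%:E)%E) ->
  chain_rule ip T (fun x => (phi1 x + (phi2 x)%:E)%E) ->
  (* y0 in D(phi) *)
  ((phi1 y0 + (phi2 y0)%:E) < +oo)%E ->
  (* U nonempty, compact in L^2(0,T;H) *)
  U !=set0 -> U `<=` L2 T ->
  (forall un : nat -> R -> H, (forall n, U (un n)) ->
     exists2 s : nat -> nat, {homo s : m n / (m < n)%N >-> (m < n)%N} &
       exists2 u, U u & L2_cvg T (fun n => un (s n)) u) ->
  (* F : X -> [0,oo], tau-lsc, finite only if u in U *)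
  (forall x, Xset ip T x -> (0 <= F x.1 x.2)%E) ->
  tau_lsc ip T F ->
  (forall x, Xset ip T x -> (F x.1 x.2 < +oo)%E -> U x.1) ->
  let phi := fun x => (phi1 x + (phi2 x)%:E)%E in
  let G := G_DG ip T phi y0 in
  let E := E_eps F G in
  let E0 := E_0 F G in
  (* existence of minimizers of E_eps *)
  (forall eps : R, 0 < eps -> exists x, is_minimizer ip T (E eps) x) /\
  (* Gamma-convergence *)
  gamma_cvg ip T E E0 /\
  (* compactness of quasiminimizers *)
  (forall (eps : nat -> R) xn, (forall n, 0 < eps n) -> eps @ \oo --> (0 : R) ->
     quasiminimizers ip T E eps xn ->
     exists2 s : nat -> nat, {homo s : m n / (m < n)%N >-> (m < n)%N} &
       exists2 x, is_minimizer ip T E0 x & tau_cvg ip T (fun n => xn (s n)) x) /\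
  (* convergence in case of a unique minimizer *)
  (forall x, is_minimizer ip T E0 x ->
     (forall x', is_minimizer ip T E0 x' -> Xeq T x' x) ->
     forall (eps : nat -> R) xn, (forall n, 0 < eps n) -> eps @ \oo --> (0 : R) ->
       quasiminimizers ip T E eps xn -> tau_cvg ip T xn x).
Proof.
move=> ipP sepH T0 pr cv ls sg C2 cs ch hy0 _ UL Uc F0 Fl FU phi G E E0.
have G0 : forall u y, (0 <= G u y)%E by exact: G_ge0.
have Gl : tau_lsc ip T G by exact: G_lsc.
have Gc := G_compact ipP sepH T0 pr cv ls sg C2 cs ch hy0.
split; first by move=> eps e0; exact: (minimizer_exists ipP sepH T0 UL Uc F0 Fl FU G0 Gl Gc).
split; first exact: gamma_cvg_E.
split; first by move=> eps xn; exact: (quasiminimizers_compact UL Uc F0 Fl FU G0 Gl Gc).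
exact: (quasiminimizers_cvg ipP sepH T0 UL Uc F0 Fl FU G0 Gl Gc).
Qed.
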